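(* Let $1<p<\infty$, let $a\in GL^\infty(\mathbb T)$, and let $A$ denote any one of the operators $$T(a)+H(at),\quad T(a)-H(at^{-1}),\quad T(a)+H(a),\quad T(a)-H(a)$$ acting on $H^p$ (here $t$ denotes the function $t\mapsto t$ on $\mathbb T$). Then $$\min\{\dim\ker A,\ \dim\operatorname{coker}A\}=0.$$
   Context: $\mathbb T$ is the unit circle, $L^p=L^p(\mathbb T)$, and $\hat f_n$ denotes the $n$-th Fourier coefficient. $H^p=\{f\in L^p:\hat f_n=0 \text{ for all } n<0\}$, $\overline{H^p}=\{f\in L^p:\hat f_n=0\text{ for all } n>0\}$. $P$ is the Riesz projection $\sum_n\hat f_n t^n\mapsto\sum_{n\ge0}\hat f_nt^n$ (bounded from $L^p$ onto $H^p$ for $1<p<\infty$), $Q=I-P$, $(Jf)(t)=t^{-1}f(t^{-1})$, and $\tilde a(t)=a(1/t)$. For $a\in L^\infty$ the Toeplitz operator on $H^p$ is $T(a)f=P(af)$ and the Hankel operator is $H(a)f=P(a\,QJf)$. $GL^\infty$ denotes the invertible elements of $L^\infty(\mathbb T)$. $\operatorname{coker}A$ is $H^p/\overline{\operatorname{im}A}$ (equivalently its dimension is that of the kernel of the adjoint). *)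

(* Defs.v *)
From mathcomp Require Import all_boot all_order all_algebra.
From mathcomp Require Import all_classical all_reals all_analysis.
From mathcomp Require Import complex.
Set Implicit Arguments. Unset Strict Implicit. Unset Printing Implicit Defensive.
Import Order.TTheory GRing.Theory Num.Theory.
Local Open Scope classical_set_scope.
Local Open Scope ring_scope.
Local Open Scope complex_scope.

(* Functions on the unit circle T are represented as functions C -> C
   (C = R[i]); only their values on T matter.  T is parametrized by
   theta in [0, 2 pi] via theta |-> e^{i theta}, with Lebesgue measure. *)

Section TH.
Variable R : realType.
Local Notation C := R[i].
Local Notation mu := (@lebesgue_measure R).

Definition circ_pt (x : R) : C := (cos x +i* sin x)%C.

Definition Tdom : set R := `[0, pi *+ 2].

Definition cabs (z : C) : R := Num.sqrt (complex.Re z ^+ 2 + complex.Im z ^+ 2).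

Definition cmeasurable (f : C -> C) : Prop :=
  measurable_fun Tdom (fun x => complex.Re (f (circ_pt x))) /\
  measurable_fun Tdom (fun x => complex.Im (f (circ_pt x))).

Definition lpint (p : R) (f : C -> C) : \bar R :=
  (\int[mu]_(x in Tdom) ((cabs (f (circ_pt x))) `^ p)%:E)%E.

Definition Lp (p : R) (f : C -> C) : Prop :=
  cmeasurable f /\ (lpint p f < +oo)%E.

Definition Linf (f : C -> C) : Prop :=
  cmeasurable f /\
  exists M : R, {ae mu, forall x, Tdom x -> cabs (f (circ_pt x)) <= M}.

Definition GLinf (a : C -> C) : Prop :=
  Linf a /\ exists b, Linf b /\
    {ae mu, forall x, Tdom x -> a (circ_pt x) * b (circ_pt x) = 1}.

Definition fourier (f : C -> C) (n : int) : C :=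
  ((pi *+ 2)^-1)%:C *
  ((Rintegral mu Tdom (fun x => complex.Re (f (circ_pt x) * circ_pt x ^ (- n))))%:C
   + 'i * (Rintegral mu Tdom (fun x => complex.Im (f (circ_pt x) * circ_pt x ^ (- n))))%:C).

Definition Hp (p : R) (f : C -> C) : Prop :=
  Lp p f /\ forall n : int, n < 0 -> fourier f n = 0.

Definition is_P (p : R) (f g : C -> C) : Prop :=
  Hp p g /\ forall n : int, 0 <= n -> fourier g n = fourier f n.

Definition is_Q (p : R) (f g : C -> C) : Prop :=
  Lp p g /\ (forall n : int, 0 <= n -> fourier g n = 0) /\
  (forall n : int, n < 0 -> fourier g n = fourier f n).

Definition Jop (f : C -> C) : C -> C := fun t => t^-1 * f (t^-1).

Definition Toep (p : R) (a f g : C -> C) : Prop :=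
  is_P p (fun t => a t * f t) g.

Definition Hank (p : R) (a f g : C -> C) : Prop :=
  exists q, is_Q p (Jop f) q /\ is_P p (fun t => a t * q t) g.

Definition TH_op (p : R) (a : C -> C) (s : C) (b f g : C -> C) : Prop :=
  exists g1 g2, Toep p a f g1 /\ Hank p b f g2 /\
    forall t, g t = g1 t + s * g2 t.

(* dim ker A = 0 on H^p  (equality in L^p, i.e. a.e.) *)
Definition ker_trivial (p : R) (a : C -> C) (s : C) (b : C -> C) : Prop :=
  forall f g, Hp p f -> TH_op p a s b f g -> lpint p g = 0%E -> lpint p f = 0%E.

Definition coker_trivial (p : R) (a : C -> C) (s : C) (b : C -> C) : Prop :=
  forall h, Hp p h -> forall eps : R, 0 < eps ->
    exists f g, Hp p f /\ TH_op p a s b f g /\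
      (lpint p (fun t => (g t - h t)%R) < eps%:E)%E.

End TH.

(* Main.v *)
(* The four operators are A f = T(a) f + s H(a t^j) f with (j, s) = (1, 1),
   (-1, -1), (0, 1), (0, -1). For f in H^p one has QJf = Jf, so A f = P (a phi) with
   phi = f + s t^j Jf, and phi (1/t) = s t^(1 - j) phi (t).

   If A f = 0, then f_- = a phi has its spectrum in n < 0. If A does not have dense
   range, some nonzero v in L^q annihilates every a (P + s t^j JP) and every
   t^-1 Q(1/t), with P and Q polynomials. The latter says that v has its spectrum in
   n <= 0; the former says that half of the Fourier coefficients of
   w (t) = a (t) v (t) + s t^(1 - j) (a v) (1/t) vanish, and the others follow by the
   symmetry w (1/t) = s t^(j - 1) w (t), so w = 0. Hence 0 = phi w = h + h (1/t) with
   h = f_- v, whose spectrum lies in n < 0, so h = 0. Leading coefficients multiply,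
   so f_- = 0 or v = 0, and f_- = 0 forces phi = 0 and f = 0.

   The Riesz projection is bounded by a subharmonicity argument: if u + iv is
   analytic with v = 0 at the origin and E is subharmonic with |x|^p <= E (x, 0) and
   E (x, y) <= K |x|^p - |x + iy|^p / 2, the mean value inequality for E (u, v) bounds
   the L^p norm of v by that of u. The annihilator v is the derivative of the norm
   at the error of a best approximation, in place of Hahn-Banach and duality. *)
Require Import Defs.
From mathcomp Require Import all_boot all_order all_algebra.
From mathcomp Require Import all_classical all_reals all_analysis.
From mathcomp Require Import measurable_realfun complex ring lra.
Set Implicit Arguments. Unset Strict Implicit. Unset Printing Implicit Defensive.
Import Order.TTheory GRing.Theory Num.Theory.
Import numFieldNormedType.Exports.
Local Open Scope classical_set_scope.
Local Open Scope ring_scope.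

(** * Elementary inequalities *)

Section real_inequalities.
Variable R : realType.
Implicit Types p x y m : R.

Lemma bernoulli_powR p y : 1 < p -> 0 <= y -> y != 1 -> 1 + p * (y - 1) < y `^ p.
Proof.
move=> p1; rewrite le_eqVlt => /predU1P[<- _|y0 y1].
  by rewrite powR0 ?gt_eqF//; lra.
have -> : y `^ p = y * expR ((p - 1) * ln y).
  by rewrite -(mulr_powRB1 (ltW y0)) ?(lt_trans ltr01)// /powR gt_eqF.
have u0 : (p - 1) * ln y != 0 by rewrite mulf_neq0 ?ln_eq0//; lra.
have lny : 1 - y^-1 <= ln y.
  by have := expR_ge1Dx (- ln y); rewrite expRN lnK ?posrE//; lra.
have yV : y * y^-1 = 1 by rewrite mulfV ?gt_eqF.
apply: (@le_lt_trans _ _ (y * (1 + (p - 1) * ln y))).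
  have := ler_wpM2l (ltW y0) (ler_wpM2l (ltW (_ : 0 < p - 1)) lny).
  rewrite subr_gt0 => /(_ p1); nra.
by rewrite ltr_pM2l// expR_gt1Dx.
Qed.

Lemma powR_subgradient p x y : 1 < p -> 0 <= x -> 0 <= y ->
  x `^ p + p * x `^ (p - 1) * (y - x) <= y `^ p.
Proof.
move=> p1 x0 y0; have p0 : 0 < p by rewrite (lt_trans ltr01).
move: x0; rewrite le_eqVlt => /predU1P[<-|x0].
  by rewrite !powR0 ?gt_eqF ?subr_gt0// mulr0 mul0r addr0 powR_ge0.
have xp : x `^ p = x * x `^ (p - 1) by rewrite mulr_powRB1// ltW.
have yE : y = x * (y / x) by rewrite mulrCA mulfV ?mulr1// gt_eqF.
have yx0 : 0 <= y / x by rewrite divr_ge0// ltW.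
have B : 1 + p * (y / x - 1) <= (y / x) `^ p.
  have [->|/(bernoulli_powR p1 yx0)/ltW//] := eqVneq (y / x) 1.
  by rewrite subrr mulr0 addr0 powR1.
have -> : y `^ p = x `^ p * (y / x) `^ p by rewrite -powRM ?(ltW x0)// -yE.
apply: le_trans (ler_wpM2l (powR_ge0 x p) B); rewrite xp.
rewrite le_eqVlt; apply/orP; left; apply/eqP.
by field; rewrite gt_eqF.
Qed.

Definition dpow p x := Num.sg x * `|x| `^ (p - 1).

Lemma dpow_mul p x : 0 < p -> dpow p x * x = `|x| `^ p.
Proof.
by move=> p0; rewrite /dpow -(mulr_powRB1 (normr_ge0 x) p0) mulrAC -normrEsg.
Qed.

Lemma norm_dpow p x : 1 < p -> `|dpow p x| = `|x| `^ (p - 1).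
Proof.
move=> p1; rewrite /dpow normrM [`|_ `^ _|]ger0_norm ?powR_ge0// normr_sg.
by have [->|] := eqVneq x 0; rewrite ?mul1r// normr0 powR0 ?mulr0// gt_eqF ?subr_gt0.
Qed.

Lemma norm_powR_subgradient p x y : 1 < p ->
  `|x| `^ p + p * dpow p x * (y - x) <= `|y| `^ p.
Proof.
move=> p1; have p0 : 0 < p by rewrite (lt_trans ltr01).
apply: le_trans (powR_subgradient p1 (normr_ge0 x) (normr_ge0 y)).
rewrite lerD2l -2!mulrA ler_wpM2l ?(ltW p0)// !mulrBr.
rewrite [`|x| `^ (p-1) * `|x|]mulrC (mulr_powRB1 _ p0)// dpow_mul// lerD2r.
by rewrite (le_trans (ler_norm _))// normrM norm_dpow.
Qed.

Lemma ler_norm_powR p x y : 0 <= p -> `|x| <= `|y| -> `|x| `^ p <= `|y| `^ p.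
Proof. by move=> p0 xy; rewrite ge0_ler_powR// nnegrE. Qed.

Lemma norm_powRD p x y : 0 < p -> `|x + y| `^ p <= 2 `^ p * (`|x| `^ p + `|y| `^ p).
Proof.
move=> p0.
wlog xy : x y / `|x| <= `|y|.
  move=> H; have [/H//|/ltW/H] := leP `|x| `|y|.
  by rewrite addrC [`|y| `^ p + _]addrC.
have : `|x + y| `^ p <= `|2 * y| `^ p.
  apply: ler_norm_powR; first exact: ltW.
  rewrite normrM (ger0_norm (ler0n _ 2)).
  by rewrite (le_trans (ler_normD _ _))//; lra.
rewrite normrM powRM// (ger0_norm (ler0n _ 2)) => /le_trans; apply.
by rewrite ler_wpM2l ?powR_ge0// lerDr powR_ge0.
Qed.

Lemma continuous_norm_powR p : 0 < p -> continuous (fun x : R => `|x| `^ p).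
Proof.
move=> p0 x; have [->|x0] := eqVneq x 0.
  rewrite /continuous_at normr0 powR0 ?gt_eqF//.
  apply/cvgrPdist_lt => /= e e0; near=> z.
  rewrite sub0r normrN ger0_norm ?powR_ge0//.
  rewrite -[ltRHS](@powRr1 _ e) ?(ltW e0)// -(@mulVf _ p) ?gt_eqF// powRrM.
  rewrite gt0_ltr_powR// ?nnegrE ?powR_ge0//.
  near: z; have e'0 : 0 < e `^ p^-1 by rewrite powR_gt0.
  by have := (@cvgr0_norm_lt _ _ _ _ (@nbhs_filter _ (0:R)) id (@cvg_id _ _) _ e'0).
apply: (@continuous_comp _ _ _ (fun x : R => `|x|) (fun x : R => x `^ p)).
  exact: norm_continuous.
apply: differentiable_continuous; apply/derivable1_diffP.
by apply: derivable_powR; rewrite in_itv/= andbT normr_gt0.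
Unshelve. all: end_near. Qed.

Let convgap p x := (`|x| `^ p + 1) / 2 - `|(1 + x) / 2| `^ p.

Let convgap_gt0 p x : 1 < p -> -1 <= x -> x < 1 -> 0 < convgap p x.
Proof.
move=> p1 x1 x2; rewrite subr_gt0.
have m0 : 0 <= (1 + x) / 2 by lra.
rewrite (ger0_norm m0); have [x0|x0] := leP 0 x.
  have m1 : 0 < (1 + x) / 2 by lra.
  set m := (1 + x) / 2 in m0 m1 *.
  have mV : m * m^-1 = 1 by rewrite mulfV ?gt_eqF.
  have n1 : x / m != 1.
    by apply/eqP => /(congr1 (fun z => z * m)); rewrite divfK ?gt_eqF// /m; lra.
  have n2 : m^-1 != 1.
    by apply/eqP => /(congr1 (fun z => z * m)); rewrite mulVf ?gt_eqF// /m; lra.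
  have B1 := bernoulli_powR p1 (divr_ge0 x0 m0) n1.
  have B2 := bernoulli_powR p1 (_ : 0 <= m^-1) n2.
  rewrite invr_ge0 in B2; have {}B2 := B2 m0.
  have S : 2 < (x / m) `^ p + m^-1 `^ p.
    have E : x / m + m^-1 = 2 by rewrite /m; field; rewrite /m in m1; lra.
    have : 1 + p * (x / m - 1) + (1 + p * (m^-1 - 1)) = 2 + p * (x / m + m^-1 - 2) by ring.
    by rewrite E; lra.
  have xE : `|x| `^ p = m `^ p * (x / m) `^ p.
    by rewrite -powRM ?(divr_ge0 x0 m0)// [m * _]mulrC divfK ?gt_eqF// ger0_norm.
  have oE : 1 = m `^ p * m^-1 `^ p.
    by rewrite -powRM ?invr_ge0// mV powR1.
  have : m `^ p * 2 < m `^ p * ((x / m) `^ p + m^-1 `^ p) by rewrite ltr_pM2l ?powR_gt0.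
  by rewrite [_ * (_ + m^-1 `^ p)]mulrDr -xE -oE; lra.
have [<-|m1] := eqVneq 0 ((1 + x) / 2).
  have p0 : 0 < p by rewrite (lt_trans ltr01).
  by rewrite powR0 ?gt_eqF//; have := powR_ge0 `|x| p; lra.
have /ge1r_powR : 0 < (1 + x) / 2 <= 1.
  by apply/andP; split; [rewrite lt_neqAle m1; lra|lra].
move/(_ _ (ltW p1)) => H; have := powR_ge0 `|x| p; lra.
Qed.

Let uniform_convex1 p d : 1 < p -> 0 < d -> exists2 C, 0 <= C &
  forall x, `|x| <= 1 -> `|1 - x| `^ p <= d + C * convgap p x.
Proof.
move=> p1 d0; have p0 : 0 < p by rewrite (lt_trans ltr01).
have gap0 x : `|x| <= 1 -> 0 <= convgap p x.
  rewrite ler_norml => /andP[a]; rewrite le_eqVlt => /predU1P[->|b].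
    by rewrite /convgap normr1 powR1 (_ : (1 + 1) / 2 = 1) ?normr1 ?powR1; lra.
  exact/ltW/convgap_gt0.
pose h := Num.min 1 (d `^ p^-1).
have h0 : 0 < h by rewrite lt_min ltr01 powR_gt0.
have h1 : h <= 1 by rewrite ge_min lexx.
have hd : h `^ p <= d.
  rewrite -[leRHS](@powRr1 _ d) ?(ltW d0)// -(@mulVf _ p) ?gt_eqF// powRrM.
  by rewrite ge0_ler_powR ?nnegrE ?powR_ge0 ?(ltW p0) ?(ltW h0)// ge_min lexx orbT.
have cf : {within `[(-1), 1 - h], continuous (convgap p)}.
  apply: continuous_subspaceT => x.
  apply: cvgB; last first.
    apply: (@continuous_comp _ _ _ (fun x : R => (1 + x) / 2) (fun x : R => `|x| `^ p)).
      by apply: cvgMl; apply: cvgD; [exact: cvg_cst|exact: cvg_id].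
    exact: continuous_norm_powR.
  apply: cvgMl; apply: cvgD; last exact: cvg_cst.
  exact: continuous_norm_powR.
have le1 : (-1 : R) <= 1 - h by lra.
have [c /[!in_itv]/= /andP[c1 c2] cmin] := EVT_min le1 cf.
have gc : 0 < convgap p c by apply: convgap_gt0 => //; lra.
exists (2 `^ p / convgap p c); first by rewrite divr_ge0 ?powR_ge0// ltW.
move=> x x1; have [xh|xh] := leP x (1 - h).
  rewrite (@le_trans _ _ (2 `^ p))//.
    rewrite -[2 in leRHS](@ger0_norm _ 2)//; apply: ler_norm_powR; first exact: ltW.
    by rewrite (ger0_norm (ler0n _ 2)) (le_trans (ler_normB _ _))// normr1; lra.
  apply: ler_wpDl (ltW d0) _.
  rewrite -mulrA ler_peMr ?powR_ge0// mulrC ler_pdivlMr// mul1r cmin//.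
  by rewrite in_itv/= xh andbT; move: x1; rewrite ler_norml => /andP[].
apply: ler_wpDr; first by rewrite mulr_ge0 ?gap0// divr_ge0 ?powR_ge0// ltW.
apply: le_trans hd; rewrite -(ger0_norm (ltW h0)).
apply: ler_norm_powR; first exact: ltW.
by move: x1; rewrite ler_norml => /andP[_ x1]; rewrite !ger0_norm; lra.
Qed.

Lemma norm_powR_uniform_convex p d : 1 < p -> 0 < d -> exists2 C, 0 <= C &
  forall x y, `|x - y| `^ p <= d * (`|x| `^ p + `|y| `^ p)
     + C * ((`|x| `^ p + `|y| `^ p) / 2 - `|(x + y) / 2| `^ p).
Proof.
move=> p1 d0; have p0 : 0 < p by rewrite (lt_trans ltr01).
have [C C0 HC] := uniform_convex1 p1 d0; exists C => // x y.
wlog xy : x y / `|x| <= `|y|.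
  move=> H; have [/H//|/ltW/H] := leP `|x| `|y|.
  by rewrite distrC [y + x]addrC [`|y| `^ p + _]addrC.
have [y0|y0] := eqVneq y 0.
  move: xy; rewrite y0 normr0 normr_le0 => /eqP ->.
  by rewrite subr0 add0r mul0r normr0 powR0 ?gt_eqF//; lra.
have xE : x = y * (x / y) by rewrite mulrCA mulfV ?mulr1.
have t1 : `|x / y| <= 1 by rewrite normf_div ler_pdivrMr ?normr_gt0// mul1r.
move: (x / y) xE t1 => t -> {x xy} t1.
have -> : y * t - y = y * (t - 1) by ring.
have -> : (y * t + y) / 2 = y * ((1 + t) / 2) by ring.
rewrite (normrM y t) (normrM y (t - 1)) (normrM y ((1 + t) / 2)) !powRM//; set Y := `|y| `^ p.
have Y0 : 0 <= Y by exact: powR_ge0.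
have := ler_wpM2l Y0 (HC t t1); rewrite distrC /convgap.
have := powR_ge0 `|t| p.
set a := `|t| `^ p; set b := `|t - 1| `^ p; set c := `|(1 + t) / 2| `^ p => a0 H.
apply: le_trans H _.
rewrite [leLHS](_ : _ = d * Y + C * ((Y * a + Y) / 2 - Y * c)); last by field.
by rewrite lerD2r ler_wpM2l ?(ltW d0)//; nra.
Qed.

Lemma norm_powRD_eps p d : 1 < p -> 0 < d -> exists2 C, 0 <= C &
  forall x y, `|x + y| `^ p <= (1 + d) * `|x| `^ p + C * `|y| `^ p.
Proof.
move=> p1 d0; have p0 : 0 < p by rewrite (lt_trans ltr01).
pose k := (1 + d) `^ p^-1.
have k1 : 1 < k.
  have -> : 1 = 1 `^ p^-1 :> R by rewrite powR1.
  by rewrite /k gt0_ltr_powR ?invr_gt0 ?nnegrE//; lra.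
have kp : k `^ p = 1 + d.
  by rewrite /k -powRrM mulVf ?gt_eqF// powRr1; lra.
pose M := k / (k - 1).
have M0 : 0 <= M by rewrite divr_ge0; lra.
exists (M `^ p); first exact: powR_ge0.
move=> x y; have [xy|xy] := leP `|y| ((k - 1) * `|x|).
  apply: ler_wpDr; first by rewrite mulr_ge0 ?powR_ge0.
  rewrite -kp -powRM//; last lra.
  rewrite ge0_ler_powR ?nnegrE ?(ltW p0)//; first by rewrite mulr_ge0//; lra.
  by rewrite (le_trans (ler_normD _ _))//; lra.
apply: ler_wpDl; first by rewrite mulr_ge0 ?powR_ge0//; lra.
rewrite -powRM// ge0_ler_powR ?nnegrE ?(ltW p0)//; first by rewrite mulr_ge0.
rewrite (le_trans (ler_normD _ _))// /M mulrAC ler_pdivlMr; last lra.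
nra.
Qed.

Lemma young_eps p q d : 1 < p -> p^-1 + q^-1 = 1 -> 0 < d -> exists2 C, 0 <= C &
  forall x y, `|x * y| <= C * `|x| `^ p + d * `|y| `^ q.
Proof.
move=> p1 pq d0; have p0 : 0 < p by rewrite (lt_trans ltr01).
have ip : p^-1 < 1 by rewrite invf_lt1.
have q0 : 0 < q by rewrite -invr_gt0; lra.
have iq : q^-1 < 1 by have : 0 < p^-1 by [rewrite invr_gt0]; lra.
pose l := d `^ q^-1.
have l0 : 0 < l by rewrite powR_gt0.
have lq : l `^ q = d by rewrite /l -powRrM mulVf ?gt_eqF// powRr1// ltW.
exists (l^-1 `^ p); first exact: powR_ge0.
move=> x y.
have := @conjugate_powR _ (l^-1 * `|x|) (l * `|y|) p q.
rewrite mulrACA mulVf ?gt_eqF// mul1r -normrM !powRM ?invr_ge0 ?(ltW l0)// lq.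
rewrite !mulr_ge0 ?invr_ge0 ?(ltW l0)// => /(_ isT isT p0 q0 pq) /le_trans; apply.
by apply: lerD; rewrite ler_piMr ?mulr_ge0 ?powR_ge0 ?ltW.
Qed.

End real_inequalities.

(** * Integrals and completeness *)

Section real_integrals.
Context d (T : measurableType d) (R : realType).
Variables (mu : {measure set T -> \bar R}) (D : set T).
Hypothesis mD : measurable D.
Implicit Types f g : T -> R.
Local Notation intble f := (mu.-integrable D (EFin \o f)).

Lemma intble_measurable f : intble f -> measurable_fun D f.
Proof. by move=> /integrableP[/measurable_EFinP]. Qed.

Lemma measurable_norm_powR f p : measurable_fun D f ->
  measurable_fun D (fun x => `|f x| `^ p).
Proof.
move=> mf; apply: (@measurableT_comp _ _ _ _ _ _ (fun z : R => z `^ p) D (fun x => `|f x|)).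
  exact: measurable_powR.
exact: measurableT_comp.
Qed.

Lemma ae_dominated_integrable f g : measurable_fun D f -> intble g ->
  {ae mu, forall x, D x -> `|f x| <= g x} -> intble f.
Proof.
move=> mf ig fg; apply/integrableP; split; first exact/measurable_EFinP.
have mg := intble_measurable ig.
case/integrableP: ig => _; apply: le_lt_trans.
apply: ae_ge0_le_integral => //.
- by apply: measurableT_comp => //; exact/measurable_EFinP.
- by apply: measurableT_comp => //; exact/measurable_EFinP.
- apply: filterS fg => x fg Dx; rewrite /= lee_fin.
  exact: le_trans (fg Dx) (ler_norm _).
Qed.

Lemma dominated_integrable f g : measurable_fun D f -> intble g ->
  (forall x, D x -> `|f x| <= g x) -> intble f.
Proof. by move=> mf ig fg; apply: ae_dominated_integrable mf ig (aeW _ fg). Qed.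

Lemma eq_intble f g : (forall x, D x -> f x = g x) -> intble f -> intble g.
Proof.
move=> fg; apply: eq_integrable => // x /[!inE] Dx /=.
by rewrite fg.
Qed.

Lemma intbleD f g : intble f -> intble g -> intble (f \+ g).
Proof. by move=> i j; apply: eq_integrable (integrableD mD i j). Qed.

Lemma intbleB f g : intble f -> intble g -> intble (f \- g).
Proof. by move=> i j; apply: eq_integrable (integrableB mD i j). Qed.

Lemma intbleZ c f : intble f -> intble (fun x => c * f x).
Proof. by move=> i; apply: eq_integrable (integrableZl mD c i). Qed.

Lemma integral_EFin f : intble f ->
  (\int[mu]_(x in D) (f x)%:E)%E = (\int[mu]_(x in D) f x)%:E.
Proof. by move=> fi; rewrite /Rintegral fineK//; exact: integrable_fin_num. Qed.

Lemma Rintegral_ae_eq f g : measurable_fun D f -> measurable_fun D g ->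
  {ae mu, forall x, D x -> f x = g x} ->
  \int[mu]_(x in D) f x = \int[mu]_(x in D) g x.
Proof.
move=> mf mg fg; congr fine; apply: ae_eq_integral => //; try exact/measurable_EFinP.
by apply: filterS fg => x /[apply] /= ->.
Qed.

Lemma le_Rintegral_ae f g : intble f -> intble g ->
  {ae mu, forall x, D x -> f x <= g x} ->
  \int[mu]_(x in D) f x <= \int[mu]_(x in D) g x.
Proof.
move=> fi gi fg; have mf := intble_measurable fi; have mg := intble_measurable gi.
have mm : measurable_fun D (fun x => Num.max (f x) (g x)) by exact: measurable_maxr.
have E : {ae mu, forall x, D x -> Num.max (f x) (g x) = g x}.
  by apply: filterS fg => x /[apply] /max_r.
rewrite -(Rintegral_ae_eq mm mg E); apply: le_Rintegral => //.
  apply: (ae_dominated_integrable mm (g := fun x => `|g x|)).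
    exact: integrable_norm gi.
  by apply: filterS E => x /[apply] ->.
by move=> x _; rewrite le_max lexx.
Qed.

Lemma norm_Rintegral_le f g : measurable_fun D f -> intble g ->
  {ae mu, forall x, D x -> `|f x| <= g x} ->
  `|\int[mu]_(x in D) f x| <= \int[mu]_(x in D) g x.
Proof.
move=> mf ig fg; have fi := ae_dominated_integrable mf ig fg.
apply: le_trans (le_normr_Rintegral mD fi) _.
by apply: le_Rintegral_ae => //; exact: integrable_norm fi.
Qed.

Lemma dominated_cvg_Rintegral (f_ : nat -> T -> R) f g :
  (forall n, measurable_fun D (f_ n)) -> measurable_fun D f -> intble g ->
  (forall n, {ae mu, forall x, D x -> `|f_ n x| <= g x}) ->
  {ae mu, forall x, D x -> f_ n x @[n --> \oo] --> f x} ->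
  \int[mu]_(x in D) f_ n x @[n --> \oo] --> \int[mu]_(x in D) f x.
Proof.
move=> mf_ mf ig fg cf.
have fg' : {ae mu, forall x n, D x -> (`|(f_ n x)%:E| <= (g x)%:E)%E}.
  apply: filterS (ae_foralln fg) => x H n Dx.
  by rewrite lee_fin H.
have cf' : {ae mu, forall x, D x -> (f_ n x)%:E @[n --> \oo] --> (f x)%:E}.
  by apply: filterS cf => x /[apply] cf; apply: cvg_EFin => //; exact: nearW.
have [ifn _ H] := @dominated_convergence _ _ _ mu D mD (fun n => EFin \o f_ n)
  (EFin \o f) (EFin \o g) (fun n => proj2 (measurable_EFinP _ _) (mf_ n))
  (proj2 (measurable_EFinP _ _) mf) cf' ig fg'.
apply: fine_cvg; rewrite fineK//; exact: integrable_fin_num.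
Qed.

End real_integrals.

Lemma limn_einf_le (R : realType) (u : nat -> \bar R) (e : \bar R) :
  (\forall n \near \oo, (u n <= e)%E) -> (limn_einf u <= e)%E.
Proof.
move=> ue; rewrite limn_einf_lim; apply: lime_le; first exact: is_cvg_einfs.
apply: filterS ue => n; apply: le_trans.
by apply: ereal_inf_lbound; exists n => //=.
Qed.

Lemma geometric_increments_cvg (R : realType) (u : nat -> R) K :
  (forall j, `|u j.+1 - u j| <= K * (2^-1) ^+ j) -> cvgn u.
Proof.
move=> uK; have K0 : 0 <= K.
  by have := uK 0%N; rewrite expr0 mulr1; exact: le_trans.
have Hs : cvgn (series (telescope u)).
  apply: normed_cvg; apply: (@series_le_cvg _ _ (geometric K 2^-1)).
  - by move=> n /=.
  - by move=> n; apply: geometric_ge0; rewrite ?invr_ge0.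
  - exact: uK.
  - apply: is_cvg_geometric_series; rewrite ger0_norm ?invr_ge0//.
    by rewrite invf_lt1// ltr1n.
have -> : u = (fun n => series (telescope u) n + u 0%N).
  by rewrite telescopeK funeqE => n /=; rewrite subrK.
apply: is_cvgD => //; exact: is_cvg_cst.
Qed.

Section Lp_completeness.
Context d (T : measurableType d) (R : realType).
Variables (mu : {measure set T -> \bar R}) (D : set T).
Hypothesis mD : measurable D.
Variables (p : R) (g : nat -> T -> R).
Hypothesis p0 : 0 < p.
Hypothesis mg : forall n, measurable_fun D (g n).
Hypothesis ig : forall n k,
  mu.-integrable D (EFin \o (fun x => `|g n x - g k x| `^ p)).
Hypothesis cg : forall e, 0 < e -> exists n0, forall n k, (n0 <= n)%N -> (n0 <= k)%N ->
  \int[mu]_(x in D) (`|g n x - g k x| `^ p) < e.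

Let r := (2^-1 : R) * 2^-1 `^ p.

Let fast_subsequence : exists phi : nat -> nat,
  (forall j n k, (phi j <= n)%N -> (phi j <= k)%N ->
     \int[mu]_(x in D) (`|g n x - g k x| `^ p) < r ^+ j) /\
  (forall j, (j <= phi j)%N /\ (phi j <= phi j.+1)%N).
Proof.
have r0 : 0 < r by rewrite mulr_gt0 ?powR_gt0 ?invr_gt0.
have /choice[n0 Hn0] : forall j, exists n0, forall n k, (n0 <= n)%N -> (n0 <= k)%N ->
    \int[mu]_(x in D) (`|g n x - g k x| `^ p) < r ^+ j.
  by move=> j; apply: cg; exact: exprn_gt0.
exists (fun j => \max_(i < j.+1) maxn i (n0 i)); split.
  have H j : (n0 j <= \max_(i < j.+1) maxn i (n0 i))%N.
    by rewrite big_ord_recr /= !leq_max leqnn !orbT.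
  by move=> j n k jn jk; apply: Hn0; exact: leq_trans (H j) _.
move=> j; split; first by rewrite big_ord_recr /= !leq_max leqnn orbT.
by rewrite [leqRHS]big_ord_recr /= leq_max leqnn.
Qed.

Let ae_increments (phi : nat -> nat) :
  (forall j n k, (phi j <= n)%N -> (phi j <= k)%N ->
     \int[mu]_(x in D) (`|g n x - g k x| `^ p) < r ^+ j) ->
  (forall j, (j <= phi j)%N /\ (phi j <= phi j.+1)%N) ->
  {ae mu, forall x, D x -> cvgn (fun n => g (phi n) x)}.
Proof.
move=> Hphi phi_mono.
pose h j x := (2 `^ p) ^+ j * `|g (phi j.+1) x - g (phi j) x| `^ p.
have h0 j x : 0 <= h j x by rewrite mulr_ge0 ?exprn_ge0 ?powR_ge0.
have ih j : mu.-integrable D (EFin \o h j) by exact: intbleZ.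
have mh j := intble_measurable (ih j).
have hle j : (\int[mu]_(x in D) (h j x)%:E <= (2 / (2 ^ j.+1)%:R)%:E)%E.
  rewrite (integral_EFin mD (ih j)) lee_fin RintegralZl//.
  apply: (@le_trans _ _ ((2 `^ p) ^+ j * r ^+ j)).
    rewrite ler_wpM2l ?exprn_ge0 ?powR_ge0// ltW//.
    by apply: Hphi => //; have [] := phi_mono j.
  rewrite -exprMn /r mulrCA -powRM// mulfV// powR1 mulr1.
  by rewrite expnS natrM invfM mulrA divff// mul1r natrX exprVn.
have iS : mu.-integrable D (fun x => \sum_(j <oo) (h j x)%:E)%E.
  apply/integrableP; split.
    apply: ge0_emeasurable_sum => [k x Dx _|k _]; first by rewrite lee_fin.
    exact/measurable_EFinP.
  rewrite (eq_integral (fun x => \sum_(j <oo) (h j x)%:E)%E); last first.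
    by move=> x _; rewrite gee0_abs// nneseries_ge0// => n _ _; rewrite lee_fin.
  rewrite integral_nneseries//; last 2 first.
  - by move=> n; exact/measurable_EFinP.
  - by move=> n x Dx; rewrite lee_fin.
  apply: le_lt_trans (ltry (2 : R)).
  apply: le_trans (epsilon_trick0 xpredT (ler0n R 2)).
  apply: lee_nneseries => // n _ _; apply: integral_ge0 => x Dx.
  by rewrite lee_fin.
apply: filterS (integrable_ae mD iS) => x /[apply].
set S := (\sum_(j <oo) _)%E => Sfin.
apply: (@geometric_increments_cvg _ _ (fine S `^ p^-1)) => j.
have hS : h j x <= fine S.
  rewrite -lee_fin fineK//.
  apply: (le_trans _ (nneseries_lim_ge (m := 0) (P := xpredT) j.+1 _)).
    rewrite big_nat_recr//= leeDr// sume_ge0// => i _.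
    by rewrite lee_fin.
  by move=> n _ _; rewrite lee_fin.
have S0 : 0 <= fine S by exact: le_trans hS.
have -> : (2^-1 : R) ^+ j = ((2^-1 `^ p) ^+ j) `^ p^-1.
  rewrite -[X in _ = X `^ _]powR_mulrn ?powR_ge0// -!powRrM.
  have -> : p * (j%:R / p) = j%:R by rewrite mulrC divfK ?gt_eqF.
  by rewrite powR_mulrn.
rewrite -powRM ?exprn_ge0 ?powR_ge0//.
set Dl := (X in X <= _); have -> : Dl = (Dl `^ p) `^ p^-1.
  by rewrite -powRrM mulfV ?gt_eqF// powRr1 /Dl.
rewrite ge0_ler_powR ?invr_ge0 ?(ltW p0) ?nnegrE ?powR_ge0//.
  by rewrite mulr_ge0 ?exprn_ge0 ?powR_ge0.
have := ler_wpM2r (exprn_ge0 j (powR_ge0 (2^-1 : R) p)) hS.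
have E : (2 `^ p) ^+ j * (2^-1 `^ p) ^+ j = 1 :> R.
  by rewrite -exprMn -powRM// mulfV// powR1 expr1n.
by rewrite /h [_ * _ * (_ ^+ j)]mulrAC E mul1r.
Qed.

Lemma Lp_complete : exists phi : nat -> nat,
  let G x := fine (limn_esup (fun n => (g (phi n) x)%:E)) in
  measurable_fun D G /\
  forall e, 0 < e -> exists n0, forall n, (n0 <= n)%N ->
    mu.-integrable D (EFin \o (fun x => `|g n x - G x| `^ p)) /\
    \int[mu]_(x in D) (`|g n x - G x| `^ p) <= e.
Proof.
have [phi [Hphi phi_mono]] := fast_subsequence.
exists phi => G; have cv := ae_increments Hphi phi_mono.
have mG : measurable_fun D G.
  have H : measurable_fun D (fun x => limn_esup (fun n => (g (phi n) x)%:E)).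
    by apply: measurable_fun_limn_esup => n; exact/measurable_EFinP.
  by apply: (measurableT_comp _ H); exact: fine_measurable.
split => // e e0; have [n0 Hn0] := cg e0; exists n0 => n nn0.
have mf k : measurable_fun D (fun x => `|g n x - g k x| `^ p).
  by exact: intble_measurable (ig n k).
have mfG : measurable_fun D (fun x => `|g n x - G x| `^ p).
  by apply: measurable_norm_powR; exact: measurable_funB.
have le_e : (\int[mu]_(x in D) (`|g n x - G x| `^ p)%:E <= e%:E)%E.
  rewrite (@ae_eq_integral _ _ _ _ _
    (fun x => limn_einf (fun k => (`|g n x - g (phi k) x| `^ p)%:E)))//; last 3 first.
  - exact/measurable_EFinP.
  - rewrite (_ : (fun x => _) = (fun x => - limn_esup (fun k => - (`|g n x - g (phi k) x| `^ p)%:E))%E); last first.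
      by rewrite funeqE => x; rewrite /limn_einf.
    apply: measurableT_comp => //; apply: measurable_fun_limn_esup => k.
    apply: measurableT_comp => //; exact/measurable_EFinP.
  - apply: filterS cv => x /[apply] cx.
    have /cvg_ex[l ul] := cx.
    have Gl : G x = l.
      have H : (g (phi k) x)%:E @[k --> \oo] --> l%:E by apply: cvg_EFin => //; exact: nearW.
      by rewrite /G (cvg_limn_einf_sup H).2.
    have H : (`|g n x - g (phi k) x| `^ p)%:E @[k --> \oo] --> (`|g n x - G x| `^ p)%:E.
      apply: cvg_EFin; first exact: nearW.
      have H1 : g n x - g (phi k) x @[k --> \oo] --> g n x - G x.
        by rewrite Gl; apply: cvgB => //; exact: cvg_cst.
      apply: (cvg_comp (fun k => g n x - g (phi k) x) (fun z : R => `|z| `^ p) H1).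
      exact: continuous_norm_powR.
    by rewrite (cvg_limn_einf_sup H).1.
  have mf' k : measurable_fun D (fun x => (`|g n x - g (phi k) x| `^ p)%:E).
    exact/measurable_EFinP.
  have f0 (k : nat) x : D x -> (0 <= (`|g n x - g (phi k) x| `^ p)%:E)%E.
    by rewrite lee_fin powR_ge0.
  apply: le_trans (fatou mu mD mf' f0) _.
  apply: limn_einf_le; near=> k.
  rewrite (integral_EFin mD (ig _ _)) lee_fin ltW// Hn0//.
  have [kphi _] := phi_mono k; apply: leq_trans kphi.
  by near: k; exact: nbhs_infty_ge.
have iG : mu.-integrable D (EFin \o (fun x => `|g n x - G x| `^ p)).
  apply/integrableP; split; first exact/measurable_EFinP.
  apply: le_lt_trans (ltry e).
  rewrite (eq_integral (fun x => (`|g n x - G x| `^ p)%:E))// => x _ /=.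
  by rewrite ger0_norm ?powR_ge0.
by split => //; rewrite -lee_fin -(integral_EFin mD iG).
Unshelve. all: end_near. Qed.

End Lp_completeness.

Section complex_parts.
Variable R : realType.
Local Notation C := R[i].
Local Notation Re := complex.Re.
Local Notation Im := complex.Im.
Implicit Types z w : C.

Lemma ReD z w : Re (z + w) = Re z + Re w. Proof. by case: z w => [a b] [c d]. Qed.
Lemma ImD z w : Im (z + w) = Im z + Im w. Proof. by case: z w => [a b] [c d]. Qed.
Lemma ReN z : Re (- z) = - Re z. Proof. by case: z. Qed.
Lemma ImN z : Im (- z) = - Im z. Proof. by case: z. Qed.
Lemma ReM z w : Re (z * w) = Re z * Re w - Im z * Im w.
Proof. by case: z w => [a b] [c d]. Qed.
Lemma ImM z w : Im (z * w) = Re z * Im w + Im z * Re w.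
Proof. by case: z w => [a b] [c d]. Qed.
Definition ReImE := (ReD, ImD, ReN, ImN, ReM, ImM).

Lemma complex_ext z w : Re z = Re w -> Im z = Im w -> z = w.
Proof. by case: z w => [a b] [c d] /= -> ->. Qed.

Lemma cabsE z : cabs z = ComplexField.Normc.normc z. Proof. by case: z. Qed.

Lemma norm_Re_cabs z : `|Re z| <= cabs z.
Proof. by rewrite /cabs -sqrtr_sqr ler_sqrt ?lerDl ?sqr_ge0// addr_ge0 ?sqr_ge0. Qed.

Lemma norm_Im_cabs z : `|Im z| <= cabs z.
Proof. by rewrite /cabs -sqrtr_sqr ler_sqrt ?lerDr ?sqr_ge0// addr_ge0 ?sqr_ge0. Qed.

Lemma cabs_le z : cabs z <= `|Re z| + `|Im z|.
Proof.
rewrite /cabs -[leRHS]ger0_norm ?addr_ge0// -sqrtr_sqr ler_sqrt ?sqr_ge0//.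
rewrite sqrrD -!normrX !(ger0_norm (sqr_ge0 _)) -addrA lerD2l lerDr.
by rewrite mulrn_wge0// mulr_ge0.
Qed.

Lemma cabs_ge0 z : 0 <= cabs z. Proof. exact: sqrtr_ge0. Qed.

Lemma cabsM z w : cabs (z * w) = cabs z * cabs w.
Proof. by rewrite !cabsE ComplexField.Normc.normcM. Qed.

(* Equivalent to |z|^p, but a sum over the two real coordinates, so that convexity
   and differentiability reduce to the real case. *)
Definition modp (p : R) z : R := `|Re z| `^ p + `|Im z| `^ p.

Lemma modp_ge0 p z : 0 <= modp p z. Proof. by rewrite addr_ge0 ?powR_ge0. Qed.

Lemma modp0 p : 0 < p -> modp p 0 = 0.
Proof. by move=> p0; rewrite /modp /= normr0 powR0 ?gt_eqF ?addr0. Qed.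

Lemma modpN p z : modp p (- z) = modp p z.
Proof. by rewrite /modp !ReImE !normrN. Qed.

Lemma modpD p z w : 0 < p -> modp p (z + w) <= 2 `^ p * (modp p z + modp p w).
Proof.
move=> p0; rewrite /modp !ReImE addrACA mulrDr.
by apply: lerD; exact: norm_powRD.
Qed.

Lemma cabs_powR_le p z : 0 < p -> cabs z `^ p <= 2 `^ p * modp p z.
Proof.
move=> p0; have := norm_powRD (`|Re z|) (`|Im z|) p0; rewrite !normr_id.
apply: le_trans; rewrite ge0_ler_powR ?nnegrE ?(ltW p0) ?cabs_ge0//.
by rewrite ger0_norm ?addr_ge0// cabs_le.
Qed.

Lemma modp_le_cabs p z : 0 < p -> modp p z <= 2 * cabs z `^ p.
Proof.
move=> p0; rewrite mulr_natl mulr2n lerD// ge0_ler_powR ?nnegrE ?(ltW p0) ?cabs_ge0//.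
  exact: norm_Re_cabs.
exact: norm_Im_cabs.
Qed.

Lemma modpM_le p M z w : 0 < p -> cabs z <= M ->
  modp p (z * w) <= 2 * (M `^ p * 2 `^ p) * modp p w.
Proof.
move=> p0 zM; apply: le_trans (modp_le_cabs _ p0) _.
rewrite -!mulrA ler_wpM2l// cabsM powRM ?cabs_ge0//.
rewrite ler_pM ?powR_ge0 ?cabs_powR_le// ge0_ler_powR ?nnegrE ?(ltW p0) ?cabs_ge0//.
exact: le_trans (cabs_ge0 z) zM.
Qed.

Lemma modp_le_cst p M z : 0 < p -> cabs z <= M -> modp p z <= 2 * M `^ p.
Proof.
move=> p0 zM; apply: le_trans (modp_le_cabs _ p0) _.
rewrite ler_wpM2l// ge0_ler_powR ?nnegrE ?(ltW p0) ?cabs_ge0//.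
exact: le_trans (cabs_ge0 z) zM.
Qed.

Lemma modpD_eps p d : 1 < p -> 0 < d -> exists2 K, 0 <= K &
  forall z w, modp p (z + w) <= (1 + d) * modp p z + K * modp p w.
Proof.
move=> p1 d0; have [K K0 HK] := norm_powRD_eps p1 d0; exists K => // z w.
rewrite /modp !ReImE !mulrDr addrACA.
by apply: lerD; exact: HK.
Qed.

Lemma modp_uniform_convex p d : 1 < p -> 0 < d -> exists2 K, 0 <= K &
  forall z w, modp p (z - w) <= d * (modp p z + modp p w)
     + K * ((modp p z + modp p w) / 2 - modp p ((z + w) * (2^-1)%:C%C)).
Proof.
move=> p1 d0; have [K K0 HK] := norm_powR_uniform_convex p1 d0; exists K => // z w.
rewrite /modp !ReImE /= !mulr0 subr0 add0r.
have := lerD (HK (Re z) (Re w)) (HK (Im z) (Im w)).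
set a := `|Re z| `^ p; set b := `|Re w| `^ p; set c := `|Im z| `^ p; set e := `|Im w| `^ p.
by move=> H; apply: le_trans H _; lra.
Qed.

Lemma norm_mul_young p q d : 1 < p -> p^-1 + q^-1 = 1 -> 0 < d -> exists2 K, 0 <= K &
  forall z w, `|Re (z * w)| + `|Im (z * w)| <= K * modp p z + d * modp q w.
Proof.
move=> p1 pq d0; have d20 : 0 < d / 2 by rewrite divr_gt0.
have [K K0 HK] := young_eps p1 pq d20; exists (2 * K); first by rewrite mulr_ge0.
move=> z w; rewrite !ReImE /modp.
have := HK (Re z) (Re w); have := HK (Im z) (Im w).
have := HK (Re z) (Im w); have := HK (Im z) (Re w).
have := ler_normB (Re z * Re w) (Im z * Im w).
have := ler_normD (Re z * Im w) (Im z * Re w).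
lra.
Qed.

Local Notation e := (@circ_pt R).

Lemma circD x y : e (x + y) = e x * e y.
Proof.
by apply: complex_ext; rewrite !ReImE /= ?cosD ?sinD// addrC.
Qed.

Lemma circ0 : e 0 = 1. Proof. by rewrite /circ_pt cos0 sin0. Qed.

Lemma circ_neq0 x : e x != 0.
Proof.
apply/eqP => /(congr1 (fun z => z * e (- x))).
by rewrite -circD subrr circ0 mul0r => /eqP; rewrite oner_eq0.
Qed.

Lemma circN x : e (- x) = (e x)^-1.
Proof.
apply: (mulfI (circ_neq0 x)); rewrite mulfV ?circ_neq0//.
by rewrite -circD subrr circ0.
Qed.

Lemma circX x n : e x ^+ n = e (x *+ n).
Proof.
by elim: n => [|n IH]; rewrite ?expr0 ?mulr0n ?circ0// exprS IH -circD mulrS.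
Qed.

Lemma circ2pi x : e (x + pi *+ 2) = e x.
Proof. by rewrite /circ_pt cosD2pi sinD2pi. Qed.

Lemma cabs_circ x : cabs (e x) = 1.
Proof. by rewrite /cabs /= cos2Dsin2 sqrtr1. Qed.

Lemma cabsV z : cabs z^-1 = (cabs z)^-1.
Proof. by rewrite !cabsE ComplexField.Normc.normcV. Qed.

Lemma cabs_circXz x (n : int) : cabs (e x ^ n) = 1.
Proof.
case: n => n; rewrite ?NegzE -?exprnP -?exprnN ?cabsV circX cabs_circ ?invr1//.
Qed.

End complex_parts.

(** * Functions on the circle *)

Section circle_integrals.
Variable R : realType.
Local Notation C := R[i].
Local Notation mu := (@lebesgue_measure R).
Local Notation D := (@Tdom R).
Local Notation Re := complex.Re.
Local Notation Im := complex.Im.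
Local Notation e := (@circ_pt R).
Local Notation intble f := (mu.-integrable D (EFin \o f)).
Implicit Types f g : C -> C.

Lemma aeS (P Q : R -> Prop) : (forall x, P x -> Q x) ->
  {ae mu, forall x, P x} -> {ae mu, forall x, Q x}.
Proof. by move=> PQ; apply: filterS => //; exact: (ae_filter_ringOfSetsType mu). Qed.

Lemma aeS2 (P1 P2 Q : R -> Prop) : (forall x, P1 x -> P2 x -> Q x) ->
  {ae mu, forall x, P1 x} -> {ae mu, forall x, P2 x} -> {ae mu, forall x, Q x}.
Proof.
move=> PQ; apply: filterS2 => //; exact: (ae_filter_ringOfSetsType mu).
Qed.

Lemma measurable_Tdom : measurable (D : set (measurableTypeR R)). Proof. exact: measurable_itv. Qed.
Local Notation mD := measurable_Tdom.

Lemma mu_Tdom : mu D = (pi *+ 2 : R)%:E.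
Proof.
rewrite /Tdom lebesgue_measure_itv /= lte_fin mulrn_wgt0 ?pi_gt0//.
by rewrite -EFinB subr0.
Qed.

Lemma intble_cst c : intble (fun=> c).
Proof.
apply/integrableP; split; first exact: measurable_cst.
rewrite /= (integral_cst mu mD).
apply: lte_mul_pinfty => //.
by have := ltry (pi *+ 2 : R); rewrite -mu_Tdom; exact.
Qed.

Lemma intble_bounded (h : R -> R) M : measurable_fun D h ->
  (forall x, D x -> `|h x| <= M) -> intble h.
Proof. by move=> mh hM; exact: (dominated_integrable (mu := mu) mD mh (intble_cst M) hM). Qed.

Section reflection.
Let refl x := pi *+ 2 - x : R.

Let measurable_refl : measurable_fun setT (refl : R -> measurableTypeR R).
Proof. by apply: measurable_funB => //; exact: measurable_cst. Qed.

Let refl_Tdom : refl @^-1` D = D.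
Proof.
apply/seteqP; split => x; rewrite /refl /Tdom /= !in_itv/= => /andP[a b];
  apply/andP; split; lra.
Qed.

Let refl_measure (A : set R) : measurable A ->
  pushforward mu (refl : R -> measurableTypeR R) A = mu A.
Proof.
move=> mA; apply/esym/lebesgue_measure_unique => //= _ [[a b]] _ <-.
rewrite /pushforward (_ : refl @^-1` _ = `[pi *+ 2 - b, pi *+ 2 - a[%classic).
  rewrite !lebesgue_measure_itv/= !lte_fin.
  have -> : (pi *+ 2 - b < pi *+ 2 - a) = (a < b) by rewrite ltrD2l ltrN2.
  by case: ifP => // _; rewrite -!EFinB; congr EFin; lra.
apply/seteqP; split => x; rewrite /refl /= !in_itv/= => /andP[u v];
  apply/andP; split; lra.
Qed.

Let ge0_integral_refl (f : R -> \bar R) : measurable_fun D f ->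
  (forall x, 0 <= f x)%E ->
  (\int[mu]_(x in D) f (refl x) = \int[mu]_(x in D) f x)%E.
Proof.
move=> mf f0.
rewrite -{1}(refl_Tdom : (refl : _ -> measurableTypeR R) @^-1` D = D).
rewrite -ge0_integral_pushforward//=.
  by apply: eq_measure_integral => //= A mA _; exact: refl_measure.
exact: mD.
Qed.

Lemma measurable_fun_refl (h : R -> R) : measurable_fun D h ->
  measurable_fun D (fun x => h (pi *+ 2 - x)).
Proof.
move=> mh; apply: (@measurable_comp _ _ _ _ _ _ D h) => //.
- exact: mD.
- by move=> _ [x Dx <-]; rewrite -refl_Tdom /refl /= opprB addrCA subrr addr0.
- exact: measurable_funTS measurable_refl.
Qed.

Lemma integral_refl (h : R -> R) : measurable_fun D h ->
  (\int[mu]_(x in D) (h (pi *+ 2 - x))%:E = \int[mu]_(x in D) (h x)%:E)%E.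
Proof.
move=> /measurable_EFinP mh; rewrite integralE [RHS]integralE.
congr (_ - _)%E.
  apply: etrans (ge0_integral_refl (measurable_funepos mh) (funepos_ge0 _)).
  by apply: eq_integral => x _; rewrite !funeposE.
apply: etrans (ge0_integral_refl (measurable_funeneg mh) (funeneg_ge0 _)).
by apply: eq_integral => x _; rewrite !funenegE.
Qed.

Lemma intble_refl (h : R -> R) : intble h -> intble (fun x => h (pi *+ 2 - x)).
Proof.
move=> /integrableP[/measurable_EFinP mh foo]; apply/integrableP; split.
  by apply/measurable_EFinP; apply: (measurable_fun_refl mh).
have mn : measurable_fun D (fun x => `|h x|) by exact: measurableT_comp.
by apply: le_lt_trans foo; rewrite le_eqVlt; apply/orP; left; apply/eqP/(integral_refl mn).
Qed.

End reflection.

Lemma cmeasurableD f g : cmeasurable f -> cmeasurable g -> cmeasurable (fun t => f t + g t).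
Proof.
move=> [f1 f2] [g1 g2]; split.
  by under [X in measurable_fun _ X]eq_fun do rewrite ReD; exact: measurable_funD.
by under [X in measurable_fun _ X]eq_fun do rewrite ImD; exact: measurable_funD.
Qed.

Lemma cmeasurableM f g : cmeasurable f -> cmeasurable g -> cmeasurable (fun t => f t * g t).
Proof.
move=> [f1 f2] [g1 g2]; split.
  under [X in measurable_fun _ X]eq_fun do rewrite ReM.
  by apply: measurable_funB; exact: measurable_funM.
under [X in measurable_fun _ X]eq_fun do rewrite ImM.
by apply: measurable_funD; exact: measurable_funM.
Qed.

Lemma cmeasurable_cst c : cmeasurable (fun=> c : C).
Proof. by split; exact: measurable_cst. Qed.

Lemma cmeasurable_refl f : cmeasurable f -> cmeasurable (fun t => f t^-1).
Proof.
have E x : (e x)^-1 = e (pi *+ 2 - x) by rewrite addrC circ2pi circN.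
move=> [f1 f2]; split; under [X in measurable_fun _ X]eq_fun do rewrite E.
  exact: (measurable_fun_refl f1).
exact: (measurable_fun_refl f2).
Qed.

Lemma cmeasurable_id : cmeasurable (fun t : C => t).
Proof.
split; apply: measurable_funTS; apply: continuous_measurable_fun.
  exact: continuous_cos.
exact: continuous_sin.
Qed.

Lemma cmeasurable_exprz n : cmeasurable (fun t : C => t ^ n).
Proof.
have X k : cmeasurable (fun t : C => t ^+ k).
  elim: k => [|k IH]; first exact: cmeasurable_cst.
  under eq_fun do rewrite exprS.
  by apply: cmeasurableM => //; exact: cmeasurable_id.
case: n => k; first exact: X.
under eq_fun do rewrite NegzE -exprnN -exprVn.
exact: (cmeasurable_refl (X _)).
Qed.

Definition L1 f := intble (fun x => Re (f (e x))) /\ intble (fun x => Im (f (e x))).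

Definition cint f : C :=
  Complex (\int[mu]_(x in D) Re (f (e x))) (\int[mu]_(x in D) Im (f (e x))).

Lemma fourierE f n :
  fourier f n = ((pi *+ 2)^-1)%:C%C * cint (fun t => f t * t ^ (- n)).
Proof. by rewrite /fourier; congr (_ * _); rewrite [RHS]complexE. Qed.

Lemma L1_cmeasurable f : L1 f -> cmeasurable f.
Proof.
by move=> [f1 f2]; split; [exact: (intble_measurable f1)|exact: (intble_measurable f2)].
Qed.

Lemma L1Z c f : L1 f -> L1 (fun t => c * f t).
Proof.
move=> [f1 f2]; split.
  apply: (eq_intble mD _ (intbleB mD (intbleZ mD (Re c) f1) (intbleZ mD (Im c) f2))).
  by move=> x _ /=; rewrite ReM.
apply: (eq_intble mD _ (intbleD mD (intbleZ mD (Re c) f2) (intbleZ mD (Im c) f1))).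
by move=> x _ /=; rewrite ImM.
Qed.

Lemma eq_cint f g : (forall x, f (e x) = g (e x)) -> cint f = cint g.
Proof.
move=> fg; rewrite /cint.
by congr Complex; apply: eq_Rintegral => x _; rewrite fg.
Qed.

Lemma cintD f g : L1 f -> L1 g -> cint (fun t => f t + g t) = cint f + cint g.
Proof.
move=> [f1 f2] [g1 g2]; apply: complex_ext; rewrite !ReImE /=.
  by rewrite -(RintegralD mD f1 g1); apply: eq_Rintegral => x _; rewrite ReD.
by rewrite -(RintegralD mD f2 g2); apply: eq_Rintegral => x _; rewrite ImD.
Qed.

Lemma cintZ c f : L1 f -> cint (fun t => c * f t) = c * cint f.
Proof.
move=> [f1 f2]; apply: complex_ext; rewrite !ReImE /=.
  rewrite -(RintegralZl _ mD f1) -(RintegralZl _ mD f2).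
  rewrite -(RintegralB mD (intbleZ mD _ f1) (intbleZ mD _ f2)).
  by apply: eq_Rintegral => x _; rewrite ReM.
rewrite -(RintegralZl _ mD f1) -(RintegralZl _ mD f2).
rewrite -(RintegralD mD (intbleZ mD _ f2) (intbleZ mD _ f1)).
by apply: eq_Rintegral => x _; rewrite ImM.
Qed.

Lemma cint_refl f : cmeasurable f -> cint (fun t => f t^-1) = cint f.
Proof.
have E x : (e x)^-1 = e (pi *+ 2 - x) by rewrite addrC circ2pi circN.
move=> [f1 f2]; rewrite /cint; congr Complex; rewrite /Rintegral; congr fine.
  by rewrite -(integral_refl f1); apply: eq_integral => x _; rewrite E.
by rewrite -(integral_refl f2); apply: eq_integral => x _; rewrite E.
Qed.

Definition ae_eqc f g := {ae mu, forall x, D x -> f (e x) = g (e x)}.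

Lemma cint_ae_eq f g : cmeasurable f -> cmeasurable g -> ae_eqc f g -> cint f = cint g.
Proof.
move=> [f1 f2] [g1 g2] fg; rewrite /cint; congr Complex.
  by apply: (Rintegral_ae_eq mD f1 g1); apply: aeS fg => x H Dx; rewrite H.
by apply: (Rintegral_ae_eq mD f2 g2); apply: aeS fg => x H Dx; rewrite H.
Qed.

End circle_integrals.

Section circle_Lp.
Variable R : realType.
Local Notation C := R[i].
Local Notation mu := (@lebesgue_measure R).
Local Notation D := (@Tdom R).
Local Notation e := (@circ_pt R).
Local Notation intble f := (mu.-integrable D (EFin \o f)).
Local Notation mD := (@measurable_Tdom R).
Implicit Types (f g a : C -> C) (p q : R).

Lemma measurable_modp p f : cmeasurable f -> measurable_fun D (fun x => modp p (f (e x))).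
Proof.
by move=> [f1 f2]; apply: measurable_funD; exact: measurable_norm_powR.
Qed.

Lemma Linf_bounded f M : cmeasurable f -> (forall x, cabs (f (e x)) <= M) -> Linf f.
Proof. by move=> mf fM; split => //; exists M; apply: aeW. Qed.

Lemma Linf_cst c : Linf (fun=> c : C).
Proof. exact: (Linf_bounded (cmeasurable_cst c) (fun=> lexx _)). Qed.

Lemma Linf_exprz n : Linf (fun t : C => t ^ n).
Proof.
apply: (@Linf_bounded _ 1 (cmeasurable_exprz _ n)) => x.
by rewrite cabs_circXz.
Qed.

Lemma LinfM f g : Linf f -> Linf g -> Linf (fun t => f t * g t).
Proof.
move=> [mf [M fM]] [mg [K gK]]; split; first exact: cmeasurableM.
exists (M * K); apply: aeS2 fM gK => x /[swap] gx /[swap] Dx => /(_ Dx) fx.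
by rewrite cabsM ler_pM ?cabs_ge0 ?gx.
Qed.

Definition LP p f := cmeasurable f /\ intble (fun x => modp p (f (e x))).
Definition NP p f := \int[mu]_(x in D) modp p (f (e x)).

Lemma NP_ge0 p f : 0 <= NP p f.
Proof. by apply: Rintegral_ge0 => x _; exact: modp_ge0. Qed.

Lemma LP_dominated p f (h : R -> R) : cmeasurable f -> intble h ->
  {ae mu, forall x, D x -> modp p (f (e x)) <= h x} ->
  LP p f /\ NP p f <= \int[mu]_(x in D) h x.
Proof.
move=> mf ih fh; have i : intble (fun x => modp p (f (e x))).
  apply: (ae_dominated_integrable mD (measurable_modp p mf) ih).
  by apply: aeS fh => x /[apply]; rewrite ger0_norm ?modp_ge0.
by split; [split|exact: (le_Rintegral_ae mD i ih fh)].
Qed.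

Lemma LPD p f g : 0 < p -> LP p f -> LP p g ->
  LP p (fun t => f t + g t) /\ NP p (fun t => f t + g t) <= 2 `^ p * (NP p f + NP p g).
Proof.
move=> p0 [mf f1] [mg g1].
have i := intbleZ mD (2 `^ p) (intbleD mD f1 g1).
have H : {ae mu, forall x, D x ->
    modp p (f (e x) + g (e x)) <= 2 `^ p * (modp p (f (e x)) + modp p (g (e x)))}.
  by apply: aeW => x _; exact: modpD.
have [H1 H2] := LP_dominated (cmeasurableD mf mg) i H.
split => //; apply: le_trans H2 _.
by rewrite (RintegralZl _ mD (intbleD mD f1 g1)) (RintegralD mD f1 g1).
Qed.

Lemma LPM p a : 0 < p -> Linf a -> exists2 K, 0 <= K & forall f, LP p f ->
  LP p (fun t => a t * f t) /\ NP p (fun t => a t * f t) <= K * NP p f.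
Proof.
move=> p0 [ma [M aM]]; exists (2 * (M `^ p * 2 `^ p)).
  by rewrite !mulr_ge0 ?powR_ge0.
move=> f [mf f1].
have i := intbleZ mD (2 * (M `^ p * 2 `^ p)) f1.
have H : {ae mu, forall x, D x ->
    modp p (a (e x) * f (e x)) <= 2 * (M `^ p * 2 `^ p) * modp p (f (e x))}.
  by apply: aeS aM => x /[apply] ax; exact: modpM_le.
have [H1 H2] := LP_dominated (cmeasurableM ma mf) i H.
by split => //; apply: le_trans H2 _; rewrite (RintegralZl _ mD f1).
Qed.

Lemma LPM_ p a f : 0 < p -> Linf a -> LP p f -> LP p (fun t => a t * f t).
Proof. by move=> p0 la /[dup] lf; have [K _ /[apply]] := LPM p0 la; case. Qed.

Lemma LPZ p c f : 0 < p -> LP p f -> LP p (fun t => c * f t).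
Proof. by move=> p0; apply: LPM_ => //; exact: Linf_cst. Qed.

Lemma eq_LP p f g : (forall x, f (e x) = g (e x)) -> LP p f -> LP p g.
Proof.
move=> fg [[f1 f2] f3]; split; last first.
  by apply: (eq_intble mD _ f3) => x _; rewrite fg.
by split; [apply: eq_measurable_fun f1|apply: eq_measurable_fun f2] => x _ /=; rewrite fg.
Qed.

Lemma eq_NP p f g : (forall x, f (e x) = g (e x)) -> NP p f = NP p g.
Proof. by move=> fg; apply: eq_Rintegral => x _; rewrite fg. Qed.

Lemma LPN p f : 0 < p -> LP p f -> LP p (fun t => - f t).
Proof. by move=> p0 /(LPZ (-1) p0); apply: eq_LP => x; rewrite mulN1r. Qed.

Lemma NPN p f : NP p (fun t => - f t) = NP p f.
Proof. by apply: eq_Rintegral => x _; rewrite modpN. Qed.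

Lemma NPC p f g : NP p (fun t => f t - g t) = NP p (fun t => g t - f t).
Proof. by rewrite -NPN; apply: eq_NP => x; rewrite opprB. Qed.

Lemma LPB p f g : 0 < p -> LP p f -> LP p g ->
  LP p (fun t => f t - g t) /\ NP p (fun t => f t - g t) <= 2 `^ p * (NP p f + NP p g).
Proof.
by move=> p0 lf lg; have := LPD p0 lf (LPN p0 lg); rewrite NPN.
Qed.

Lemma Linf_LP p a : 0 < p -> Linf a -> LP p a.
Proof.
move=> p0 [ma [M aM]].
apply: (proj1 (LP_dominated ma (intble_cst (2 * M `^ p)) _)).
by apply: aeS aM => x /[apply]; exact: modp_le_cst.
Qed.

Lemma LP_refl p f : LP p f -> LP p (fun t => f t^-1).
Proof.
have E x : (e x)^-1 = e (pi *+ 2 - x) by rewrite addrC circ2pi circN.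
move=> [mf f1]; split; first exact: cmeasurable_refl.
by apply: (eq_intble mD _ (intble_refl f1)) => x _; rewrite E.
Qed.

Lemma measurable_cabs_powR p f : cmeasurable f ->
  measurable_fun D (fun x => cabs (f (e x)) `^ p).
Proof.
move=> [f1 f2]; apply: (measurableT_comp (f := fun z : R => z `^ p)).
  exact: measurable_powR.
apply: (measurableT_comp (f := @Num.sqrt R)).
  by apply: continuous_measurable_fun; exact: sqrt_continuous.
by apply: measurable_funD; exact: measurable_funX.
Qed.

Lemma Lp_LP p f : 0 < p -> Lp p f <-> LP p f.
Proof.
move=> p0; split=> [[mf fi]|[mf fi]]; split => //.
  have mc := measurable_cabs_powR p mf.
  have ic : intble (fun x => cabs (f (e x)) `^ p).
    apply/integrableP; split; first exact/measurable_EFinP.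
    apply: le_lt_trans fi; rewrite /lpint le_eqVlt; apply/orP; left; apply/eqP.
    by apply: eq_integral => x _ /=; rewrite ger0_norm ?powR_ge0.
  apply: (dominated_integrable mD (measurable_modp p mf) (intbleZ mD 2 ic)) => x _.
  by rewrite ger0_norm ?modp_ge0// modp_le_cabs.
have /integrableP[_] := intbleZ mD (2 `^ p) fi; apply: le_lt_trans.
apply: ge0_le_integral => //=; first exact: mD.
- by move=> x _; rewrite lee_fin powR_ge0.
- by apply/measurable_EFinP; exact: measurable_cabs_powR.
- apply/measurable_EFinP; apply: measurableT_comp => //.
  by apply: measurable_funM => //; exact: measurable_modp.
- move=> x _; rewrite lee_fin ger0_norm; first exact: cabs_powR_le.
  by rewrite mulr_ge0 ?powR_ge0 ?modp_ge0.
Qed.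

End circle_Lp.

Section dpow_continuity.
Variable R : realType.

Lemma continuous_dpow (p : R) : 1 < p -> continuous (dpow p).
Proof.
move=> p1; have p10 : 0 < p - 1 by rewrite subr_gt0.
have -> : dpow p = (fun x => `|(x + `|x|) / 2| `^ (p - 1) - `|(`|x| - x) / 2| `^ (p - 1)).
  apply/funext => x; rewrite /dpow; have [x0|x0|->] := ltrgt0P x.
  - by rewrite gtr0_sg// subrr mul0r normr0 powR0 ?gt_eqF// -mulr2n -[x *+ 2]mulr_natr
      mulfK// gtr0_norm// subr0 mul1r.
  - rewrite ltr0_sg// subrr mul0r normr0 powR0 ?gt_eqF// sub0r -opprD -mulr2n.
    by rewrite -[x *+ 2]mulr_natr -mulNr mulfK// normrN ltr0_norm// mulN1r.
  - by rewrite sgr0 mul0r addr0 subr0 mul0r subrr.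
move=> x; apply: cvgB.
- apply: (@continuous_comp _ _ _ (fun x : R => (x + `|x|) / 2) (fun x : R => `|x| `^ (p - 1))).
    by apply: cvgMl; apply: cvgD; [exact: cvg_id|exact: norm_continuous].
  exact: continuous_norm_powR.
- apply: (@continuous_comp _ _ _ (fun x : R => (`|x| - x) / 2) (fun x : R => `|x| `^ (p - 1))).
    by apply: cvgMl; apply: cvgB; [exact: norm_continuous|exact: cvg_id].
  exact: continuous_norm_powR.
Qed.

Lemma measurable_dpow (p : R) : 1 < p -> measurable_fun setT (dpow p).
Proof. by move=> p1; apply: continuous_measurable_fun; exact: continuous_dpow. Qed.

Lemma norm_dpow_conj (p q x : R) : 1 < p -> p^-1 + q^-1 = 1 ->
  `|dpow p x| `^ q = `|x| `^ p.
Proof.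
move=> p1 pq; have p0 : 0 < p by rewrite (lt_trans ltr01).
have ip : p^-1 < 1 by rewrite invf_lt1.
have q0 : 0 < q by rewrite -invr_gt0; lra.
rewrite norm_dpow// -powRrM; congr (_ `^ _).
apply: (mulfI (_ : p^-1 * q^-1 != 0)); first by rewrite mulf_neq0// invr_eq0 gt_eqF.
rewrite [LHS](_ : _ = (1 - p^-1) * (q^-1 * q) * (p^-1 * p)); last by field; rewrite !gt_eqF.
rewrite [RHS](_ : _ = q^-1 * (p^-1 * p)); last by ring.
by rewrite !mulVf ?gt_eqF// !mulr1; lra.
Qed.

Lemma norm_dpowD_mul (p x y s : R) : 1 < p -> 0 <= s -> s <= 1 ->
  `|dpow p (x + s * y) * y| <= 2 `^ p * (`|x| `^ p + `|y| `^ p).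
Proof.
move=> p1 s0 s1; have p0 : 0 < p by rewrite (lt_trans ltr01).
have := norm_powRD (`|x|) (`|y|) p0; rewrite !normr_id; apply: le_trans.
rewrite normrM norm_dpow// [`| `|x| + `|y| |]ger0_norm ?addr_ge0//.
rewrite -(mulr_powRB1 (addr_ge0 (normr_ge0 x) (normr_ge0 y)) p0) mulrC.
rewrite ler_pM ?powR_ge0 ?lerDr//.
apply: ge0_ler_powR; rewrite ?nnegrE ?subr_ge0 ?(ltW p1) ?(addr_ge0 (normr_ge0 x) (normr_ge0 y))//.
rewrite (le_trans (ler_normD _ _))// lerD2l normrM (ger0_norm s0).
by rewrite ler_piMl.
Qed.

End dpow_continuity.

Section Lp_duality.
Variable R : realType.
Local Notation C := R[i].
Local Notation mu := (@lebesgue_measure R).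
Local Notation D := (@Tdom R).
Local Notation Re := complex.Re.
Local Notation Im := complex.Im.
Local Notation e := (@circ_pt R).
Local Notation intble f := (mu.-integrable D (EFin \o f)).
Local Notation mD := (@measurable_Tdom R).
Implicit Types (f g a m : C -> C).
Let double_le (x y d : R) : y <= d / 2 -> x + y + (x + y) <= 2 * x + d.
Proof. by lra. Qed.

Variables (p q : R).
Hypotheses (p1 : 1 < p) (pq : p^-1 + q^-1 = 1).

Let p0 : 0 < p. Proof. by rewrite (lt_trans ltr01). Qed.
Let q1 : 1 < q.
Proof.
have ip : p^-1 < 1 by rewrite invf_lt1.
have ip0 : 0 < p^-1 by rewrite invr_gt0.
have iq : q^-1 = 1 - p^-1 by rewrite -pq addrAC subrr add0r.
have iq0 : 0 < q^-1 by rewrite iq subr_gt0.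
by rewrite -[q]invrK invf_gt1// iq ltrBlDr ltrDl.
Qed.
Let q0 : 0 < q. Proof. by rewrite (lt_trans ltr01). Qed.

Lemma cint_young g (d : R) : LP q g -> 0 < d -> exists2 K, 0 <= K &
  forall f, LP p f -> L1 (fun t => f t * g t) /\
  `|Re (cint (fun t => f t * g t))| + `|Im (cint (fun t => f t * g t))| <= K * NP p f + d.
Proof.
move=> [mg ig] d0.
have N0 : 0 < 2 * (NP q g + 1) by rewrite mulr_gt0// ltr_wpDl// NP_ge0.
have [c c0 cE] : exists2 c : R, 0 < c & c * (2 * (NP q g + 1)) = d.
  by exists (d / (2 * (NP q g + 1))); rewrite ?divfK ?gt_eqF ?divr_gt0.
have [K K0 HK] := norm_mul_young p1 pq c0.
exists (2 * K); first by rewrite mulr_ge0.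
move=> f [mf fi].
pose h x := K * modp p (f (e x)) + c * modp q (g (e x)).
have ih : intble h by exact: (intbleD mD (intbleZ mD K fi) (intbleZ mD c ig)).
have hE : \int[mu]_(x in D) h x = K * NP p f + c * NP q g.
  by rewrite /h (RintegralD mD (intbleZ mD K fi) (intbleZ mD c ig)) !RintegralZl//; exact: mD.
have [mfg1 mfg2] := cmeasurableM mf mg.
have b1 x : `|Re (f (e x) * g (e x))| <= h x.
  by apply: le_trans (HK _ _); rewrite lerDl.
have b2 x : `|Im (f (e x) * g (e x))| <= h x.
  by apply: le_trans (HK _ _); rewrite lerDr.
have i1 := dominated_integrable mD mfg1 ih (fun x _ => b1 x).
have i2 := dominated_integrable mD mfg2 ih (fun x _ => b2 x).
split; first by split.
have n1 : `|Re (cint (fun t => f t * g t))| <= \int[mu]_(x in D) h x.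
  by apply: (norm_Rintegral_le mD mfg1 ih); apply: aeW => x _.
have n2 : `|Im (cint (fun t => f t * g t))| <= \int[mu]_(x in D) h x.
  by apply: (norm_Rintegral_le mD mfg2 ih); apply: aeW => x _.
apply: le_trans (lerD n1 n2) _; rewrite hE.
have : c * NP q g <= d / 2.
  by rewrite -cE ler_pdivlMr// -mulrA ler_pM2l// [2 * (_ + 1)]mulrDr mulr1 [NP q g * 2]mulrC lerDl.
by rewrite -mulrA; exact: double_le.
Qed.

Lemma LP_mul_L1 f g : LP p f -> LP q g -> L1 (fun t => f t * g t).
Proof.
by move=> lf lg; have [K _ /(_ f lf)[]] := cint_young lg ltr01.
Qed.

Lemma LP_L1 f : LP p f -> L1 f.
Proof.
move=> lf; have l1 : LP q (fun=> 1 : C) by apply: Linf_LP => //; exact: Linf_cst.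
have [h1 h2] := LP_mul_L1 lf l1; split.
  by apply: (eq_intble mD _ h1) => x _; rewrite mulr1.
by apply: (eq_intble mD _ h2) => x _; rewrite mulr1.
Qed.

Lemma cint_closure f g : LP p f -> LP q g ->
  (forall d, 0 < d -> exists m, [/\ LP p m, NP p (fun t => f t - m t) <= d &
     cint (fun t => m t * g t) = 0]) ->
  cint (fun t => f t * g t) = 0.
Proof.
move=> lf lg H.
suff S d : 0 < d -> `|Re (cint (fun t => f t * g t))| + `|Im (cint (fun t => f t * g t))| <= d.
  have : `|Re (cint (fun t => f t * g t))| + `|Im (cint (fun t => f t * g t))| <= 0.
    by apply/ler_addgt0Pr => d /S; rewrite add0r.
  rewrite le_eqVlt ltNge addr_ge0//= orbF paddr_eq0//.
  by move=> /andP[/eqP/normr0_eq0 A /eqP/normr0_eq0 B]; exact: complex_ext.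
move=> d0; have d20 : 0 < d / 2 by rewrite divr_gt0.
have [K K0 HK] := cint_young lg d20.
have k0 : 0 < d / 2 / (K + 1) by rewrite divr_gt0// ltr_wpDl.
have [m [lm Nm cm]] := H _ k0.
have [lfm _] := LPB p0 lf lm.
have [i1 b] := HK _ lfm.
have E : cint (fun t => f t * g t) = cint (fun t => (f t - m t) * g t).
  rewrite -[RHS]addr0 -cm -cintD//; last exact: LP_mul_L1.
  by apply: eq_cint => x; rewrite -mulrDl subrK.
rewrite E; apply: le_trans b _.
have : K * NP p (fun t => f t - m t) <= d / 2.
  apply: (@le_trans _ _ (K * (d / 2 / (K + 1)))); first exact: ler_wpM2l.
  by rewrite mulrCA ler_piMr ?(ltW d20)// ler_pdivrMr ?mul1r ?lerDl// ltr_wpDl.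
by move=> H1; rewrite [leRHS](splitr d) lerD2r.
Qed.

Lemma LP_complete (f : nat -> C -> C) : (forall n, LP p (f n)) ->
  (forall d, 0 < d -> exists n0, forall n k, (n0 <= n)%N -> (n0 <= k)%N ->
     NP p (fun t => f n t - f k t) < d) ->
  exists F, LP p F /\ forall d, 0 < d -> exists n0, forall n, (n0 <= n)%N ->
     NP p (fun t => f n t - F t) <= d.
Proof.
move=> lf cf.
have iB n k : intble (fun x => modp p (f n (e x) - f k (e x))).
  by have [[]] := LPB p0 (lf n) (lf k).
have part (P : C -> R) : (forall z w, P (z - w) = P z - P w) ->
    (forall z, `|P z| `^ p <= modp p z) ->
    (forall n, measurable_fun D (fun x => P (f n (e x)))) ->
    exists G : C -> R, measurable_fun D (fun x => G (e x)) /\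
    forall d, 0 < d -> exists n0, forall n, (n0 <= n)%N ->
    intble (fun x => `|P (f n (e x)) - G (e x)| `^ p) /\
    \int[mu]_(x in D) (`|P (f n (e x)) - G (e x)| `^ p) <= d.
  move=> PB Pmod mP.
  have iP n k : intble (fun x => `|P (f n (e x)) - P (f k (e x))| `^ p).
    apply: (dominated_integrable mD _ (iB n k)).
      exact: (measurable_norm_powR _ (measurable_funB (mP n) (mP k))).
    by move=> x _; rewrite ger0_norm ?powR_ge0// -PB.
  have cP d : 0 < d -> exists n0, forall n k, (n0 <= n)%N -> (n0 <= k)%N ->
      \int[mu]_(x in D) (`|P (f n (e x)) - P (f k (e x))| `^ p) < d.
    move=> /cf[n0 Hn0]; exists n0 => n k nn kn; apply: le_lt_trans (Hn0 n k nn kn).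
    by apply: (le_Rintegral mD (iP n k) (iB n k)) => x _; rewrite -PB.
  have [phi [mG HG]] := Lp_complete mD p0 mP iP cP.
  by exists (fun z => fine (limn_esup (fun n => (P (f (phi n) z))%:E))).
have ReB (z w : C) : Re (z - w) = Re z - Re w by rewrite !ReImE.
have ImB (z w : C) : Im (z - w) = Im z - Im w by rewrite !ReImE.
have Rem (z : C) : `|Re z| `^ p <= modp p z by rewrite lerDl powR_ge0.
have Imm (z : C) : `|Im z| `^ p <= modp p z by rewrite lerDr powR_ge0.
have [G1 [mG1 HG1]] := part _ ReB Rem (fun n => (lf n).1.1).
have [G2 [mG2 HG2]] := part _ ImB Imm (fun n => (lf n).1.2).
pose F z : C := Complex (G1 z) (G2 z).
have mF : cmeasurable F by [].
have key d : 0 < d -> exists n0, forall n, (n0 <= n)%N ->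
    LP p (fun t => f n t - F t) /\ NP p (fun t => f n t - F t) <= d.
  move=> d0; have d20 : 0 < d / 2 by rewrite divr_gt0.
  have [n1 H1] := HG1 _ d20; have [n2 H2] := HG2 _ d20.
  exists (maxn n1 n2) => n; rewrite geq_max => /andP[/H1[i1 b1] /H2[i2 b2]].
  have E x : modp p (f n (e x) - F (e x)) =
      `|Re (f n (e x)) - G1 (e x)| `^ p + `|Im (f n (e x)) - G2 (e x)| `^ p.
    by rewrite /modp !ReImE.
  split; first split.
  - have [m1 m2] := (lf n).1; split.
      by under [X in measurable_fun _ X]eq_fun do rewrite ReD ReN; exact: measurable_funB.
    by under [X in measurable_fun _ X]eq_fun do rewrite ImD ImN; exact: measurable_funB.
  - by apply: (eq_intble mD _ (intbleD mD i1 i2)) => x _; rewrite E.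
  - rewrite /NP; under eq_Rintegral do rewrite E.
    rewrite (RintegralD mD i1 i2); move: b1 b2; clear -p1 pq; lra.
exists F; split; last by move=> d /key[n0 H]; exists n0 => n /H[].
have [n0 /(_ n0 (leqnn _))[l _]] := key 1 ltr01.
by have [+ _] := LPB p0 (lf n0) l; apply: eq_LP => x; rewrite subKr.
Qed.

End Lp_duality.

(** * Annihilators by best approximation *)

Section Lp_annihilator.
Variable R : realType.
Local Notation C := R[i].
Local Notation mu := (@lebesgue_measure R).
Local Notation D := (@Tdom R).
Local Notation Re := complex.Re.
Local Notation Im := complex.Im.
Local Notation e := (@circ_pt R).
Local Notation intble f := (mu.-integrable D (EFin \o f)).
Local Notation mD := (@measurable_Tdom R).
Implicit Types (f g a m : C -> C).
Variables (p q : R).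
Hypotheses (p1 : 1 < p) (pq : p^-1 + q^-1 = 1).

Let p0 : 0 < p. Proof. by rewrite (lt_trans ltr01). Qed.

Definition dmodp (F : C -> C) : C -> C :=
  fun z => Complex (dpow p (Re (F z))) (- dpow p (Im (F z))).

Lemma modp_dmodp F z : modp q (dmodp F z) = modp p (F z).
Proof. by rewrite /modp /dmodp /= normrN !norm_dpow_conj. Qed.

Lemma cmeasurable_dmodp F : cmeasurable F -> cmeasurable (dmodp F).
Proof.
move=> [F1 F2]; split.
  exact: (measurableT_comp (measurable_dpow p1) F1).
exact: (measurable_funN (measurableT_comp (measurable_dpow p1) F2)).
Qed.

Lemma LP_dmodp F : LP p F -> LP q (dmodp F).
Proof.
move=> [mF iF]; split; first exact: cmeasurable_dmodp.
by apply: (eq_intble mD _ iF) => x _; rewrite modp_dmodp.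
Qed.

Lemma Re_mul_dmodp F z : Re (F z * dmodp F z) = modp p (F z).
Proof.
by rewrite ReM /= mulrN opprK mulrC [Im _ * _]mulrC !dpow_mul.
Qed.

Lemma LPD_eps (B d : R) : 0 <= B -> 0 < d -> exists2 K, 0 <= K &
  forall f g, LP p f -> NP p f <= B -> LP p g ->
  NP p (fun t => f t + g t) <= NP p f + d + K * NP p g.
Proof.
move=> B0 d0.
have c0 : 0 < d / (B + 1) by rewrite divr_gt0// ltr_wpDl.
have [K K0 HK] := modpD_eps p1 c0; exists K => // f g [mf fi] fB [mg gi].
set c := d / _ in c0 HK.
have ih := intbleD mD (intbleZ mD (1 + c) fi) (intbleZ mD K gi).
have H : {ae mu, forall x, D x -> modp p (f (e x) + g (e x)) <=
    (1 + c) * modp p (f (e x)) + K * modp p (g (e x))}.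
  by apply: aeW => x _.
have [_ ] := LP_dominated (cmeasurableD mf mg) ih H; move=> /le_trans; apply.
rewrite (RintegralD mD (intbleZ mD (1 + c) fi) (intbleZ mD K gi)).
rewrite (RintegralZl _ mD fi) (RintegralZl _ mD gi) lerD2r -/(NP p f).
rewrite mulrDl mul1r lerD2l /c mulrAC ler_pdivrMr ?ltr_wpDl//.
by rewrite ler_wpM2l ?(ltW d0)// ler_wpDr.
Qed.

Lemma cint_dmodp_ge0 F m : LP p F -> LP p m ->
  (forall s, 0 < s -> NP p F <= NP p (fun t => F t + s%:C%C * m t)) ->
  0 <= Re (cint (fun t => m t * dmodp F t)).
Proof.
move=> lF lm Fmin.
pose Fs (s : R) t := F t + s%:C%C * m t.
have lFs s : LP p (Fs s) by apply: (proj1 (LPD _ _ _)) => //; exact: LPZ.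
pose G s x := Re (m (e x) * dmodp (Fs s) (e x)).
have GE s x : G s x = dpow p (Re (F (e x)) + s * Re (m (e x))) * Re (m (e x))
    + dpow p (Im (F (e x)) + s * Im (m (e x))) * Im (m (e x)).
  rewrite /G /Fs ReM /dmodp /= !ReImE /= !mul0r subr0 addr0 mulrN opprK.
  by rewrite mulrC [Im _ * _]mulrC.
have mG s : measurable_fun D (G s).
  exact: (cmeasurableM lm.1 (cmeasurable_dmodp (lFs s).1)).1.
have [mF iF] := lF; have [mm im] := lm.
pose h x := 2 `^ p * (modp p (F (e x)) + modp p (m (e x))).
have ih : intble h by exact: (intbleZ mD (2 `^ p) (intbleD mD iF im)).
have Gh s x : 0 <= s -> s <= 1 -> `|G s x| <= h x.
  move=> s0 s1; rewrite GE (le_trans (ler_normD _ _))//.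
  have := lerD (norm_dpowD_mul (Re (F (e x))) (Re (m (e x))) p1 s0 s1)
     (norm_dpowD_mul (Im (F (e x))) (Im (m (e x))) p1 s0 s1).
  by move=> /le_trans; apply; rewrite -mulrDr /h addrACA.
have iG s : 0 <= s -> s <= 1 -> intble (G s).
  by move=> s0 s1; apply: (dominated_integrable mD (mG s) ih) => x _; exact: Gh.
have G0 s : 0 < s -> s <= 1 -> 0 <= \int[mu]_(x in D) G s x.
  move=> s0 s1; have k0 : 0 < p * s by rewrite mulr_gt0.
  rewrite -(pmulr_rge0 _ k0) -(RintegralZl _ mD (iG s (ltW s0) s1)).
  have := Fmin s s0; rewrite -subr_ge0 -(RintegralB mD (lFs s).2 iF).
  move=> /le_trans; apply.
  have iB := intbleB mD (lFs s).2 iF.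
  apply: (le_Rintegral mD iB (intbleZ mD _ (iG s (ltW s0) s1))) => x _.
  have := norm_powR_subgradient (Re (Fs s (e x))) (Re (F (e x))) p1.
  have := norm_powR_subgradient (Im (Fs s (e x))) (Im (F (e x))) p1.
  rewrite GE /modp /Fs /= !ReImE /= !mul0r subr0 addr0.
  set a := Re (F (e x)); set b := Im (F (e x)); set u := Re (m _); set v := Im (m _).
  have -> : a - (a + s * u) = - (s * u) by ring.
  have -> : b - (b + s * v) = - (s * v) by ring.
  set A := dpow _ _; set B := dpow _ _ => H1 H2; move: H1 H2; clear; lra.
have cG : \int[mu]_(x in D) G (harmonic n) x @[n --> \oo] --> \int[mu]_(x in D) G 0 x.
  apply: (dominated_cvg_Rintegral mD (fun n => mG _) (mG 0) ih).
    move=> n; apply: aeW => x _; apply: Gh; first exact: ltW (harmonic_gt0 n).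
    by rewrite /harmonic /= invf_le1// ler1n.
  apply: aeW => x _.
  rewrite (_ : (fun n => _) = (fun n => dpow p (Re (F (e x)) + harmonic n * Re (m (e x))) * Re (m (e x))
    + dpow p (Im (F (e x)) + harmonic n * Im (m (e x))) * Im (m (e x)))); last first.
    by apply/funext => n; rewrite GE.
  have dc (r1 r2 : R) : dpow p (r1 + harmonic n * r2) @[n --> \oo] --> dpow p (r1 + 0 * r2).
    have H : r1 + harmonic n * r2 @[n --> \oo] --> r1 + 0 * r2.
      by apply: cvgD; [exact: cvg_cst|apply: cvgMl; exact: cvg_harmonic].
    apply: (cvg_comp (fun n => r1 + harmonic n * r2) (dpow p) H).
    exact: continuous_dpow.
  rewrite GE.
  by apply: cvgD; apply: cvgMl; exact: dc.
have -> : Re (cint (fun t => m t * dmodp F t)) = \int[mu]_(x in D) G 0 x.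
  apply: eq_Rintegral => x _; rewrite /G; congr (Re (_ * _)).
  by rewrite /dmodp /Fs !ReImE /= !mul0r subr0 !addr0.
rewrite -(cvg_lim (@Rhausdorff R) cG); apply: limr_ge; first by apply/cvg_ex; eexists; exact: cG.
apply: nearW => n; apply: G0; first exact: harmonic_gt0.
by rewrite /harmonic /= invf_le1// ler1n.
Qed.

End Lp_annihilator.

Lemma midpoint_cauchy_bound (R : realFieldType) (d s K u v w r t : R) :
  0 < s -> 0 <= K -> u <= d + t -> v <= d + t -> t <= 1 -> d <= w ->
  s * (2 * (2 * d + 2 + 1)) = r -> K * t <= r / 2 ->
  s * (u + v) + K * ((u + v) / 2 - w) < r.
Proof.
move=> s0 K0 ut vt t1 dw sE KE.
have A1 : s * (u + v) <= s * (2 * d + 2) by rewrite ler_pM2l//; lra.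
have A2 : K * ((u + v) / 2 - w) <= K * t by rewrite ler_wpM2l//; lra.
lra.
Qed.

Section Lp_annihilator_theorem.
Variable R : realType.
Local Notation C := R[i].
Local Notation Re := complex.Re.
Local Notation e := (@circ_pt R).
Implicit Types (f g a m : C -> C).
Variables (p q : R).
Hypotheses (p1 : 1 < p) (pq : p^-1 + q^-1 = 1).
Variables (M : (C -> C) -> Prop) (h : C -> C).
Hypothesis LM : forall m, M m -> LP p m.
Hypothesis M0 : M (fun=> 0).
Hypothesis Mlin : forall c m1 m2, M m1 -> M m2 -> M (fun t => m1 t + c * m2 t).
Hypothesis Lh : LP p h.

Let p0 : 0 < p. Proof. by rewrite (lt_trans ltr01). Qed.

Let le_NP_eq f g (c : R) : (forall x, f (e x) = g (e x)) -> c <= NP p f -> c <= NP p g.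
Proof. by move=> fg; rewrite (eq_NP p fg). Qed.

Let d := inf [set NP p (fun t => h t - m t) | m in M].

Let has_inf_d : has_inf [set NP p (fun t => h t - m t) | m in M].
Proof.
split; first by exists (NP p (fun t => h t - 0)), (fun=> 0).
by exists 0 => _ [m _ <-]; exact: NP_ge0.
Qed.

Let d_le m : M m -> d <= NP p (fun t => h t - m t).
Proof. by move=> Mm; apply: (ge_inf has_inf_d.2); exists m. Qed.

Let d_ge0 : 0 <= d.
Proof. by apply: lb_le_inf has_inf_d.1 _ => _ [m _ <-]; exact: NP_ge0. Qed.

Lemma NP_uniform_convex (s : R) : 0 < s -> exists2 K, 0 <= K &
  forall f g, LP p f -> LP p g ->
  NP p (fun t => f t - g t) <= s * (NP p f + NP p g)
    + K * ((NP p f + NP p g) / 2 - NP p (fun t => (2^-1)%:C%C * (f t + g t))).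
Proof.
move=> s0; have [K K0 HK] := modp_uniform_convex p1 s0; exists K => // f g lf lg.
have [_ i1] := lf; have [_ i2] := lg.
have [_ i3] := LPZ (2^-1)%:C%C p0 (LPD p0 lf lg).1.
have [_ i0] := (LPB p0 lf lg).1.
have mD := @measurable_Tdom R.
have i12 := intbleD mD i1 i2.
have j1 := intbleZ mD s i12.
have i12h := intbleZ mD (2^-1) i12.
have j2 := intbleZ mD K (intbleB mD i12h i3).
have := le_Rintegral mD i0 (intbleD mD j1 j2); rewrite (RintegralD mD j1 j2).
rewrite (RintegralZl _ mD i12) (RintegralZl _ mD (intbleB mD i12h i3)).
rewrite (RintegralB mD i12h i3) (RintegralZl _ mD i12) (RintegralD mD i1 i2).
rewrite [2^-1 * _]mulrC; apply => x _ /=.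
by rewrite [2^-1 * _]mulrC [_%:C%C * _]mulrC.
Qed.

Let minimizer : exists F, [/\ LP p F, NP p F <= d,
  (forall m, M m -> d <= NP p (fun t => F t + m t)) &
  forall eps, 0 < eps -> exists2 m, M m & NP p (fun t => h t - F t - m t) <= eps].
Proof.
have /choice[m Hm] : forall n : nat, exists m, M m /\ NP p (fun t => h t - m t) < d + n.+1%:R^-1.
  move=> n; have e0 : 0 < n.+1%:R^-1 :> R by rewrite invr_gt0.
  by have [_ [m Mm <-] H] := inf_adherent e0 has_inf_d; exists m.
pose E n t := h t - m n t.
have LE n : LP p (E n) by exact: (LPB p0 Lh (LM (Hm n).1)).1.
have NE n : d <= NP p (E n) by apply: d_le; exact: (Hm n).1.
have NE' n : NP p (E n) < d + n.+1%:R^-1 by exact: (Hm n).2.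
have inv_le (n0 n : nat) : (n0 <= n)%N -> n.+1%:R^-1 <= n0.+1%:R^-1 :> R.
  by move=> nn; rewrite lef_pV2 ?posrE// ler_nat.
have small (r : R) : 0 < r -> exists n0 : nat, n0.+1%:R^-1 < r.
  move=> r0; exists (Num.truncn r^-1).
  by rewrite -[X in _ < X]invrK ltf_pV2 ?posrE ?invr_gt0// truncnS_gt.
have cE (r : R) : 0 < r -> exists n0, forall n k, (n0 <= n)%N -> (n0 <= k)%N ->
    NP p (fun t => E n t - E k t) < r.
  move=> r0; pose s := r / (2 * (2 * d + 2 + 1)).
  have dp0 : 0 < 2 * (2 * d + 2 + 1) by rewrite mulr_gt0// ltr_wpDl// addr_ge0// mulr_ge0.
  have s0 : 0 < s by rewrite divr_gt0.
  have [K K0 HK] := NP_uniform_convex s0.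
  have [n0 Hn0] : exists n0 : nat, n0.+1%:R^-1 < r / (2 * (K + 1)).
    by apply: small; rewrite divr_gt0// mulr_gt0// ltr_wpDl.
  exists n0 => n k nn kn; apply: le_lt_trans (HK _ _ (LE n) (LE k)) _.
  have Eub k' : (n0 <= k')%N -> NP p (E k') <= d + n0.+1%:R^-1.
    by move=> /inv_le kn'; apply: ltW; apply: lt_le_trans (NE' k') _; rewrite lerD2l.
  have mid : d <= NP p (fun t => (2^-1)%:C%C * (E n t + E k t)).
    apply: (le_NP_eq _ (d_le (Mlin (2^-1)%:C%C (Mlin (2^-1)%:C%C M0 (Hm n).1) (Hm k).1))).
    move=> x; rewrite /E add0r.
    have hf : h (e x) = (2^-1)%:C%C * h (e x) + (2^-1)%:C%C * h (e x).
      rewrite -mulrDl -rmorphD/= (_ : 2^-1 + 2^-1 = 1) ?mul1r//.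
      by rewrite [RHS](splitr 1) !mul1r.
    by rewrite [X in X - _]hf; ring.
  have n1 : n0.+1%:R^-1 <= 1 :> R by rewrite invf_le1// ler1n.
  have sE : s * (2 * (2 * d + 2 + 1)) = r by rewrite /s divfK// gt_eqF.
  have KE : K * n0.+1%:R^-1 <= r / 2.
    apply: (@le_trans _ _ ((K + 1) * n0.+1%:R^-1)); first by rewrite ler_wpM2r// lerDl.
    have K1 : 0 < K + 1 by rewrite ltr_wpDl.
    rewrite (le_trans (ler_wpM2l (ltW K1) (ltW Hn0)))//.
    by rewrite invfM mulrCA [_ * (2^-1 / _)]mulrCA mulfV ?mulr1// gt_eqF.
  exact: (midpoint_cauchy_bound s0 K0 (Eub n nn) (Eub k kn) n1 mid sE KE).
have [F [LF HF]] := LP_complete p1 LE cE.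
have LFE n : LP p (fun t => F t - E n t) by exact: (LPB p0 LF (LE n)).1.
have small_tail (K r : R) : 0 <= K -> 0 < r -> exists n0 : nat, forall n, (n0 <= n)%N ->
    K * NP p (fun t => E n t - F t) <= r /\ n.+1%:R^-1 <= r.
  move=> K0 r0; have k0 : 0 < r / (K + 1) by rewrite divr_gt0// ltr_wpDl.
  have [n1 H1] := HF _ k0; have [n2 H2] := small _ r0.
  exists (maxn n1 n2) => n; rewrite geq_max => /andP[/H1 nn1 /inv_le nn2].
  split; last exact: le_trans nn2 (ltW H2).
  apply: le_trans (ler_wpM2l K0 nn1) _.
  by rewrite mulrCA ler_piMr ?(ltW r0)// ler_pdivrMr ?mul1r ?lerDl// ltr_wpDl.
have le_add3 (x y : R) : (forall r : R, 0 < r -> x <= y + r + r + r) -> x <= y.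
  move=> H; apply/ler_addgt0Pr => r r0.
  have := H (r / 3) (divr_gt0 r0 (ltr0n _ 3)); rewrite -!addrA.
  by rewrite (_ : r / 3 + (r / 3 + r / 3) = r)//; field.
have B1 : 0 <= d + 1 by rewrite addr_ge0.
exists F; split; first exact: LF.
- apply: le_add3 => r r0; have [K K0 HK] := LPD_eps p1 B1 r0.
  have [n0 /(_ n0 (leqnn _))[H1 H2]] := small_tail K r K0 r0.
  have n1 : n0.+1%:R^-1 <= 1 :> R by rewrite invf_le1// ler1n.
  have Eb : NP p (E n0) <= d + 1 by rewrite ltW// (lt_le_trans (NE' n0))// lerD2l.
  have := HK _ _ (LE n0) Eb (LFE n0).
  rewrite NPC in H1.
  have -> : NP p (fun t => E n0 t + (F t - E n0 t)) = NP p F.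
    by apply: eq_NP => x; rewrite addrC subrK.
  move=> /le_trans; apply; apply: lerD => //.
  by rewrite lerD2r ltW// (lt_le_trans (NE' n0))// lerD2l.
- move=> m' Mm'; apply: le_add3 => r r0.
  have LFm : LP p (fun t => F t + m' t) by exact: (LPD p0 LF (LM Mm')).1.
  have [K K0 HK] := LPD_eps p1 (NP_ge0 p (fun t => F t + m' t)) r0.
  have [n0 /(_ n0 (leqnn _))[H1 _]] := small_tail K r K0 r0.
  have LEF : LP p (fun t => E n0 t - F t) by exact: (LPB p0 (LE n0) LF).1.
  have := HK _ _ LFm (lexx _) LEF.
  have dm : d <= NP p (fun t => F t + m' t + (E n0 t - F t)).
    apply: (le_NP_eq _ (d_le (Mlin (-1) (Hm n0).1 Mm'))) => x.
    by rewrite /E mulN1r; ring.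
  move=> /(le_trans dm) /le_trans; apply.
  apply: lerD; last first.
    by apply: le_trans H1 _.
  by rewrite -addrA lerD2l lerDl ltW.
- move=> r r0; have [n0 /(_ n0 (leqnn _))H] := HF _ r0.
  exists (m n0); first exact: (Hm n0).1.
  apply: le_trans H; rewrite le_eqVlt; apply/orP; left; apply/eqP.
  by apply: eq_NP => x; rewrite /E addrAC.
Qed.

(* Uniform convexity yields a best approximation of h by limits of M, and the
   derivative of NP at the error annihilates M. *)
Lemma LP_annihilator (eps : R) : 0 < eps ->
  (forall m, M m -> eps <= NP p (fun t => h t - m t)) ->
  exists v, [/\ LP q v, forall m, M m -> cint (fun t => m t * v t) = 0 &
    cint (fun t => h t * v t) != 0].
Proof.
move=> eps0 heps; have [F [LF Fd dF Fh]] := minimizer.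
have d0 : 0 < d.
  apply: lt_le_trans eps0 _; apply: lb_le_inf has_inf_d.1 _ => _ [m Mm <-].
  exact: heps.
have Lv := LP_dmodp p1 pq LF; exists (dmodp p F).
have cge0 m : M m -> 0 <= Re (cint (fun t => m t * dmodp p F t)).
  move=> Mm; apply: (cint_dmodp_ge0 p1 LF (LM Mm)) => s s0.
  apply: le_trans Fd _.
  by apply: (le_NP_eq _ (dF _ (Mlin s%:C%C M0 Mm))) => x; rewrite add0r.
have cZ c m : M m -> cint (fun t => (c * m t) * dmodp p F t) = c * cint (fun t => m t * dmodp p F t).
  move=> Mm; rewrite -cintZ; last exact: (LP_mul_L1 p1 pq (LM Mm) Lv).
  by apply: eq_cint => x; rewrite mulrA.
have MZ c m : M m -> M (fun t => c * m t).
  move=> Mm; have := Mlin c M0 Mm; congr M.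
  by apply/funext => t; rewrite add0r.
have c0 m : M m -> cint (fun t => m t * dmodp p F t) = 0.
  move=> Mm; set c := cint _.
  have H1 := cge0 _ Mm; have H2 := cge0 _ (MZ (-1) _ Mm).
  have H3 := cge0 _ (MZ (Complex 0 1) _ Mm); have H4 := cge0 _ (MZ (Complex 0 (-1)) _ Mm).
  rewrite cZ// in H2; rewrite cZ// in H3; rewrite cZ// in H4.
  move: H1 H2 H3 H4; rewrite -/c !ReImE /= !(oppr0, mul0r, mulN1r, mul1r, sub0r, opprK, subr0) !oppr_ge0.
  move=> H1 H2 H3 H4; apply: complex_ext => /=; apply/eqP; rewrite eq_le.
    by rewrite H1 H2.
  by rewrite H3 H4.
split => //.
have LhF : LP p (fun t => h t - F t) by exact: (LPB p0 Lh LF).1.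
have chF : cint (fun t => (h t - F t) * dmodp p F t) = 0.
  apply: (cint_closure p1 pq LhF Lv) => r /Fh[m Mm Hm].
  by exists m; split => //; [exact: LM|exact: c0].
have -> : cint (fun t => h t * dmodp p F t) = cint (fun t => F t * dmodp p F t).
  rewrite -[RHS]addr0 -chF -(cintD (LP_mul_L1 p1 pq LF Lv) (LP_mul_L1 p1 pq LhF Lv)).
  by apply: eq_cint => x; rewrite -mulrDl addrC subrK.
apply/eqP => /(congr1 (@complex.Re R)) /=.
have -> : \int[@lebesgue_measure R]_(x in @Tdom R) Re (F (e x) * dmodp p F (e x)) = NP p F.
  by apply: eq_Rintegral => x _; rewrite Re_mul_dmodp.
apply/eqP; rewrite gt_eqF//; apply: lt_le_trans d0 _.
by apply: (le_NP_eq _ (dF _ M0)) => x; rewrite addr0.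
Qed.

End Lp_annihilator_theorem.

(** * Uniqueness of Fourier coefficients *)

Section vanishing_on_intervals.
Variable R : realType.
Local Notation mu := (@lebesgue_measure R).
Local Notation D := (@Tdom R).
Local Notation mD := (@measurable_Tdom R).
Local Notation intble f := (mu.-integrable D (EFin \o f)).

Lemma integrals_eq0_ae (f : R -> R) : intble f ->
  (forall y, 0 < y < pi *+ 2 -> \int[mu]_(x in D) (f \_ `]0, y[) x = 0) ->
  {ae mu, forall x, D x -> f x = 0}.
Proof.
move=> fi f0; pose g := f \_ D.
have locg : locally_integrable [set: R] g by exact: (integrable_locally_restrict mD fi).
have gi A : measurable (A : set (measurableTypeR R)) -> mu.-integrable A (EFin \o g).
  move=> mA; apply: (integrableS measurableT) => //; rewrite /g.
  by rewrite (_ : EFin \o _ = (EFin \o f) \_ D);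
    [exact/(integrable_mkcond _ mD).1|rewrite restrict_EFin].
have := FTC1 (a := BLeft 0) (fun y => gi _ (measurable_itv _)) locg.
set F := fun x => _.
have F0 y : 0 < y < pi *+ 2 -> F y = 0.
  move=> y0; have := f0 y y0; rewrite -Rintegral_mkcondr.
  rewrite (_ : D `&` `]0, y[ = `]0, y[%classic); last first.
    apply/seteqP; split => x; rewrite /Tdom /=; first by case.
    rewrite !in_itv/= => /andP[a b]; split; last by rewrite a b.
    by case/andP: y0 => y0 y1; apply/andP; split; apply: ltW => //; exact: lt_trans y1.
  move=> <-; rewrite /F.
  have yD : `[0, y]%classic `<=` D.
    move=> x; rewrite /Tdom /= !in_itv/= => /andP[-> xy] /=.
    by apply: le_trans xy _; apply: ltW; case/andP: y0.
  rewrite (@eq_Rintegral _ _ _ mu _ f); last first.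
    by move=> x /[!inE] /yD Dx; rewrite /g patchE mem_set.
  have i1 : mu.-integrable `[0, y] (EFin \o f).
    by apply: (integrableS mD) => //; exact: measurable_itv.
  have i2 : mu.-integrable `]0, y] (EFin \o f).
    apply: (integrableS _ _ _ i1); [exact: measurable_itv|exact: measurable_itv|].
    exact: subset_itv_oc_cc.
  rewrite -Rintegral_itv_obnd_cbnd// Rintegral_itv_bndo_bndc//.
  apply: (integrableS _ _ _ i2); [exact: measurable_itv|exact: measurable_itv|].
  exact: subset_itv_oo_oc.
move=> H.
have N0 : {ae mu, forall x : R, x != 0 /\ x != pi *+ 2}.
  exists ([set 0] `|` [set pi *+ 2 : R]); split.
  - by apply: measurableU; exact: measurable_set1.
  - apply: null_set_setU; [exact: measurable_set1|exact: measurable_set1| |];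
      exact: lebesgue_measure_set1.
  - move=> x /= /not_andP[/negP|/negP]; rewrite negbK => /eqP ->; [by left|by right].
apply: (aeS2 _ H N0) => x /[swap] -[x0 x2] Hx Dx.
have x02 : 0 < x < pi *+ 2.
  move: Dx; rewrite /Tdom /= in_itv/= => /andP[a b].
  by rewrite !lt_neqAle a b x2 eq_sym x0.
have xgt0 : 0 < x by case/andP: x02.
move: Hx; rewrite /= lte_fin => /(_ xgt0)[_]; rewrite /g patchE mem_set// => <-.
rewrite derive1E (@near_eq_derive _ _ _ _ (cst 0)) ?derive_cst//.
have : \forall z \near x, z \in `]0, (pi *+ 2)[ by apply: near_in_itvoo; rewrite in_itv.
by apply: filterS => z; rewrite in_itv/= => /F0.
Qed.

End vanishing_on_intervals.

Section step_polynomials.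
Variable R : realType.
Implicit Types s y : R.

Lemma bernoulli_exprn y n : -1 <= y -> 1 + y *+ n <= (1 + y) ^+ n.
Proof.
move=> y1; elim: n => [|n IH]; first by rewrite mulr0n addr0 expr0.
rewrite exprS; have y0 : 0 <= 1 + y by lra.
apply: le_trans (ler_wpM2l y0 IH).
have : 0 <= y * y *+ n by rewrite mulrn_wge0// -expr2 sqr_ge0.
by rewrite mulrDr mulr1 mulrDl mul1r mulrnAr mulrS; lra.
Qed.

(* Converges to the indicator of s < 1/2 on [0, 1], by Bernoulli's inequality. *)
Let step n s := (1 - s ^+ n) ^+ (2 ^ n).

Lemma step_01 n s : 0 <= s <= 1 -> 0 <= (1 - s ^+ n) ^+ (2 ^ n) <= 1.
Proof.
move=> /andP[s0 s1]; have a : 0 <= s ^+ n by exact: exprn_ge0.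
have b : s ^+ n <= 1 by exact: exprn_ile1.
by rewrite exprn_ge0 ?exprn_ile1//; lra.
Qed.

Lemma step_cvg1 s : 0 <= s -> s < 2^-1 -> step n s @[n --> \oo] --> (1 : R).
Proof.
move=> s0 s2; have s1 : s <= 1 by lra.
have s01 : 0 <= s <= 1 by rewrite s0 s1.
apply: (@squeeze_cvgr _ _ _ _ (fun n => 1 - (2 * s) ^+ n) (fun=> 1)).
- apply: nearW => n; rewrite andbC; case/andP: (step_01 n s01) => _ -> /=.
  have := @bernoulli_exprn (- s ^+ n) (2 ^ n); rewrite /step.
  rewrite lerN2 exprn_ile1// => /(_ isT); apply: le_trans.
  by rewrite exprMn mulNrn -[s ^+ n *+ _]mulr_natl natrX.
- rewrite -[X in _ --> X]subr0; apply: cvgB; first exact: cvg_cst.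
  by apply: cvg_expr; rewrite ger0_norm; lra.
- exact: cvg_cst.
Qed.

Lemma step_cvg0 s : 2^-1 < s -> s <= 1 -> step n s @[n --> \oo] --> (0 : R).
Proof.
move=> s2 s1; have s0 : 0 <= s by lra.
have s01 : 0 <= s <= 1 by rewrite s0 s1.
apply: (@squeeze_cvgr _ _ _ _ (fun=> 0) (fun n => ((2 * s)^-1) ^+ n)).
- apply: nearW => n; case/andP: (step_01 n s01) => -> _ /=.
  set y := s ^+ n; have y0 : 0 <= y by exact: exprn_ge0.
  have y1 : y <= 1 by exact: exprn_ile1.
  have P0 : 0 < (2 * s) ^+ n by apply: exprn_gt0; lra.
  rewrite exprVn -[leRHS]mul1r ler_pdivlMr//.
  have H : (2 * s) ^+ n <= (1 + y) ^+ (2 ^ n).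
    have y11 : -1 <= y by lra.
    apply: le_trans (bernoulli_exprn (2 ^ n) y11).
    by rewrite exprMn -/y -natrX mulr_natl lerDr.
  apply: le_trans (ler_wpM2l _ H) _; first by case/andP: (step_01 n s01).
  rewrite /step -/y -exprMn exprn_ile1//.
    by rewrite mulr_ge0// ?subr_ge0 ?addr_ge0.
  by rewrite (_ : (1 - y) * (1 + y) = 1 - y * y) ?lerBlDr ?lerDl ?mulr_ge0//; ring.
- exact: cvg_cst.
- apply: cvg_expr; rewrite ger0_norm ?invr_ge0; last lra.
  by rewrite invf_lt1; lra.
Qed.

End step_polynomials.

Section fourier_uniqueness.
Variable R : realType.
Local Notation C := R[i].
Local Notation mu := (@lebesgue_measure R).
Local Notation D := (@Tdom R).
Local Notation Re := complex.Re.
Local Notation Im := complex.Im.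
Local Notation e := (@circ_pt R).
Local Notation intble f := (mu.-integrable D (EFin \o f)).
Local Notation mD := (@measurable_Tdom R).
Implicit Types (f g v w : C -> C).

Lemma L1_LP1 f : L1 f <-> LP 1 f.
Proof.
split=> [lf|[[m1 m2] i]].
  split; first exact: L1_cmeasurable.
  have [f1 f2] := lf.
  apply: (eq_intble mD _ (intbleD mD (integrable_norm f1) (integrable_norm f2))).
  by move=> x _; rewrite /modp !powRr1.
by split; [apply: (dominated_integrable mD m1 i)|apply: (dominated_integrable mD m2 i)] => x _;
  rewrite /modp !powRr1// ?lerDl ?lerDr.
Qed.

Lemma L1M v w : L1 v -> Linf w -> L1 (fun t => v t * w t).
Proof.
move=> /L1_LP1 lv lw; apply/L1_LP1.
by apply: eq_LP (LPM_ ltr01 lw lv) => x; rewrite mulrC.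
Qed.

Lemma LinfD w1 w2 : Linf w1 -> Linf w2 -> Linf (fun t => w1 t + w2 t).
Proof.
move=> [m1 [M1 H1]] [m2 [M2 H2]]; split; first exact: cmeasurableD.
exists (M1 + M2); apply: aeS2 H1 H2 => x /[swap] h2 /[swap] Dx => /(_ Dx) h1.
rewrite cabsE (le_trans (le_normcD _ _))// -!cabsE lerD//; exact: h2.
Qed.

Section annihilated_multipliers.
Variables (v : C -> C) (lv : L1 v).
Hypothesis v0 : forall n : int, cint (fun t => v t * t ^ n) = 0.

Let A w := Linf w /\ forall n : int, cint (fun t => v t * (w t * t ^ n)) = 0.

Let L1w w (n : int) : Linf w -> L1 (fun t => v t * (w t * t ^ n)).
Proof. by move=> lw; apply: L1M => //; apply: LinfM => //; exact: Linf_exprz. Qed.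

Let A1 : A (fun=> 1).
Proof.
split; first exact: Linf_cst.
by move=> n; rewrite -[RHS](v0 n); apply: eq_cint => x; rewrite mul1r.
Qed.

Let AD w1 w2 : A w1 -> A w2 -> A (fun t => w1 t + w2 t).
Proof.
move=> [l1 h1] [l2 h2]; split; first exact: LinfD.
move=> n; rewrite -[RHS]addr0 -{1}(h1 n) -(h2 n) -cintD; [|exact: L1w|exact: L1w].
by apply: eq_cint => x; rewrite mulrDl mulrDr.
Qed.

Let AZ c w : A w -> A (fun t => c * w t).
Proof.
move=> [l1 h1]; split; first by apply: LinfM => //; exact: Linf_cst.
move=> n; rewrite -[RHS](mulr0 c) -(h1 n) -cintZ; last exact: L1w.
by apply: eq_cint => x; rewrite -mulrA mulrCA.
Qed.

Let AX (k : int) w : A w -> A (fun t => t ^ k * w t).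
Proof.
move=> [l1 h1]; split; first by apply: LinfM => //; exact: Linf_exprz.
move=> n; rewrite -(h1 (k + n)); apply: eq_cint => x.
by rewrite expfzDr ?circ_neq0//; ring.
Qed.

Variable c : R.
(* On the circle, S (e^{ix}) = 1/2 - (cos (x - c) - cos c) / 4, which lies in [0, 1]
   and is below 1/2 exactly on the arc 0 < x < 2c. *)
Let S (t : C) : C := (2^-1 + cos c / 4)%:C%C +
  (- (8%:R^-1)%:C%C) * (t ^ 1 * e (- c) + t ^ (-1) * e c).

Let S_real x : S (e x) = (2^-1 - (cos (x - c) - cos c) / 4)%:C%C.
Proof.
rewrite /S expr1z -[e x ^ (-1)]/((e x)^-1) -circN -!circD.
have E : - x + c = - (x - c) by ring.
apply: complex_ext; rewrite !ReImE /= E ?cosN ?sinN.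
  by field.
by ring.
Qed.

Let AS w : A w -> A (fun t => S t * w t).
Proof.
move=> Aw; have H : A (fun t => (2^-1 + cos c / 4)%:C%C * w t
    + (- (8%:R^-1)%:C%C) * (e (- c) * (t ^ 1 * w t) + e c * (t ^ (-1) * w t))).
  by apply: AD; [exact: AZ|apply: AZ; apply: AD; apply: AZ; exact: AX].
congr A: H; apply/funext => t; rewrite /S; ring.
Qed.

Let ASn n w : A w -> A (fun t => S t ^+ n * w t).
Proof.
elim: n => [|n IH] Aw; first by congr A: Aw; apply/funext => t; rewrite expr0 mul1r.
by congr A: (AS (IH Aw)); apply/funext => t; rewrite exprS mulrA.
Qed.

Let Astep n N : A (fun t => (1 - S t ^+ n) ^+ N).
Proof.
elim: N => [|N IH]; first by congr A: A1; apply/funext => t; rewrite expr0.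
congr A: (AD IH (AZ (-1) (ASn n IH))); apply/funext => t.
by rewrite exprS mulN1r -mulNr -{1}[_ ^+ N]mul1r -mulrDl.
Qed.

Hypothesis c0 : 0 < c < pi.

Let sigma x := 2^-1 - (cos (x - c) - cos c) / 4.

Let sigma01 x : 0 <= sigma x <= 1.
Proof.
rewrite /sigma; have /andP[a1 a2] : -1 <= cos (x - c) <= 1 by rewrite cos_geN1 cos_le1.
have /andP[b1 b2] : -1 <= cos c <= 1 by rewrite cos_geN1 cos_le1.
by apply/andP; split; lra.
Qed.

Let cos_dec (y z : R) : 0 <= y -> y < z -> z <= pi -> cos z < cos y.
Proof.
move=> y0 yz zp; rewrite ltr_cos// in_itv/=; apply/andP; split => //; lra.
Qed.

Let sigma_in x : 0 < x < c *+ 2 -> sigma x < 2^-1.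
Proof.
case/andP: c0 => c1 c2 /andP[x0 x1]; rewrite /sigma ltrBlDr ltrDl divr_gt0// subr_gt0.
rewrite -(cos_norm (x - c)); apply: cos_dec; [by []| |exact: ltW].
by rewrite ltr_norml; apply/andP; split; lra.
Qed.

Let sigma_out x : c *+ 2 < x < pi *+ 2 -> 2^-1 < sigma x.
Proof.
case/andP: c0 => c1 c2 /andP[x0 x1]; rewrite /sigma ltrBrDr gtrDl pmulr_llt0// subr_lt0.
have [xp|xp] := leP (x - c) pi.
  by apply: cos_dec => //; lra.
rewrite -(cosN (x - c)) -cosD2pi; apply: cos_dec; lra.
Qed.

Let annihilated_arc (P : C -> R) : (forall z (r : R), P (z * r%:C%C) = P z * r) ->
  (P 0 = 0) -> (forall w, P (cint w) = \int[mu]_(x in D) P (w (e x))) ->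
  intble (fun x => P (v (e x))) ->
  \int[mu]_(x in D) ((fun x => P (v (e x))) \_ `]0, c *+ 2[) x = 0.
Proof.
move=> PM P0 Pint iP.
pose T n x : R := (1 - sigma x ^+ n) ^+ (2 ^ n).
have TE n x : (1 - S (e x) ^+ n) ^+ (2 ^ n) = (T n x)%:C%C.
  rewrite S_real /T -/(sigma x); move: (sigma x) => s.
  by rewrite rmorphXn rmorphB rmorph1 rmorphXn.
have int0 n : \int[mu]_(x in D) (P (v (e x)) * T n x) = 0.
  have [_ /(_ 0%R)/(congr1 P)] := Astep n (2 ^ n); rewrite P0 Pint => <-.
  by apply: eq_Rintegral => x _; rewrite expr0z mulr1 TE PM.
have mP := intble_measurable iP.
have ms : measurable_fun setT sigma.
  apply: continuous_measurable_fun => x; rewrite /sigma.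
  apply: cvgB; first exact: cvg_cst.
  apply: cvgMl; apply: cvgB; last exact: cvg_cst.
  apply: (@continuous_comp _ _ _ (fun x => x - c) cos); last exact: continuous_cos.
  by apply: cvgB; [exact: cvg_id|exact: cvg_cst].
have mT n : measurable_fun D (T n).
  apply: measurable_funX; apply: measurable_funB; first exact: measurable_cst.
  by apply: measurable_funX; exact: measurable_funTS.
have mf n : measurable_fun D (fun x => P (v (e x)) * T n x).
  by apply: measurable_funM.
have mR : measurable_fun D ((fun x => P (v (e x))) \_ `]0, c *+ 2[).
  apply/(measurable_restrict _ _ _).1; [exact: measurable_itv|exact: mD|].
  by apply: measurable_funS mP; [exact: mD|exact: subIsetl].
have H := @dominated_cvg_Rintegral _ _ _ mu D mD (fun n x => P (v (e x)) * T n x)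
  ((fun x => P (v (e x))) \_ `]0, c *+ 2[) (fun x => `|P (v (e x))|) mf mR
  (integrable_norm iP).
suff cv : \int[mu]_(x in D) (P (v (e x)) * T n x) @[n --> \oo]
    --> \int[mu]_(x in D) ((fun x => P (v (e x))) \_ `]0, c *+ 2[) x.
  have c00 : \int[mu]_(x in D) (P (v (e x)) * T n x) @[n --> \oo] --> (0 : R).
    rewrite (_ : (fun n => _) = (fun=> 0)); first exact: cvg_cst.
    exact/funext.
  exact: (cvg_unique (@Rhausdorff R) cv c00).
apply: H.
- move=> n; apply: aeW => x _; rewrite normrM ler_piMr//.
  by case/andP: (step_01 n (sigma01 x)) => a b; rewrite ger0_norm.
- have N0 : {ae mu, forall x : R, x \notin [:: 0; c *+ 2; pi *+ 2]}.
    exists ([set 0] `|` ([set c *+ 2] `|` [set pi *+ 2 : R])); split.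
    + by apply: measurableU; [|apply: measurableU]; exact: measurable_set1.
    + apply: null_set_setU; [exact: measurable_set1| | exact: lebesgue_measure_set1|].
        by apply: measurableU; exact: measurable_set1.
      apply: null_set_setU; [exact: measurable_set1|exact: measurable_set1| |];
      exact: lebesgue_measure_set1.
    + move=> x /= /negP; rewrite negbK !inE => /or3P[] /eqP ->;
        [by left|by right; left|by right; right].
  apply: aeS N0 => x; rewrite !inE !negb_or => /and3P[x0 xc x2] Dx.
  have /andP[Dx0 Dx2] : 0 < x < pi *+ 2.
    by move: Dx; rewrite /Tdom /= in_itv/= !lt_neqAle => /andP[-> ->]; rewrite x2 eq_sym x0.
  have /andP[sx0 sx1] := sigma01 x; rewrite patchE.
  have [xc1|xc1] := ltP x (c *+ 2).
    rewrite mem_set/= ?in_itv/= ?Dx0// -[X in _ --> X]mulr1.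
    by apply: cvgMr; apply: step_cvg1 => //; apply: sigma_in; rewrite Dx0.
  rewrite memNset/=; last by rewrite in_itv/= Dx0/= ltNge xc1.
  rewrite -[X in _ --> X](mulr0 (P (v (e x)))).
  apply: cvgMr; apply: step_cvg0 => //; apply: sigma_out.
  by rewrite Dx2 lt_neqAle xc1 eq_sym xc.
Qed.

Lemma annihilated_arcs :
  \int[mu]_(x in D) ((fun x => Re (v (e x))) \_ `]0, c *+ 2[) x = 0 /\
  \int[mu]_(x in D) ((fun x => Im (v (e x))) \_ `]0, c *+ 2[) x = 0.
Proof.
split; apply: annihilated_arc => //; try by case: lv.
- by move=> z r; rewrite !ReImE /= mulr0 subr0.
- by move=> z r; rewrite !ReImE /= mulr0 add0r.
Qed.

End annihilated_multipliers.

Lemma L1_fourier_eq0 v : L1 v -> (forall n : int, cint (fun t => v t * t ^ n) = 0) ->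
  ae_eqc v (fun=> 0).
Proof.
move=> lv v0; have arcs y : 0 < y < pi *+ 2 ->
    \int[mu]_(x in D) ((fun x => Re (v (e x))) \_ `]0, y[) x = 0 /\
    \int[mu]_(x in D) ((fun x => Im (v (e x))) \_ `]0, y[) x = 0.
  move=> /andP[y0 y1]; have := @annihilated_arcs v lv v0 (y / 2).
  have -> : (y / 2) *+ 2 = y by rewrite -mulr_natr divfK.
  by apply; apply/andP; split; lra.
have [l1 l2] := lv.
have h1 := integrals_eq0_ae l1 (fun y hy => (arcs y hy).1).
have h2 := integrals_eq0_ae l2 (fun y hy => (arcs y hy).2).
by apply: aeS2 h1 h2 => x /[swap] a /[swap] Dx => /(_ Dx) b; apply: complex_ext; rewrite ?b ?a.
Qed.

End fourier_uniqueness.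

(** * Trigonometric polynomials *)

Section pointwise_derivatives.
Variable R : realType.
Implicit Types (f g : R -> R) (x : R).

Lemma derD f g x (df dg : R) : is_derive x 1 f df -> is_derive x 1 g dg ->
  is_derive x 1 (fun y => f y + g y) (df + dg).
Proof. by move=> H1 H2; exact: is_deriveD. Qed.

Lemma derM f g x (df dg : R) : is_derive x 1 f df -> is_derive x 1 g dg ->
  is_derive x 1 (fun y => f y * g y) (df * g x + f x * dg).
Proof.
move=> H1 H2; apply: (is_derive_eq (is_deriveM H1 H2)).
by rewrite addrC; congr (_ + _); rewrite [LHS]mulrC.
Qed.

Lemma derZ c f x (df : R) : is_derive x 1 f df ->
  is_derive x 1 (fun y => c * f y) (c * df).
Proof. by move=> H; exact: is_deriveZ. Qed.

Lemma derN f x (df : R) : is_derive x 1 f df -> is_derive x 1 (fun y => - f y) (- df).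
Proof. by move=> H; exact: is_deriveN. Qed.

Lemma der_cst c x : is_derive x 1 (fun=> c) (0 : R).
Proof. exact: is_derive_cst. Qed.

Lemma der_comp f g x (df dg : R) : is_derive (f x) 1 g dg -> is_derive x 1 f df ->
  is_derive x 1 (fun y => g (f y)) (dg * df).
Proof. by move=> H1 H2; exact: (is_derive1_comp H1 H2). Qed.

Lemma der_sum n (h : 'I_n -> R -> R) (dh : 'I_n -> R) x :
  (forall i, is_derive x 1 (h i) (dh i)) ->
  is_derive x 1 (fun y => \sum_(i < n) h i y) (\sum_(i < n) dh i).
Proof.
move=> H; rewrite (_ : (fun y => _) = \sum_(i < n) h i); first exact: is_derive_sum.
by apply/funext => y; rewrite fct_sumE.
Qed.

Lemma der_continuous f x (df : R) : is_derive x 1 f df -> {for x, continuous f}.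
Proof. by case=> d _; apply: differentiable_continuous; apply/derivable1_diffP. Qed.

Lemma der_cos_lin (r x : R) : is_derive x 1 (fun y => cos (r * y)) (- r * sin (r * x)).
Proof.
apply: (is_derive_eq (der_comp (is_derive_cos (r * x)) (derZ r (is_derive_id x 1)))).
by rewrite mulr1 mulNr mulrC mulNr.
Qed.

Lemma der_sin_lin (r x : R) : is_derive x 1 (fun y => sin (r * y)) (r * cos (r * x)).
Proof.
apply: (is_derive_eq (der_comp (is_derive_sin (r * x)) (derZ r (is_derive_id x 1)))).
by rewrite mulr1 mulrC.
Qed.

End pointwise_derivatives.

Section trigonometric_polynomials.
Variable R : realType.
Local Notation C := R[i].
Local Notation mu := (@lebesgue_measure R).
Local Notation D := (@Tdom R).
Local Notation Re := complex.Re.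
Local Notation Im := complex.Im.
Local Notation e := (@circ_pt R).
Local Notation mD := (@measurable_Tdom R).
Implicit Types (f g v w : C -> C) (P Q : {poly C}).

Lemma circ_exprz x (n : int) : e x ^ n = e (n%:~R * x).
Proof.
case: n => n; first by rewrite -exprnP circX pmulrn mulr_natl.
by rewrite NegzE -exprnN circX -circN rmorphN /= mulNr mulr_natl.
Qed.

Lemma Rintegral_Tdom_derive (F f : R -> R) :
  (forall x : R, is_derive x 1 F (f x)) -> continuous f ->
  \int[mu]_(x in D) f x = F (pi *+ 2) - F 0.
Proof.
move=> dF cf; have cF x : F y @[y --> x] --> F x.
  by apply: differentiable_continuous; apply/derivable1_diffP; case: (dF x).
rewrite /Rintegral (@continuous_FTC2 _ f F)//.
- by rewrite mulrn_wgt0 ?pi_gt0.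
- exact: continuous_subspaceT.
- split; first by move=> x _; case: (dF x).
    exact: cvg_at_right_filter.
  exact: cvg_at_left_filter.
- by move=> x _; rewrite derive1E derive_val.
Qed.

Lemma cint_exprz (n : int) : n != 0 -> cint (fun t : C => t ^ n) = 0.
Proof.
move=> n0; set r : R := n%:~R; have r0 : r != 0 by rewrite intr_eq0.
have e2 : e (r * (pi *+ 2)) = 1.
  by rewrite -circ_exprz -[pi *+ 2]add0r circ2pi circ0 exp1rz.
have c2 : cos (r * (pi *+ 2)) = 1 := congr1 (@complex.Re R) e2.
have s2 : sin (r * (pi *+ 2)) = 0 := congr1 (@complex.Im R) e2.
have dr (x : R) : is_derive x 1 (fun y => r^-1 * sin (r * y)) (cos (r * x)).
  by apply: (is_derive_eq (derZ r^-1 (der_sin_lin r x))); rewrite mulKf.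
have di (x : R) : is_derive x 1 (fun y => (- r^-1) * cos (r * y)) (sin (r * x)).
  by apply: (is_derive_eq (derZ (- r^-1) (der_cos_lin r x))); rewrite mulrA mulrNN mulVf ?mul1r.
apply: complex_ext => /=.
  have -> : \int[mu]_(x in D) Re (e x ^ n) = \int[mu]_(x in D) cos (r * x).
    by apply: eq_Rintegral => x _; rewrite circ_exprz.
  rewrite (Rintegral_Tdom_derive dr) => [|x]; last exact: (der_continuous (der_cos_lin r x)).
  by rewrite s2 !mulr0 sin0 mulr0 subrr.
have -> : \int[mu]_(x in D) Im (e x ^ n) = \int[mu]_(x in D) sin (r * x).
  by apply: eq_Rintegral => x _; rewrite circ_exprz.
rewrite (Rintegral_Tdom_derive di) => [|x]; last exact: (der_continuous (der_sin_lin r x)).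
by rewrite c2 mulr0 cos0 subrr.
Qed.

Lemma cint1 : cint (fun=> 1 : C) != 0.
Proof.
apply/eqP => /(congr1 (@complex.Re R)) /=; rewrite Rintegral_cst; last exact: mD.
rewrite mul1r -[fine _]/(fine (mu D)) mu_Tdom /= => /eqP.
by rewrite gt_eqF// mulrn_wgt0// pi_gt0.
Qed.

Definition trigpoly P Q (t : C) : C := P.[t] + t^-1 * Q.[t^-1].

Lemma cmeasurable_horner P : cmeasurable (fun t => P.[t]).
Proof.
elim/poly_ind: P => [|P c IH].
  by under eq_fun do rewrite horner0; exact: cmeasurable_cst.
under eq_fun do rewrite hornerMXaddC.
apply: cmeasurableD; last exact: cmeasurable_cst.
by apply: cmeasurableM => //; exact: cmeasurable_id.
Qed.

Lemma Linf_horner P : Linf (fun t => P.[t]).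
Proof.
elim/poly_ind: P => [|P c IH].
  by under eq_fun do rewrite horner0; exact: Linf_cst.
under eq_fun do rewrite hornerMXaddC.
by apply: LinfD; [apply: LinfM => //; exact: (Linf_exprz _ 1)|exact: Linf_cst].
Qed.

Lemma Linf_hornerV P : Linf (fun t => P.[t^-1]).
Proof.
elim/poly_ind: P => [|P c IH].
  by under eq_fun do rewrite horner0; exact: Linf_cst.
under eq_fun do rewrite hornerMXaddC.
by apply: LinfD; [apply: LinfM => //; exact: (Linf_exprz _ (-1))|exact: Linf_cst].
Qed.

Lemma Linf_trigpoly P Q : Linf (trigpoly P Q).
Proof.
apply: LinfD; first exact: Linf_horner.
by apply: LinfM; [exact: (Linf_exprz _ (-1))|exact: Linf_hornerV].
Qed.

Lemma trigpoly_lin c P1 Q1 P2 Q2 t :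
  trigpoly P1 Q1 t + c * trigpoly P2 Q2 t = trigpoly (P1 + c *: P2) (Q1 + c *: Q2) t.
Proof. by rewrite /trigpoly !hornerD !hornerZ; ring. Qed.

Lemma exprz_trigpoly (n : int) : exists P Q, (fun t : C => t ^ n) = trigpoly P Q.
Proof.
case: n => n.
  exists 'X^n, 0; apply/funext => t.
  by rewrite /trigpoly hornerXn horner0 mulr0 addr0.
exists 0, 'X^n; apply/funext => t.
by rewrite /trigpoly hornerXn horner0 add0r -exprS NegzE -exprnN exprVn.
Qed.

Variables (p q : R).
Hypotheses (p1 : 1 < p) (pq : p^-1 + q^-1 = 1).
Let p0 : 0 < p. Proof. by rewrite (lt_trans ltr01). Qed.

Lemma conj_gt1 : 1 < q.
Proof.
have ip : p^-1 < 1 by rewrite invf_lt1.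
have ip0 : 0 < p^-1 by rewrite invr_gt0.
have iq : q^-1 = 1 - p^-1 by rewrite -pq addrAC subrr add0r.
have iq0 : 0 < q^-1 by rewrite iq subr_gt0.
by rewrite -[q]invrK invf_gt1// iq ltrBlDr ltrDl.
Qed.

Lemma trigpoly_dense f (eps : R) : LP p f -> 0 < eps ->
  exists P Q, NP p (fun t => f t - trigpoly P Q t) < eps.
Proof.
move=> lf e0; apply: contrapT => H.
pose M m := exists P Q, m = trigpoly P Q.
have LM m : M m -> LP p m by move=> [P [Q ->]]; apply: Linf_LP => //; exact: Linf_trigpoly.
have M0 : M (fun=> 0).
  exists 0, 0; apply/funext => t; by rewrite /trigpoly !horner0 mulr0 addr0.
have Ml c m1 m2 : M m1 -> M m2 -> M (fun t => m1 t + c * m2 t).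
  move=> [P1 [Q1 ->]] [P2 [Q2 ->]]; exists (P1 + c *: P2), (Q1 + c *: Q2).
  by apply/funext => t; rewrite trigpoly_lin.
have [|v [lv v0 /eqP]] := LP_annihilator p1 pq LM M0 Ml lf e0.
  move=> m [P [Q ->]]; rewrite leNgt; apply/negP => h; apply: H.
  by exists P, Q.
apply; have q1 := conj_gt1.
have qp : q^-1 + p^-1 = 1 by rewrite addrC.
have lv1 := LP_L1 q1 qp lv.
have vz : ae_eqc v (fun=> 0).
  apply: (L1_fourier_eq0 lv1) => n; rewrite -[RHS](v0 (fun t => t ^ n)).
    by apply: eq_cint => x; rewrite mulrC.
  exact: exprz_trigpoly.
rewrite (@cint_ae_eq _ _ (fun=> 0)).
- by rewrite /cint; apply: complex_ext; rewrite /= Rintegral_cst ?mul0r//; exact: mD.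
- exact: L1_cmeasurable (LP_mul_L1 p1 pq lf lv).
- exact: cmeasurable_cst.
- by apply: aeS vz => x /[apply] ->; rewrite mulr0.
Qed.

End trigonometric_polynomials.

(** * The Riesz projection *)

Section smooth_expressions.
Variable R : realType.

(* A syntactic class of smooth functions on the plane, closed under both partial
   derivatives: iterated derivatives are computed by recursion. *)
Inductive sexpr := SX | SY | SCst of R | SAdd of sexpr & sexpr
  | SMul of sexpr & sexpr | SPow of sexpr & R.

Fixpoint sev (E : sexpr) (x y : R) : R :=
  match E with
  | SX => x | SY => y | SCst c => c
  | SAdd E1 E2 => sev E1 x y + sev E2 x y
  | SMul E1 E2 => sev E1 x y * sev E2 x y
  | SPow E1 s => sev E1 x y `^ s
  end.

Fixpoint sdiff (b : bool) (E : sexpr) : sexpr :=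
  match E with
  | SX => SCst (~~ b)%:R | SY => SCst b%:R | SCst c => SCst 0
  | SAdd E1 E2 => SAdd (sdiff b E1) (sdiff b E2)
  | SMul E1 E2 => SAdd (SMul (sdiff b E1) E2) (SMul E1 (sdiff b E2))
  | SPow E1 s => SMul (SMul (SCst s) (SPow E1 (s - 1))) (sdiff b E1)
  end.
Local Notation dX := (sdiff false).
Local Notation dY := (sdiff true).

(* Bases of powers stay away from 0, where powR is not smooth. *)
Fixpoint swf (E : sexpr) : Prop :=
  match E with
  | SX | SY | SCst _ => True
  | SAdd E1 E2 | SMul E1 E2 => swf E1 /\ swf E2
  | SPow E1 s => (exists2 d, 0 < d & forall x y, d <= sev E1 x y) /\ swf E1
  end.

Lemma swf_sdiff b E : swf E -> swf (sdiff b E).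
Proof.
elim: E => //= [E1 H1 E2 H2|E1 H1 E2 H2|E1 H1 s].
- by move=> [/H1 ? /H2 ?].
- by move=> [w1 w2]; do ![split]; rewrite ?H1 ?H2; auto.
- by move=> [h w]; do ![split] => //; exact: H1.
Qed.

Lemma sev_sdiffC E x y : sev (dX (dY E)) x y = sev (dY (dX E)) x y.
Proof.
elim: E => //= [E1 -> E2 ->//|E1 H1 E2 H2|E1 H1 s]; first by rewrite H1 H2; ring.
by rewrite H1; ring.
Qed.

Lemma der_sev E (u v : R -> R) (z du dv : R) : swf E ->
  is_derive z 1 u du -> is_derive z 1 v dv ->
  is_derive z 1 (fun z => sev E (u z) (v z))
    (sev (dX E) (u z) (v z) * du + sev (dY E) (u z) (v z) * dv).
Proof.
move=> + hu hv; elim: E => [| |c|E1 H1 E2 H2|E1 H1 E2 H2|E1 H1 s] /=.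
- by move=> _; apply: (is_derive_eq hu); rewrite mul1r mul0r addr0.
- by move=> _; apply: (is_derive_eq hv); rewrite mul1r mul0r add0r.
- by move=> _; apply: (is_derive_eq (der_cst c z)); rewrite !mul0r addr0.
- move=> [/H1 h1 /H2 h2]; apply: (is_derive_eq (derD h1 h2)); ring.
- move=> [/H1 h1 /H2 h2]; apply: (is_derive_eq (derM h1 h2)); ring.
- move=> [[d d0 hd] /H1 h1].
  have E0 : 0 < sev E1 (u z) (v z) by exact: lt_le_trans (hd _ _).
  have H := @der_comp _ (fun z => sev E1 (u z) (v z)) (fun y => y `^ s) z _ _
    (is_derive1_powR s E0) h1.
  by apply: (is_derive_eq H); ring.
Qed.

Lemma sev_bounded E M : swf E -> exists K, forall x y, `|x| <= M -> `|y| <= M ->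
  `|sev E x y| <= K.
Proof.
elim: E => [| |c|E1 H1 E2 H2|E1 H1 E2 H2|E1 H1 s] /=.
- by exists M.
- by exists M.
- by exists `|c|.
- move=> [/H1[K1 b1] /H2[K2 b2]]; exists (K1 + K2) => x y xM yM.
  by rewrite (le_trans (ler_normD _ _))// lerD ?b1 ?b2.
- move=> [/H1[K1 b1] /H2[K2 b2]]; exists (K1 * K2) => x y xM yM.
  by rewrite normrM ler_pM ?b1 ?b2.
- move=> [[d d0 hd] /H1[K1 b1]]; exists (K1 `^ s + d `^ s) => x y xM yM.
  have E0 : 0 < sev E1 x y by exact: lt_le_trans (hd _ _).
  have E1K : sev E1 x y <= K1 by rewrite (le_trans (ler_norm _))// b1.
  rewrite ger0_norm ?powR_ge0//; have [s0|s0] := leP 0 s.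
    by rewrite ler_wpDr ?powR_ge0// ge0_ler_powR ?nnegrE ?(ltW E0)// (le_trans (ltW E0)).
  rewrite ler_wpDl ?powR_ge0// -[s]opprK !(powRN _ (- s)) lef_pV2 ?posrE ?powR_gt0//.
  by rewrite ge0_ler_powR ?nnegrE ?(ltW E0) ?(ltW d0) ?oppr_ge0 ?(ltW s0) ?hd.
Qed.

End smooth_expressions.

Section harmonic_pair.
Variables (R : realType) (N : nat).
Implicit Types (a b : 'I_N -> R) (r x : R).

(* The real and imaginary parts of sum_k (a_k + i b_k) (r e^{ix})^k. *)
Definition hpU a b r x : R :=
  \sum_(k < N) r ^+ k * (a k * cos (k%:R * x) - b k * sin (k%:R * x)).
Definition hpV a b r x : R :=
  \sum_(k < N) r ^+ k * (a k * sin (k%:R * x) + b k * cos (k%:R * x)).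
Definition kth a : 'I_N -> R := fun k => k%:R * a k.
Definition hpU' a b r x : R :=
  \sum_(k < N) (k%:R * r ^+ k.-1) * (a k * cos (k%:R * x) - b k * sin (k%:R * x)).
Definition hpV' a b r x : R :=
  \sum_(k < N) (k%:R * r ^+ k.-1) * (a k * sin (k%:R * x) + b k * cos (k%:R * x)).

Lemma der_exprn k r : is_derive r 1 (fun z : R => z ^+ k) (k%:R * r ^+ k.-1).
Proof.
elim: k => [|k IH]; first by apply: (is_derive_eq (der_cst 1 r)); rewrite mul0r.
rewrite (_ : (fun z => _) = (fun z => z * z ^+ k)); last first.
  by apply/funext => z; rewrite exprS.
apply: (is_derive_eq (derM (is_derive_id r 1) IH)).
rewrite mul1r -natr1 mulrDl mul1r addrC; congr (_ + _).
by case: k {IH} => [|k] /=; rewrite ?mul0r ?mulr0// mulrCA exprS.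
Qed.

Lemma derMr (f : R -> R) (c z df : R) : is_derive z 1 f df ->
  is_derive z 1 (fun y => f y * c) (df * c).
Proof.
by move=> H; apply: (is_derive_eq (derM H (der_cst c z))); rewrite mulr0 addr0.
Qed.

Lemma der_hpU_r a b r x : is_derive r 1 (fun r => hpU a b r x) (hpU' a b r x).
Proof. by apply: der_sum => k; apply: derMr; exact: der_exprn. Qed.

Lemma der_hpV_r a b r x : is_derive r 1 (fun r => hpV a b r x) (hpV' a b r x).
Proof. by apply: der_sum => k; apply: derMr; exact: der_exprn. Qed.

Lemma der_hpU_x a b r x : is_derive x 1 (hpU a b r) (- hpV (kth a) (kth b) r x).
Proof.
rewrite /hpV -sumrN; apply: der_sum => k.
have H := derZ (r ^+ k) (derD (derZ (a k) (der_cos_lin k%:R x)) (derZ (- b k) (der_sin_lin k%:R x))).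
rewrite (_ : (fun y => _) = (fun y => r ^+ k * (a k * cos (k%:R * y) + - b k * sin (k%:R * y)))).
  by apply: (is_derive_eq H); rewrite /kth; ring.
by apply/funext => y; rewrite mulNr.
Qed.

Lemma der_hpV_x a b r x : is_derive x 1 (hpV a b r) (hpU (kth a) (kth b) r x).
Proof.
apply: der_sum => k.
have H := derZ (r ^+ k) (derD (derZ (a k) (der_sin_lin k%:R x)) (derZ (b k) (der_cos_lin k%:R x))).
by apply: (is_derive_eq H); rewrite /kth; ring.
Qed.

Lemma mul_hpU' a b r x : r * hpU' a b r x = hpU (kth a) (kth b) r x.
Proof.
rewrite /hpU' /hpU mulr_sumr; apply: eq_bigr => k _.
rewrite /kth; case: k => -[|k] kN /=; first by rewrite !mul0r !mulr0 subrr mulr0.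
by rewrite exprS; ring.
Qed.

Lemma mul_hpV' a b r x : r * hpV' a b r x = hpV (kth a) (kth b) r x.
Proof.
rewrite /hpV' /hpV mulr_sumr; apply: eq_bigr => k _.
rewrite /kth; case: k => -[|k] kN /=; first by rewrite !mul0r !mulr0 addr0 mulr0.
by rewrite exprS; ring.
Qed.

Definition bounded2 (h : R -> R -> R) := exists K, forall r x, `|r| <= 2 -> `|h r x| <= K.

Lemma bounded2D h1 h2 : bounded2 h1 -> bounded2 h2 -> bounded2 (fun r x => h1 r x + h2 r x).
Proof.
move=> [K1 H1] [K2 H2]; exists (K1 + K2) => r x r2.
by rewrite (le_trans (ler_normD _ _))// lerD ?H1 ?H2.
Qed.

Lemma bounded2N h : bounded2 h -> bounded2 (fun r x => - h r x).
Proof. by move=> [K H]; exists K => r x r2; rewrite normrN H. Qed.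

Lemma bounded2M h1 h2 : bounded2 h1 -> bounded2 h2 -> bounded2 (fun r x => h1 r x * h2 r x).
Proof.
move=> [K1 H1] [K2 H2]; exists (K1 * K2) => r x r2.
by rewrite normrM ler_pM ?H1 ?H2.
Qed.

Lemma bounded2_sum (h : 'I_N -> R -> R -> R) : (forall k, bounded2 (h k)) ->
  bounded2 (fun r x => \sum_(k < N) h k r x).
Proof.
move=> /choice[K HK]; exists (\sum_(k < N) K k) => r x r2.
by rewrite (le_trans (ler_norm_sum _ _ _))// ler_sum// => k _; exact: HK.
Qed.

Lemma bounded2_cst c : bounded2 (fun _ _ => c).
Proof. by exists `|c|. Qed.

Lemma bounded2_cos (s : R) : bounded2 (fun _ x => cos (s * x)).
Proof. by exists 1 => r x _; rewrite ler_norml cos_geN1 cos_le1. Qed.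

Lemma bounded2_sin (s : R) : bounded2 (fun _ x => sin (s * x)).
Proof. by exists 1 => r x _; rewrite ler_norml sin_geN1 sin_le1. Qed.

Lemma bounded2_expr k : bounded2 (fun r _ => r ^+ k).
Proof.
by exists (2 ^+ k) => r x r2; rewrite normrX lerXn2r ?nnegrE.
Qed.

Hint Resolve bounded2_cst bounded2_cos bounded2_sin bounded2_expr : core.

Lemma bounded2_hpU a b : bounded2 (hpU a b).
Proof.
apply: bounded2_sum => k; apply: bounded2M => //.
by apply: bounded2D; [|apply: bounded2N]; exact: bounded2M.
Qed.

Lemma bounded2_hpV a b : bounded2 (hpV a b).
Proof.
apply: bounded2_sum => k; apply: bounded2M => //.
by apply: bounded2D; exact: bounded2M.
Qed.

Lemma bounded2_hpU' a b : bounded2 (hpU' a b).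
Proof.
apply: bounded2_sum => k; apply: bounded2M; first exact: bounded2M.
by apply: bounded2D; [|apply: bounded2N]; exact: bounded2M.
Qed.

Lemma bounded2_hpV' a b : bounded2 (hpV' a b).
Proof.
apply: bounded2_sum => k; apply: bounded2M; first exact: bounded2M.
by apply: bounded2D; exact: bounded2M.
Qed.

Lemma bounded2_sev E (u v : R -> R -> R) : swf E -> bounded2 u -> bounded2 v ->
  bounded2 (fun r x => sev E (u r x) (v r x)).
Proof.
move=> w [K1 H1] [K2 H2]; have [K HK] := sev_bounded (Num.max K1 K2) w.
by exists K => r x r2; apply: HK; rewrite le_max ?H1 ?H2 ?orbT.
Qed.

End harmonic_pair.

Section sub_mean_value.
Variables (R : realType).
Implicit Types (r x : R).
Local Notation D := (@Tdom R).
Local Notation mu := (@lebesgue_measure R).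
Local Notation mD := (@measurable_Tdom R).
Local Notation intble f := (mu.-integrable D (EFin \o f)).

Lemma continuous_bounded2_intble (h : R -> R -> R) r : bounded2 h -> `|r| <= 2 ->
  continuous (h r) -> intble (h r).
Proof.
move=> [K HK] r2 ch; apply: (intble_bounded (M := K)).
  by apply: measurable_funTS; exact: continuous_measurable_fun.
by move=> x _; exact: HK.
Qed.

Lemma der_integral (h h' : R -> R -> R) r : bounded2 h -> bounded2 h' ->
  (forall r x, is_derive r 1 (fun r => h r x) (h' r x)) ->
  (forall r, continuous (h r)) -> -1 < r < 2 ->
  is_derive r 1 (fun r => \int[mu]_(x in D) h r x) (\int[mu]_(x in D) h' r x).
Proof.
move=> bh bh' dh ch r12.
have I2 (s : R) : `]-1, 2[%classic s -> `|s| <= 2.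
  by rewrite /= in_itv/= => /andP[s1 s2]; rewrite ler_norml; apply/andP; split; lra.
have Ir : `]-1, 2[%classic r by rewrite /= in_itv.
have ih s : `]-1, 2[%classic s -> intble (h s).
  by move=> /I2 s2; exact: continuous_bounded2_intble.
have dh1 s x : `]-1, 2[%classic s -> D x -> derivable (h ^~ x) s 1.
  by move=> _ _; case: (dh s x).
have [K HK] := bh'.
have d1E s x : partial1of2 h s x = h' s x.
  by rewrite partial1of2E; case: (dh s x).
have G0 (y : R) : 0 <= `|K| by [].
have Gub s x : `]-1, 2[%classic s -> D x -> `|partial1of2 h s x| <= `|K|.
  by move=> /I2 s2 _; rewrite d1E (le_trans (HK s x s2))// ler_norm.
split.
  exact: (derivable_under_integral mD Ir ih dh1 (G := fun=> `|K|) G0 (intble_cst _) Gub).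
rewrite -derive1E.
rewrite (differentiation_under_integral mD Ir ih dh1 (G := fun=> `|K|) G0 (intble_cst _) Gub).
by apply: eq_Rintegral => x _; exact: d1E.
Qed.

Lemma nondecreasing_of_derivative (F F' : R -> R) :
  (forall r, -1 < r < 2 -> is_derive r 1 F (F' r)) ->
  (forall r, 0 < r < 1 -> 0 <= F' r) -> forall r, 0 <= r <= 1 -> F 0 <= F r.
Proof.
move=> dF F0 r /andP[r0 r1].
have cF : {within `[0, 1], continuous F}.
  apply: continuous_in_subspaceT => x; rewrite inE/= in_itv/= => /andP[x0 x1].
  by apply: (der_continuous (dF x _)); apply/andP; split; lra.
have H := @ger0_derive1_le_cc R F 0 1.
apply: H => //; rewrite ?in_itv/= ?lexx ?ler01 ?r0 ?r1//.
- move=> x; rewrite in_itv/= => /andP[x0 x1].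
  have [] // : is_derive x 1 F (F' x) by apply: dF; apply/andP; split; lra.
- move=> x; rewrite in_itv/= => /andP[x0 x1].
  have [_] : is_derive x 1 F (F' x) by apply: dF; apply/andP; split; lra.
  by rewrite derive1E => ->; apply: F0; rewrite x0 x1.
Qed.

Variables (N : nat) (a b : 'I_N -> R) (E : sexpr R).
Hypothesis wE : swf E.
Local Notation dX := (sdiff false).
Local Notation dY := (sdiff true).
Hypothesis lapE : forall x y, 0 <= sev (dX (dX E)) x y + sev (dY (dY E)) x y.

Let ev F r x := sev F (hpU a b r x) (hpV a b r x).
Let a1 := kth a. Let b1 := kth b.
Let a2 := kth a1. Let b2 := kth b1.
Let u1 := hpU a1 b1. Let v1 := hpV a1 b1.
Let u2 := hpU a2 b2. Let v2 := hpV a2 b2.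

Let der_ev_r F r x : swf F -> is_derive r 1 (fun r => ev F r x)
  (ev (dX F) r x * hpU' a b r x + ev (dY F) r x * hpV' a b r x).
Proof. by move=> wF; apply: der_sev => //; [exact: der_hpU_r|exact: der_hpV_r]. Qed.

Let der_ev_x F r x : swf F -> is_derive x 1 (ev F r)
  (ev (dX F) r x * - v1 r x + ev (dY F) r x * u1 r x).
Proof. by move=> wF; apply: der_sev => //; [exact: der_hpU_x|exact: der_hpV_x]. Qed.

Let A r x := ev (dX E) r x * u1 r x + ev (dY E) r x * v1 r x.
Let A' r x := ((ev (dX (dX E)) r x * hpU' a b r x + ev (dY (dX E)) r x * hpV' a b r x) * u1 r x
  + ev (dX E) r x * hpU' a1 b1 r x) +
  ((ev (dX (dY E)) r x * hpU' a b r x + ev (dY (dY E)) r x * hpV' a b r x) * v1 r x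
  + ev (dY E) r x * hpV' a1 b1 r x).
Let B r x := ev (dX E) r x * - v1 r x + ev (dY E) r x * u1 r x.
Let B' r x := ((ev (dX (dX E)) r x * - v1 r x + ev (dY (dX E)) r x * u1 r x) * - v1 r x
  + ev (dX E) r x * - u2 r x) +
  ((ev (dX (dY E)) r x * - v1 r x + ev (dY (dY E)) r x * u1 r x) * u1 r x
  + ev (dY E) r x * - v2 r x).

Let der_A r x : is_derive r 1 (fun r => A r x) (A' r x).
Proof.
by apply: derD; apply: derM; (try by apply: der_ev_r; exact: swf_sdiff);
  [exact: der_hpU_r|exact: der_hpV_r].
Qed.

Let der_B r x : is_derive x 1 (B r) (B' r x).
Proof.
apply: derD; apply: derM; try by apply: der_ev_x; exact: swf_sdiff.
  by apply: derN; exact: der_hpV_x.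
exact: der_hpU_x.
Qed.

Let w1 k : swf (sdiff k E). Proof. exact: swf_sdiff. Qed.
Let w2 k l : swf (sdiff k (sdiff l E)). Proof. by do 2 apply: swf_sdiff. Qed.

Let continuous_ev F r : swf F -> continuous (ev F r).
Proof. by move=> wF x; apply: der_continuous (der_ev_x r x wF). Qed.

Let continuous_hpU c d r : continuous (@hpU R N c d r).
Proof. by move=> x; exact: der_continuous (der_hpU_x c d r x). Qed.

Let continuous_hpV c d r : continuous (@hpV R N c d r).
Proof. by move=> x; exact: der_continuous (der_hpV_x c d r x). Qed.

Let contD (f g : R -> R) : continuous f -> continuous g -> continuous (fun x => f x + g x).
Proof. by move=> cf cg x; apply: cvgD; [exact: cf|exact: cg]. Qed.

Let contM (f g : R -> R) : continuous f -> continuous g -> continuous (fun x => f x * g x).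
Proof. by move=> cf cg x; apply: cvgM; [exact: cf|exact: cg]. Qed.

Let contN (f : R -> R) : continuous f -> continuous (fun x => - f x).
Proof. by move=> cf x; apply: cvgN; exact: cf. Qed.

Let cX r := @continuous_ev _ r (w1 false).
Let cY r := @continuous_ev _ r (w1 true).
Let cXX r := @continuous_ev _ r (w2 false false).
Let cYX r := @continuous_ev _ r (w2 true false).
Let cXY r := @continuous_ev _ r (w2 false true).
Let cYY r := @continuous_ev _ r (w2 true true).
Let cu1 r := @continuous_hpU a1 b1 r.
Let cv1 r := @continuous_hpV a1 b1 r.

Let continuous_B' r : continuous (B' r).
Proof.
exact: (contD
  (contD (contM (contD (contM (@cXX r) (contN (@cv1 r))) (contM (@cYX r) (@cu1 r)))
                (contN (@cv1 r)))
         (contM (@cX r) (contN (@continuous_hpU a2 b2 r))))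
  (contD (contM (contD (contM (@cXY r) (contN (@cv1 r))) (contM (@cYY r) (@cu1 r))) (@cu1 r))
         (contM (@cY r) (contN (@continuous_hpV a2 b2 r))))).
Qed.

Let cos_sin_2pi (k : 'I_N) : cos (k%:R * (pi *+ 2)) = 1 :> R /\ sin (k%:R * (pi *+ 2)) = 0 :> R.
Proof.
have : circ_pt (k%:R * (pi *+ 2) : R) = 1.
  have -> : k%:R = (k : int)%:~R :> R by [].
  by rewrite -circ_exprz -[pi *+ 2]add0r circ2pi circ0 exp1rz.
by move=> H; split; [exact: (congr1 (@complex.Re R) H)|exact: (congr1 (@complex.Im R) H)].
Qed.

Let hpU_2pi c d r : @hpU R N c d r (pi *+ 2) = hpU c d r 0.
Proof.
by apply: eq_bigr => k _; have [-> ->] := cos_sin_2pi k; rewrite !mulr0 cos0 sin0 ?mulr0.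
Qed.

Let hpV_2pi c d r : @hpV R N c d r (pi *+ 2) = hpV c d r 0.
Proof.
by apply: eq_bigr => k _; have [-> ->] := cos_sin_2pi k; rewrite !mulr0 cos0 sin0 ?mulr0.
Qed.

Let int_B' r : \int[mu]_(x in D) B' r x = 0.
Proof.
rewrite (Rintegral_Tdom_derive (der_B r) (@continuous_B' r)).
by rewrite /B /ev /u1 /v1 !hpU_2pi !hpV_2pi subrr.
Qed.

Let b_ev F : swf F -> bounded2 (ev F).
Proof. by move=> wF; apply: bounded2_sev => //; [exact: bounded2_hpU|exact: bounded2_hpV]. Qed.

Let bounded2_A : bounded2 A.
Proof.
by do ![exact: bounded2_hpU | exact: bounded2_hpV | exact: bounded2_hpU'
       | exact: bounded2_hpV' | apply: b_ev; solve [auto]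
       | apply: bounded2D | apply: bounded2M | apply: bounded2N].
Qed.

Let bounded2_A' : bounded2 A'.
Proof.
by do ![exact: bounded2_hpU | exact: bounded2_hpV | exact: bounded2_hpU'
       | exact: bounded2_hpV' | apply: b_ev; solve [auto]
       | apply: bounded2D | apply: bounded2M | apply: bounded2N].
Qed.

Let bounded2_B' : bounded2 B'.
Proof.
by do ![exact: bounded2_hpU | exact: bounded2_hpV | exact: bounded2_hpU'
       | exact: bounded2_hpV' | apply: b_ev; solve [auto]
       | apply: bounded2D | apply: bounded2M | apply: bounded2N].
Qed.

Let G r x := ev E r x.
Let G' r x := ev (dX E) r x * hpU' a b r x + ev (dY E) r x * hpV' a b r x.

Let bounded2_G' : bounded2 G'.
Proof.
by do ![exact: bounded2_hpU | exact: bounded2_hpV | exact: bounded2_hpU'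
       | exact: bounded2_hpV' | apply: b_ev; solve [auto]
       | apply: bounded2D | apply: bounded2M | apply: bounded2N].
Qed.

Let mul_G' r x : r * G' r x = A r x.
Proof. by rewrite /G' mulrDr !(mulrCA r) mul_hpU' mul_hpV'. Qed.

Let mul_A' r x : r * A' r x =
  (ev (dX (dX E)) r x + ev (dY (dY E)) r x) * (u1 r x * u1 r x + v1 r x * v1 r x) - B' r x.
Proof.
have H1 : r * hpU' a b r x = u1 r x := mul_hpU' a b r x.
have H2 : r * hpV' a b r x = v1 r x := mul_hpV' a b r x.
have H3 : r * hpU' a1 b1 r x = u2 r x := mul_hpU' a1 b1 r x.
have H4 : r * hpV' a1 b1 r x = v2 r x := mul_hpV' a1 b1 r x.
rewrite /A' /B' -{}H3 -{}H4 -{}H1 -{}H2 (_ : ev (dX (dY E)) r x = ev (dY (dX E)) r x); last exact: sev_sdiffC.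
ring.
Qed.

Let continuous_A r : continuous (A r).
Proof.
exact: (contD (contM (@cX r) (@cu1 r)) (contM (@cY r) (@cv1 r))).
Qed.

(* Let M(r) be the mean of E(u, v) on the circle of radius r, (u, v) being the
   coordinates of f = u + iv. Then r (r M')' is the mean of |r f'|^2 times the
   Laplacian of E: the angular second derivatives integrate to 0. *)
Lemma sub_mean_value :
  \int[mu]_(x in D) sev E (hpU a b 0 x) (hpV a b 0 x) <=
  \int[mu]_(x in D) sev E (hpU a b 1 x) (hpV a b 1 x).
Proof.
have dL r : -1 < r < 2 ->
    is_derive r 1 (fun r => \int[mu]_(x in D) A r x) (\int[mu]_(x in D) A' r x).
  by apply: der_integral.
have dK r : -1 < r < 2 ->
    is_derive r 1 (fun r => \int[mu]_(x in D) G r x) (\int[mu]_(x in D) G' r x).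
  apply: der_integral => //.
  - exact: b_ev.
  - by move=> s x; exact: der_ev_r.
  - by move=> s; exact: continuous_ev.
have iz (h : R -> R -> R) (z : R) : bounded2 h -> `|z| <= 2 -> measurable_fun D (h z) -> intble (h z).
  by move=> [M HM] z2 mz; apply: (intble_bounded (M := M) mz) => x _; exact: HM.
have r2 (z : R) : 0 < z < 1 -> `|z| <= 2 by move=> /andP[z0 z1]; rewrite ger0_norm; lra.
have iA (z : R) : `|z| <= 2 -> intble (A z).
  by move=> z2; exact: continuous_bounded2_intble.
have iB' (z : R) : `|z| <= 2 -> intble (B' z).
  by move=> z2; exact: continuous_bounded2_intble.
have mA' (z : R) : 0 < z < 1 -> intble (A' z).
  move=> z01; have z0 : z != 0 by case/andP: z01 => /gt_eqF ->.
  apply: iz => //; first exact: r2.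
  rewrite (_ : A' z = (fun x => z^-1 * ((ev (dX (dX E)) z x + ev (dY (dY E)) z x) *
    (u1 z x * u1 z x + v1 z x * v1 z x) - B' z x))); last first.
    by apply/funext => x; rewrite -mul_A' mulKf.
  apply: measurable_funTS; apply: continuous_measurable_fun.
  apply: contM; first by move=> x; exact: cvg_cst.
  apply: contD; last by apply: contN.
  exact: (contM (contD (@cXX z) (@cYY z))
    (contD (contM (@cu1 z) (@cu1 z)) (contM (@cv1 z) (@cv1 z)))).
have mG' (z : R) : 0 < z < 1 -> intble (G' z).
  move=> z01; have z0 : z != 0 by case/andP: z01 => /gt_eqF ->.
  apply: iz => //; first exact: r2.
  rewrite (_ : G' z = (fun x => z^-1 * A z x)); last first.
    by apply/funext => x; rewrite -mul_G' mulKf.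
  apply: measurable_funTS; apply: continuous_measurable_fun.
  by apply: contM => //; move=> x; exact: cvg_cst.
have L0 r : 0 <= r <= 1 -> 0 <= \int[mu]_(x in D) A r x.
  move=> r01; have A0 : \int[mu]_(x in D) A 0 x = 0.
    rewrite (_ : (fun x => _) = (fun=> 0)) ?Rintegral_cst ?mul0r//; first exact: mD.
    by apply/funext => x; rewrite -mul_G' mul0r.
  rewrite -A0; apply: (nondecreasing_of_derivative dL) r01 => z z01.
  have z0 : 0 < z by case/andP: z01.
  rewrite -(pmulr_rge0 _ z0) -(RintegralZl _ mD (mA' z z01)).
  have iS : intble (fun x => z * A' z x + B' z x).
    by apply: (intbleD mD (intbleZ mD z (mA' z z01)) (iB' z (r2 z z01))).
  rewrite -[leRHS]addr0 -(int_B' z) -(RintegralD mD (intbleZ mD z (mA' z z01)) (iB' z (r2 z z01))).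
  rewrite int_B'; apply: Rintegral_ge0 => x _; rewrite mul_A' subrK; apply: mulr_ge0; first exact: lapE.
  by rewrite addr_ge0// -expr2 sqr_ge0.
apply: (nondecreasing_of_derivative dK); last by rewrite ler01 lexx.
move=> z z01; have z0 : 0 < z by case/andP: z01.
rewrite -(pmulr_rge0 _ z0) -(RintegralZl _ mD (mG' z z01)).
have -> : \int[mu]_(x in D) (z * G' z x) = \int[mu]_(x in D) A z x.
  by apply: eq_Rintegral => x _; exact: mul_G'.
by apply: L0; case/andP: z01 => [/ltW -> /ltW ->].
Qed.

End sub_mean_value.

Section riesz_functions.
Variable R : realType.
Implicit Types (p x y d : R).
Local Notation dX := (sdiff false).
Local Notation dY := (sdiff true).

Definition sqX d : sexpr R := SAdd (SMul (SX R) (SX R)) (SCst d).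
Definition sqXY d : sexpr R :=
  SAdd (SAdd (SMul (SX R) (SX R)) (SMul (SY R) (SY R))) (SCst d).

(* At d = 0, with z = x + iy, these are 2/(p-1) |x|^p - |z|^p, subharmonic for
   1 < p <= 2, and (p^2/2 x^2 - |z|^2) |z|^(p-2), subharmonic for p >= 2; d > 0
   smoothes them at the origin. *)
Definition riesz_low p d : sexpr R :=
  SAdd (SMul (SCst (2 / (p - 1))) (SPow (sqX d) (p / 2)))
       (SMul (SCst (-1)) (SPow (sqXY d) (p / 2))).
Definition riesz_high p d : sexpr R :=
  SMul (SAdd (SMul (SCst (p ^+ 2 / 2)) (sqX d)) (SMul (SCst (-1)) (sqXY d)))
       (SPow (sqXY d) (p / 2 - 1)).

Let sqX_ge d x y : d <= sev (sqX d) x y.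
Proof. by rewrite /= lerDr -expr2 sqr_ge0. Qed.

Let sqXY_ge d x y : d <= sev (sqXY d) x y.
Proof. by rewrite /= lerDr -!expr2 addr_ge0 ?sqr_ge0. Qed.

Lemma swf_riesz_low p d : 0 < d -> swf (riesz_low p d).
Proof.
by move=> d0 /=; do ![split] => //; exists d => // x y; [exact: sqX_ge|exact: sqXY_ge].
Qed.

Lemma swf_riesz_high p d : 0 < d -> swf (riesz_high p d).
Proof. by move=> d0 /=; do ![split] => //; exists d => // x y; exact: sqXY_ge. Qed.

Let powR_pred (S s : R) : 0 < S -> S `^ s = S * S `^ (s - 1).
Proof.
move=> S0; rewrite -{2}[S]powRr1 ?(ltW S0)// -powRD; last by rewrite (gt_eqF S0) implybT.
by congr (_ `^ _); ring.
Qed.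

Lemma riesz_low_subharmonic p d x y : 1 < p -> p <= 2 -> 0 < d ->
  0 <= sev (dX (dX (riesz_low p d))) x y + sev (dY (dY (riesz_low p d))) x y.
Proof.
move=> p1 p2 d0 /=.
set s := x * x + d; set S := x * x + y * y + d.
have s0 : 0 < s by rewrite /s ltr_wpDl// -expr2 sqr_ge0.
have S0 : 0 < S by rewrite /S ltr_wpDl// addr_ge0// -expr2 sqr_ge0.
rewrite (powR_pred (p / 2 - 1) s0) (powR_pred (p / 2 - 1) S0).
have s1E := powR_pred (p / 2 - 1) s0; have S1E := powR_pred (p / 2 - 1) S0.
have s2 : 0 < s `^ (p / 2 - 1 - 1) by rewrite powR_gt0.
have S2 : 0 < S `^ (p / 2 - 1 - 1) by rewrite powR_gt0.
have sS : S * S `^ (p / 2 - 1 - 1) <= s * s `^ (p / 2 - 1 - 1).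
  rewrite -s1E -S1E -[p / 2 - 1]opprB !(powRN _ (1 - p / 2)) lef_pV2 ?posrE ?powR_gt0//.
  rewrite ge0_ler_powR ?nnegrE ?(ltW s0) ?(ltW S0)//; first lra.
  by rewrite /s /S lerD2r lerDl -expr2 sqr_ge0.
set s' := s `^ (p / 2 - 1 - 1) in s1E s2 sS *; set S' := S `^ (p / 2 - 1 - 1) in S1E S2 sS *.
set K := 2 / (p - 1); have KE : K * (p - 1) = 2 by rewrite /K divfK// subr_eq0 gt_eqF.
have K0 : 0 < K by rewrite divr_gt0// subr_gt0.
have xx : 0 <= x * x by rewrite -expr2 sqr_ge0.
have yy : 0 <= y * y by rewrite -expr2 sqr_ge0.
rewrite [leRHS](_ : _ = p / 2 * ((K * s' * (2 * (p - 2) * (x * x) + 2 * s))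
   - S' * (2 * (p - 2) * (x * x + y * y) + 4 * S))); last first.
  by rewrite -/s' -/S' /s /S; field.
apply: mulr_ge0; first lra.
have p20 : 0 <= 2 - p by rewrite subr_ge0.
rewrite subr_ge0.
have H1 : S' * (2 * (p - 2) * (x * x + y * y) + 4 * S) <= 4 * (S * S').
  have : 0 <= S' * ((2 - p) * (x * x + y * y)).
    by rewrite mulr_ge0 ?(ltW S2)// mulr_ge0// addr_ge0.
  by move=> H; rewrite [leRHS](_ : _ = S' * (4 * S)); [rewrite ler_pM2l//; nra|ring].
have H2 : 4 * (s * s') <= K * s' * (2 * (p - 2) * (x * x) + 2 * s).
  have : 0 <= K * s' * (2 * (2 - p) * (s - x * x)).
    have sx : 0 <= s - x * x by rewrite /s addrAC subrr add0r ltW.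
    apply: mulr_ge0; first by apply: mulr_ge0; exact: ltW.
    by apply: mulr_ge0 => //; apply: mulr_ge0.
  have -> : K * s' * (2 * (2 - p) * (s - x * x)) =
    K * s' * (2 * (p - 2) * (x * x) + 2 * s) - 2 * (K * (p - 1)) * (s * s') by ring.
  by rewrite KE subr_ge0; apply: le_trans; rewrite le_eqVlt; apply/orP; left; apply/eqP; ring.
apply: le_trans H1 (le_trans _ H2).
by rewrite ler_pM2l.
Qed.

Lemma riesz_high_subharmonic p d x y : 2 <= p -> 0 < d ->
  0 <= sev (dX (dX (riesz_high p d))) x y + sev (dY (dY (riesz_high p d))) x y.
Proof.
move=> p2 d0 /=.
set S := x * x + y * y + d; set g := p / 2 - 1.
have S0 : 0 < S by rewrite /S ltr_wpDl// addr_ge0// -expr2 sqr_ge0.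
have g0 : 0 <= g by rewrite /g; lra.
have pE : p = 2 * (g + 1) by rewrite /g; field.
rewrite (powR_pred g S0) (powR_pred (g - 1) S0).
have S2 : 0 < S `^ (g - 1 - 1) by rewrite powR_gt0.
set S' := S `^ (g - 1 - 1) in S2 *.
have xx : 0 <= x * x by rewrite -expr2 sqr_ge0.
have yy : 0 <= y * y by rewrite -expr2 sqr_ge0.
set r := x * x + y * y.
have r0 : 0 <= r by rewrite addr_ge0.
have Sr : S = r + d by [].
rewrite [leRHS](_ : _ = S' * (16 * g * (g + 1) ^+ 2 * (x * x) * S +
  8 * g * (g + 1) ^+ 2 * (x * x + d) * (g * r + d) + 4 * g * (g + 1) * (S * d))).
  apply: mulr_ge0; first exact: ltW.
  have dge0 := ltW d0; have Sge0 := ltW S0.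
  by do ![done | apply: mulr_ge0 | apply: exprn_ge0 | apply: addr_ge0].
by rewrite pE Sr /r; field.
Qed.


Let sq_ge0 x : 0 <= x * x. Proof. by rewrite -expr2 sqr_ge0. Qed.

Lemma riesz_function p : 1 < p -> exists2 K, 0 <= K & forall d, 0 < d ->
  exists E : sexpr R, [/\ swf E,
    forall x y, 0 <= sev (dX (dX E)) x y + sev (dY (dY E)) x y,
    forall x, (x * x + d) `^ (p / 2) <= sev E x 0 &
    forall x y, sev E x y <= K * (x * x + d) `^ (p / 2)
       - (x * x + y * y + d) `^ (p / 2) / 2].
Proof.
move=> p1; have [p2|/ltW p2] := leP p 2.
  have p10 : 0 < p - 1 by rewrite subr_gt0.
  exists (2 / (p - 1)); first by rewrite divr_ge0// ltW.
  move=> d d0; exists (riesz_low p d); split.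
  - exact: swf_riesz_low.
  - by move=> x y; exact: riesz_low_subharmonic.
  - move=> x /=; rewrite mulr0 addr0; set P := _ `^ _.
    have P0 : 0 <= P by exact: powR_ge0.
    have K2 : 2 <= 2 / (p - 1) by rewrite ler_pdivlMr//; lra.
    have := ler_wpM2r P0 K2; lra.
  - move=> x y /=; set P := (_ + d) `^ _; have := powR_ge0 (x * x + y * y + d) (p / 2).
    by rewrite -/P; lra.
have p0 : 0 < p by rewrite (lt_trans ltr01).
set B := p ^+ 2 / 2; have B2 : 2 <= B.
  by rewrite /B ler_pdivlMr// -natrM -[(2 * 2)%:R]/((2 ^ 2)%:R) natrX lerXn2r ?nnegrE// ltW.
set g := p / 2 - 1; have g0 : 0 <= g by rewrite /g; lra.
have B0 : 0 <= B by lra.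
exists (B * (2 * B) `^ g); first by rewrite mulr_ge0 ?powR_ge0.
move=> d d0; exists (riesz_high p d).
have gE (S : R) : 0 < S -> S `^ (p / 2) = S * S `^ g by move=> S0; exact: powR_pred.
have sq0 x : 0 < x * x + d by rewrite ltr_wpDl.
have S0 x y : 0 < x * x + y * y + d by rewrite ltr_wpDl// addr_ge0.
split.
- exact: swf_riesz_high.
- by move=> x y; exact: riesz_high_subharmonic.
- move=> x /=; rewrite -/B -/g mulr0 addr0 gE//.
  rewrite ler_wpM2r ?powR_ge0//.
  have : 2 * (x * x + d) <= B * (x * x + d) by rewrite ler_wpM2r// ltW.
  by lra.
- move=> x y /=; rewrite -/B -/g [(x * x + y * y + d) `^ (p / 2)]gE//.
  set s := x * x + d; set S := x * x + y * y + d.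
  have [BS|BS] := leP (B * s) (S / 2).
    have H : (B * s + -1 * S) * S `^ g <= - (S / 2) * S `^ g.
      by rewrite ler_wpM2r ?powR_ge0//; lra.
    apply: le_trans H _.
    have H0 : 0 <= B * (2 * B) `^ g * s `^ (p / 2).
      by apply: mulr_ge0; [apply: mulr_ge0 => //; exact: powR_ge0|exact: powR_ge0].
    by rewrite mulNr mulrAC lerDr.
  have Sg : S `^ g <= (2 * B) `^ g * s `^ g.
    have B20 : 0 <= 2 * B by apply: mulr_ge0.
    have s0 : 0 <= s by exact: ltW (sq0 x).
    rewrite -powRM//.
    have SB : S <= 2 * B * s by rewrite -mulrA [2 * _]mulrC -ler_pdivrMr// ltW.
    apply: ge0_ler_powR => //; rewrite nnegrE; first exact: ltW (S0 x y).
    exact: mulr_ge0.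
  rewrite [s `^ (p / 2)](gE _ (sq0 x)).
  have H1 : B * s * S `^ g <= B * s * ((2 * B) `^ g * s `^ g).
    by apply: ler_wpM2l => //; apply: mulr_ge0 => //; exact: ltW (sq0 x).
  have H2 : 0 <= S * S `^ g.
    by apply: mulr_ge0; [exact: ltW (S0 x y)|exact: powR_ge0].
  rewrite [X in _ <= X - _]mulrACA.
  rewrite mulrDl mulN1r mulNr lerD// lerN2 ler_pdivrMr//.
  by rewrite mulr_natr mulr2n lerDl.
Qed.


Local Notation D := (@Tdom R).
Local Notation mu := (@lebesgue_measure R).
Local Notation mD := (@measurable_Tdom R).
Local Notation intble f := (mu.-integrable D (EFin \o f)).

Let powR_half (z p : R) : (z * z) `^ (p / 2) = `|z| `^ p.
Proof.
rewrite -expr2 -(real_normK (num_real z)) -powR_mulrn// -powRrM.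
by congr (_ `^ _); field.
Qed.

Lemma riesz_conjugate p : 1 < p -> exists2 K, 0 <= K &
  forall N (a b : 'I_N -> R), (forall k : 'I_N, nat_of_ord k = 0%N -> b k = 0) ->
  \int[mu]_(x in D) (`|hpU a b 0 x| `^ p) + (\int[mu]_(x in D) (`|hpV a b 1 x| `^ p)) / 2
    <= K * \int[mu]_(x in D) (`|hpU a b 1 x| `^ p).
Proof.
move=> p1; have [K K0 HK] := riesz_function p1.
have p0 : 0 < p by rewrite (lt_trans ltr01).
have p20 : 0 < p / 2 by rewrite divr_gt0.
exists (K * 2 `^ (p / 2)); first by apply: mulr_ge0 => //; exact: powR_ge0.
move=> N a b b0.
have V0 x : hpV a b 0 x = 0.
  rewrite /hpV big1// => k _; case: (eqVneq (k : nat) 0%N) => [k0|k0].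
    by rewrite b0// k0 !mul0r sin0 mulr0 addr0 mulr0.
  by rewrite expr0n (negbTE k0) mul0r.
have cU r : continuous (hpU a b r) by move=> x; exact: der_continuous (der_hpU_x a b r x).
have cV r : continuous (hpV a b r) by move=> x; exact: der_continuous (der_hpV_x a b r x).
have n2 (r : R) : 0 <= r <= 1 -> `|r| <= 2.
  by move=> /andP[r0 r1]; rewrite ger0_norm//; lra.
have iP (h : R -> R -> R) r : bounded2 h -> `|r| <= 2 -> continuous (h r) ->
    intble (fun x => `|h r x| `^ p).
  move=> [M HM] r2 ch; apply: (intble_bounded (M := M `^ p)).
    by apply: measurable_norm_powR; apply: measurable_funTS; exact: continuous_measurable_fun.
  move=> x _; rewrite ger0_norm ?powR_ge0//.
  by apply: ge0_ler_powR; rewrite ?nnegrE ?(ltW p0)//; [exact: le_trans (HM r x r2)|exact: HM].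
have i0 := iP _ 0 (bounded2_hpU a b) (n2 0 _) (cU 0).
have iU := iP _ 1 (bounded2_hpU a b) (n2 1 _) (cU 1).
have iV := iP _ 1 (bounded2_hpV a b) (n2 1 _) (cV 1).
rewrite !lexx !ler01 in i0 iU iV.
have {}i0 := i0 isT; have {}iU := iU isT; have {}iV := iV isT.
set I0 := Rintegral _ _ _; set IV := Rintegral _ _ _; set IU := Rintegral _ _ _.
have [L HL] : exists L : R, forall dl, 0 < dl ->
    I0 + IV / 2 <= K * 2 `^ (p / 2) * (IU + L * dl).
  exists (\int[mu]_(x in D) 1) => dl dl0.
  set d := dl `^ (p / 2)^-1; have d0 : 0 < d by rewrite powR_gt0.
  have ddl : d `^ (p / 2) = dl by rewrite -powRrM mulVf ?gt_eqF// powRr1// ltW.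
  have [E [wE lapE E1 E2]] := HK d d0.
  have iE r : 0 <= r <= 1 -> intble (fun x => sev E (hpU a b r x) (hpV a b r x)).
    move=> r01; apply: (@continuous_bounded2_intble _
      (fun r x => sev E (hpU a b r x) (hpV a b r x)) r).
    - by apply: bounded2_sev => //; [exact: bounded2_hpU|exact: bounded2_hpV].
    - exact: n2.
    - by move=> x; exact: der_continuous (der_sev wE (der_hpU_x a b r x) (der_hpV_x a b r x)).
  have S1 : I0 <= \int[mu]_(x in D) sev E (hpU a b 0 x) (hpV a b 0 x).
    apply: le_Rintegral_ae => //; [exact: mD|apply: iE; by rewrite lexx ler01|].
    apply: aeW => x _; rewrite V0; apply: le_trans (E1 _).
    rewrite -powR_half; apply: ge0_ler_powR; rewrite ?nnegrE ?(ltW p20)//.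
      by apply: addr_ge0 => //; exact: ltW.
    by rewrite lerDl ltW.
  have S2 := sub_mean_value a b wE lapE.
  have S3 : \int[mu]_(x in D) sev E (hpU a b 1 x) (hpV a b 1 x) <=
    K * 2 `^ (p / 2) * (IU + (\int[mu]_(x in D) 1) * dl) - IV / 2.
    have i1 := intbleD mD iU (intbleZ mD dl (intble_cst 1)).
    have -> : K * 2 `^ (p / 2) * (IU + (\int[mu]_(x in D) 1) * dl) - IV / 2 =
      \int[mu]_(x in D) (K * 2 `^ (p / 2) * (`|hpU a b 1 x| `^ p + dl * 1) -
        2^-1 * `|hpV a b 1 x| `^ p).
      rewrite (RintegralB mD (intbleZ mD (K * 2 `^ (p / 2)) i1) (intbleZ mD (2^-1) iV)).
      rewrite (RintegralZl _ mD i1) (RintegralZl _ mD iV) (RintegralD mD iU (intbleZ mD dl (intble_cst 1))).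
      by rewrite (RintegralZl _ mD (intble_cst 1)) [IV / 2]mulrC [Rintegral _ _ _ * dl]mulrC.
    apply: (le_Rintegral_ae mD); first by apply: iE; rewrite lexx ler01.
      exact: (intbleB mD (intbleZ mD (K * 2 `^ (p / 2)) i1) (intbleZ mD (2^-1) iV)).
    apply: aeW => x _; apply: le_trans (E2 _ _) _.
    set u := hpU a b 1 x; set v := hpV a b 1 x.
    have H1 : (u * u + d) `^ (p / 2) <= 2 `^ (p / 2) * (`|u| `^ p + dl * 1).
      have := norm_powRD (u * u) d p20.
      have dge0 := ltW d0.
      rewrite (ger0_norm (sq_ge0 u)) (ger0_norm dge0) (ger0_norm (addr_ge0 (sq_ge0 u) dge0)).
      by rewrite powR_half ddl mulr1.
    have H2 : `|v| `^ p <= (u * u + v * v + d) `^ (p / 2).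
      rewrite -powR_half; apply: ge0_ler_powR; rewrite ?nnegrE ?(ltW p20)//.
        by apply: addr_ge0 (ltW d0); exact: addr_ge0.
      by rewrite addrAC lerDr; apply: addr_ge0 => //; exact: ltW.
    rewrite -mulrA lerB ?ler_wpM2l//.
    by rewrite mulrC ler_wpM2r.
  have := le_trans S1 (le_trans S2 S3).
  by rewrite lerBrDr.
apply/ler_addgt0Pr => eps e0.
set c := K * 2 `^ (p / 2) * `|L|.
have c0 : 0 <= c by apply: mulr_ge0 => //; apply: mulr_ge0 => //; exact: powR_ge0.
have c1 : 0 < c + 1 by rewrite ltr_wpDl.
have dl0 : 0 < eps / (c + 1) by rewrite divr_gt0.
apply: le_trans (HL _ dl0) _; rewrite mulrDr lerD2l.
apply: (@le_trans _ _ (c * (eps / (c + 1)))).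
  rewrite /c [leLHS]mulrA; apply: ler_wpM2r; first exact: ltW.
  apply: ler_wpM2l; last exact: ler_norm.
  by apply: mulr_ge0 => //; exact: powR_ge0.
by rewrite mulrCA ger_pMr// ler_pdivrMr// mul1r lerDl.
Qed.

End riesz_functions.

Section riesz_projection.
Variable R : realType.
Local Notation C := R[i].
Local Notation mu := (@lebesgue_measure R).
Local Notation D := (@Tdom R).
Local Notation Re := complex.Re.
Local Notation Im := complex.Im.
Local Notation e := (@circ_pt R).
Local Notation intble f := (mu.-integrable D (EFin \o f)).
Local Notation mD := (@measurable_Tdom R).
Implicit Types (f g : C -> C) (P Q : {poly C}).

Lemma Linf_L1 f : Linf f -> L1 f.
Proof.
move=> lf; have h : 2^-1 + 2^-1 = 1 :> R by field.
by apply: (LP_L1 _ h); [rewrite ltr1n|exact: Linf_LP].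
Qed.

Lemma cint_horner_exprz P (n : int) : 0 < n -> cint (fun t => P.[t] * t ^ n) = 0.
Proof.
elim/poly_ind: P n => [|P c IH] n n0.
  rewrite (eq_cint (g := fun t => 0 * t ^ n)) => [|x]; last by rewrite horner0.
  by rewrite cintZ ?mul0r//; apply: Linf_L1; exact: Linf_exprz.
have L1P k Q : L1 (fun t : C => Q.[t] * t ^ k).
  by apply: Linf_L1; apply: LinfM; [exact: Linf_horner|exact: Linf_exprz].
have L1X k : L1 (fun t : C => t ^ k) by apply: Linf_L1; exact: Linf_exprz.
rewrite (eq_cint (g := fun t => P.[t] * t ^ (n + 1) + c * t ^ n)) => [|x]; last first.
  by rewrite hornerMXaddC mulrDl -mulrA (addrC n) expfzDr ?circ_neq0// expr1z.
rewrite cintD//; last exact: L1Z.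
by rewrite cintZ// cint_exprz ?gt_eqF// mulr0 addr0 IH// ltr_wpDr.
Qed.


Lemma cint_hornerV_exprz Q (n : int) : n < 0 -> cint (fun t => Q.[t^-1] * t ^ n) = 0.
Proof.
move=> n0; rewrite -(@cint_horner_exprz Q (- n)) ?oppr_gt0//.
rewrite -[RHS]cint_refl; last by apply: cmeasurableM; [exact: cmeasurable_horner|exact: cmeasurable_exprz].
by apply: eq_cint => x; rewrite exprz_inv opprK.
Qed.

Lemma cint_trigpoly_exprz P Q (n : int) : n <= 0 ->
  cint (fun t => trigpoly P Q t * t ^ n) = cint (fun t => P.[t] * t ^ n).
Proof.
move=> n0.
have i1 : L1 (fun t : C => P.[t] * t ^ n).
  by apply: Linf_L1; apply: LinfM; [exact: Linf_horner|exact: Linf_exprz].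
have i2 : L1 (fun t : C => Q.[t^-1] * t ^ (n - 1)).
  by apply: Linf_L1; apply: LinfM; [exact: Linf_hornerV|exact: Linf_exprz].
rewrite -[RHS]addr0 -(@cint_hornerV_exprz Q (n - 1)); last by rewrite ltrBlDr ltr_pwDr.
rewrite -cintD//; apply: eq_cint => x; rewrite mulrDl; congr (_ + _).
by rewrite expfzDr ?circ_neq0// -[e x ^ (-1)]/((e x)^-1) mulrAC mulrC [(e x)^-1 * _]mulrC.
Qed.

Section coefficients.
Variables (N : nat) (c m : 'I_N -> C).
Hypothesis mz : forall k : 'I_N, nat_of_ord k = 0%N -> m k = 0.

Let nz (k : 'I_N) (x : R) := if nat_of_ord k == 0%N then 0 else x.
(* F is the analytic part of F + G. The analytic functions F1, F2 with coefficients
   a1 + i b1, a2 + i b2 satisfy Re F1 = Re (F + G), Re F2 = Im (F + G) and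
   2 F = F1 + i F2 + F1(0) + i F2(0); b1 and b2 vanish at 0 to normalize the
   harmonic conjugates. *)
Let a1 k := Re (c k) + Re (m k).
Let b1 k := nz k (Im (c k) - Im (m k)).
Let a2 k := Im (c k) + Im (m k).
Let b2 k := nz k (Re (m k) - Re (c k)).

Let F x := \sum_(k < N) c k * e x ^+ k.
Let G x := \sum_(k < N) m k * (e x)^-1 ^+ k.

Let ReX x k : Re (e x ^+ k) = cos (k%:R * x).
Proof. by rewrite circX mulr_natl. Qed.
Let ImX x k : Im (e x ^+ k) = sin (k%:R * x).
Proof. by rewrite circX mulr_natl. Qed.
Let ReVX x k : Re ((e x)^-1 ^+ k) = cos (k%:R * x).
Proof. by rewrite -circN circX mulNrn /= cosN mulr_natl. Qed.
Let ImVX x k : Im ((e x)^-1 ^+ k) = - sin (k%:R * x).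
Proof. by rewrite -circN circX mulNrn /= sinN mulr_natl. Qed.

Let Re_sum n (h : 'I_n -> C) : Re (\sum_k h k) = \sum_k Re (h k).
Proof. by apply: (big_ind2 (fun z x => Re z = x)) => // z1 x1 z2 x2 <- <-; rewrite ReD. Qed.
Let Im_sum n (h : 'I_n -> C) : Im (\sum_k h k) = \sum_k Im (h k).
Proof. by apply: (big_ind2 (fun z x => Im z = x)) => // z1 x1 z2 x2 <- <-; rewrite ImD. Qed.

Let ReFG x : Re (F x + G x) = hpU a1 b1 1 x.
Proof.
rewrite -big_split Re_sum; apply: eq_bigr => k _.
rewrite expr1n mul1r !ReImE ReX ImX ReVX ImVX /a1 /b1 /nz.
by case: eqP => [->|_]; rewrite ?mul0r ?sin0; ring.
Qed.

Let ImFG x : Im (F x + G x) = hpU a2 b2 1 x.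
Proof.
rewrite -big_split Im_sum; apply: eq_bigr => k _.
rewrite expr1n mul1r !ReImE ReX ImX ReVX ImVX /a2 /b2 /nz.
by case: eqP => [->|_]; rewrite ?mul0r ?sin0; ring.
Qed.

Let ReF x : Re (F x) = 2^-1 * (hpU a1 b1 1 x + (hpU a1 b1 0 x - hpV a2 b2 1 x)).
Proof.
rewrite Re_sum -sumrB -big_split mulr_sumr; apply: eq_bigr => k _ /=.
rewrite expr1n !mul1r expr0n !ReImE ReX ImX /a1 /b1 /a2 /b2 /nz.
case: eqP => [k0|_]; last by rewrite mulr0n mul0r; field.
by rewrite mz// k0 !mul0r sin0 cos0 /=; field.
Qed.

Let ImF x : Im (F x) = 2^-1 * (hpV a1 b1 1 x + (hpU a2 b2 1 x + hpU a2 b2 0 x)).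
Proof.
rewrite Im_sum -!big_split mulr_sumr; apply: eq_bigr => k _ /=.
rewrite expr1n !mul1r expr0n !ReImE ReX ImX /a1 /b1 /a2 /b2 /nz.
case: eqP => [k0|_]; last by rewrite mulr0n mul0r; field.
by rewrite mz// k0 !mul0r sin0 cos0 /=; field.
Qed.

Let i_hp p (h : R -> R -> R) (r : R) : 1 < p -> bounded2 h -> 0 <= r <= 1 -> continuous (h r) ->
  intble (fun x => `|h r x| `^ p).
Proof.
move=> p1 [M HM] /andP[r0 r1] ch; apply: (intble_bounded (M := M `^ p)).
  by apply: measurable_norm_powR; apply: measurable_funTS; exact: continuous_measurable_fun.
have p0 : 0 <= p by rewrite (le_trans ler01)// ltW.
have HMr x : `|h r x| <= M by apply: HM; rewrite ger0_norm// (le_trans r1)// ler1n.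
move=> x _; rewrite ger0_norm ?powR_ge0//.
by apply: ge0_ler_powR; rewrite ?nnegrE//; exact: le_trans (HMr x).
Qed.

Let norm_powR3 p (x y z : R) : 1 < p ->
  `|2^-1 * (x + (y + z))| `^ p <= 2 `^ p * 2 `^ p * (`|x| `^ p + (`|y| `^ p + `|z| `^ p)).
Proof.
move=> p1; have p0 : 0 < p by rewrite (lt_trans ltr01).
set B := 2 `^ p; have B1 : 1 <= B by rewrite -(powRr0 2) ler_powR ?ler1n ?ltW.
have B0 : 0 <= B by exact: le_trans B1.
have H : `|2^-1 * (x + (y + z))| <= `|x + (y + z)|.
  by rewrite normrM ler_piMl// ger0_norm// invf_le1// ler1n.
apply: le_trans (ler_norm_powR (ltW p0) H) (le_trans (norm_powRD _ _ p0) _).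
rewrite -mulrA ler_wpM2l// mulrDr lerD//; first by rewrite ler_peMl ?powR_ge0.
exact: norm_powRD.
Qed.

Let sum_conjugates (K u1 w1 v1 u2 w2 v2 : R) : w1 + v1 / 2 <= K * u1 -> w2 + v2 / 2 <= K * u2 ->
  0 <= w1 -> 0 <= w2 -> u1 + (w1 + v2) + (v1 + (u2 + w2)) <= (1 + 2 * K) * (u1 + u2).
Proof. by lra. Qed.

Lemma NP_harmonic_coefs p (K : R) : 1 < p -> 0 <= K ->
  (forall N (a b : 'I_N -> R), (forall k : 'I_N, nat_of_ord k = 0%N -> b k = 0) ->
  \int[mu]_(x in D) (`|hpU a b 0 x| `^ p) + (\int[mu]_(x in D) (`|hpV a b 1 x| `^ p)) / 2
    <= K * \int[mu]_(x in D) (`|hpU a b 1 x| `^ p)) ->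
  forall f g, cmeasurable f -> (forall x, f (e x) = F x) -> (forall x, g (e x) = F x + G x) ->
  NP p f <= 2 `^ p * 2 `^ p * (1 + 2 * K) * NP p g.
Proof.
move=> p1 K0 HK f g mf fF gFG.
have nz0 (h : 'I_N -> R) (k : 'I_N) : nat_of_ord k = 0%N -> nz k (h k) = 0 by rewrite /nz => ->.
have H1 := HK N a1 b1 (fun k => @nz0 (fun k => Im (c k) - Im (m k)) k).
have H2 := HK N a2 b2 (fun k => @nz0 (fun k => Re (m k) - Re (c k)) k).
have cU a b r : continuous (@hpU R N a b r).
  by move=> x; exact: der_continuous (der_hpU_x a b r x).
have cV a b r : continuous (@hpV R N a b r).
  by move=> x; exact: der_continuous (der_hpV_x a b r x).
have r0 : 0 <= (0 : R) <= 1 by rewrite lexx ler01.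
have r1 : 0 <= (1 : R) <= 1 by rewrite lexx ler01.
have iU (a b : 'I_N -> R) (r : R) : 0 <= r <= 1 -> intble (fun x => `|hpU a b r x| `^ p).
  by move=> r01; exact: (i_hp p1 (bounded2_hpU a b) r01 (cU a b r)).
have iV (a b : 'I_N -> R) : intble (fun x => `|hpV a b 1 x| `^ p).
  exact: (i_hp p1 (bounded2_hpV a b) r1 (cV a b 1)).
have gE : NP p g = \int[mu]_(x in D) (`|hpU a1 b1 1 x| `^ p) +
                   \int[mu]_(x in D) (`|hpU a2 b2 1 x| `^ p).
  rewrite -(RintegralD mD (iU _ _ _ r1) (iU _ _ _ r1)).
  by apply: eq_Rintegral => x _; rewrite gFG /modp ReFG ImFG.
pose h x := 2 `^ p * 2 `^ p * (
  (`|hpU a1 b1 1 x| `^ p + (`|hpU a1 b1 0 x| `^ p + `|hpV a2 b2 1 x| `^ p)) +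
  (`|hpV a1 b1 1 x| `^ p + (`|hpU a2 b2 1 x| `^ p + `|hpU a2 b2 0 x| `^ p))).
have j1 := intbleD mD (iU a1 b1 0 r0) (iV a2 b2).
have j2 := intbleD mD (iU a2 b2 1 r1) (iU a2 b2 0 r0).
have j3 := intbleD mD (iU a1 b1 1 r1) j1.
have j4 := intbleD mD (iV a1 b1) j2.
have j5 := intbleD mD j3 j4.
have ih : intble h by exact: (intbleZ mD (2 `^ p * 2 `^ p) j5).
have fh : {ae mu, forall x, D x -> modp p (f (e x)) <= h x}.
  apply: aeW => x _; rewrite fF /modp ReF ImF /h [leRHS]mulrDr.
  rewrite -[`|hpV a2 b2 1 x|]normrN.
  by apply: lerD; exact: norm_powR3.
have [_ fle] := LP_dominated mf ih fh.
apply: le_trans fle _.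
rewrite (RintegralZl _ mD j5) (RintegralD mD j3 j4) (RintegralD mD (iU a1 b1 1 r1) j1).
rewrite (RintegralD mD (iV a1 b1) j2) (RintegralD mD (iU a1 b1 0 r0) (iV a2 b2)).
rewrite (RintegralD mD (iU a2 b2 1 r1) (iU a2 b2 0 r0)) gE -!mulrA.
do 2 (apply: ler_wpM2l; first exact: powR_ge0).
by apply: (sum_conjugates H1 H2); apply: Rintegral_ge0 => x _; exact: powR_ge0.
Qed.

End coefficients.

Lemma NP_riesz_trigpoly p : 1 < p -> exists2 K, 0 <= K & forall P Q,
  NP p (fun t => P.[t]) <= K * NP p (trigpoly P Q).
Proof.
move=> p1; have [K K0 HK] := riesz_conjugate p1.
exists (2 `^ p * 2 `^ p * (1 + 2 * K)).
  by rewrite !mulr_ge0 ?powR_ge0// addr_ge0// mulr_ge0.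
move=> P Q; set n := maxn (size P) (size Q).
pose c (k : 'I_n.+1) := P`_k; pose m (k : 'I_n.+1) := if nat_of_ord k is j.+1 then Q`_j else 0.
have cE x : P.[e x] = \sum_(k < n.+1) c k * e x ^+ k.
  by rewrite (@horner_coef_wide _ n.+1)// leqW// leq_maxl.
apply: (@NP_harmonic_coefs n.+1 c m) => //.
- by move=> k; rewrite /m => ->.
- exact: cmeasurable_horner.
move=> x; rewrite /trigpoly cE; congr (_ + _).
rewrite big_ord_recl /m /= mul0r add0r (@horner_coef_wide _ n Q) ?leq_maxr//.
rewrite mulr_sumr; apply: eq_bigr => k _.
by rewrite exprS mulrCA.
Qed.

Variables (p q : R).
Hypotheses (p1 : 1 < p) (pq : p^-1 + q^-1 = 1).

Let p0 : 0 < p. Proof. by rewrite (lt_trans ltr01). Qed.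
Let q0 : 0 < q. Proof. by rewrite (lt_trans ltr01)// (conj_gt1 p1 pq). Qed.

Let LPexprz (n : int) : LP q (fun t : C => t ^ n).
Proof. by apply: Linf_LP => //; exact: Linf_exprz. Qed.

Let mul_div_succ_le (c eps : R) : 0 < c + 1 -> 0 < eps -> c * (eps / (c + 1)) <= eps.
Proof. by move=> c1 e0; rewrite mulrCA ger_pMr// ler_pdivrMr// mul1r lerDl. Qed.

Let mul_div_succ_lt (c eps : R) : 0 < c + 1 -> 0 < eps -> c * (eps / (c + 1)) < eps.
Proof. by move=> c1 e0; rewrite mulrCA gtr_pMr// ltr_pdivrMr// mul1r ltrDl. Qed.

Lemma riesz_projection : exists2 K, 0 <= K & forall f, LP p f -> exists g,
  [/\ LP p g, NP p g <= K * NP p f,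
      forall n : int, n <= 0 -> cint (fun t => g t * t ^ n) = cint (fun t => f t * t ^ n),
      forall n : int, 0 < n -> cint (fun t => g t * t ^ n) = 0 &
      forall d, 0 < d -> exists P, NP p (fun t => g t - P.[t]) <= d].
Proof.
have [K K0 HK] := NP_riesz_trigpoly p1.
set B := 2 `^ p; have B1 : 1 <= B by rewrite -(powRr0 2) ler_powR ?ler1n ?ltW.
have B0 : 0 <= B by exact: le_trans B1.
exists (B * (K * B)); first by rewrite !mulr_ge0.
move=> f lf.
have approx (n : nat) : exists PQ : {poly C} * {poly C},
    NP p (fun t => f t - trigpoly PQ.1 PQ.2 t) < n.+1%:R^-1.
  have [|P [Q H]] := trigpoly_dense p1 pq lf (eps := n.+1%:R^-1); first by rewrite invr_gt0.
  by exists (P, Q).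
pose PQ n := sval (cid (approx n)).
have HPQ n : NP p (fun t => f t - trigpoly (PQ n).1 (PQ n).2 t) < n.+1%:R^-1.
  by rewrite /PQ; case: cid.
have lh P : LP p (fun t => P.[t]) by apply: Linf_LP => //; exact: Linf_horner.
have ltr P Q : LP p (trigpoly P Q) by apply: Linf_LP => //; exact: Linf_trigpoly.
have small d : 0 < d -> exists n0, forall n, (n0 <= n)%N ->
    NP p (fun t => f t - trigpoly (PQ n).1 (PQ n).2 t) < d.
  move=> d0; have [n0 Hn0] : exists n0 : nat, d^-1 <= n0%:R.
    by exists (Num.truncn d^-1).+1; rewrite ltW// truncnS_gt.
  exists n0 => n nn; apply: lt_le_trans (HPQ n) _.
  rewrite invf_ple ?posrE//; apply: le_trans Hn0 _.
  by rewrite ler_nat (leq_trans nn).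
have cauchy d : 0 < d -> exists n0, forall n k, (n0 <= n)%N -> (n0 <= k)%N ->
    NP p (fun t => (PQ n).1.[t] - (PQ k).1.[t]) < d.
  move=> d0; set d' := d / (K * B + 1) / 2.
  have KB : 0 < K * B + 1 by rewrite ltr_wpDl// mulr_ge0.
  have d'0 : 0 < d' by rewrite !divr_gt0.
  have [n0 Hn0] := small d' d'0.
  exists n0 => n k nn kn.
  have E : NP p (fun t => (PQ n).1.[t] - (PQ k).1.[t]) =
      NP p (fun t => ((PQ n).1 - (PQ k).1).[t]).
    by apply: eq_NP => x; rewrite hornerD hornerN.
  rewrite E; apply: le_lt_trans (HK _ ((PQ n).2 - (PQ k).2)) _.
  have E2 : NP p (trigpoly ((PQ n).1 - (PQ k).1) ((PQ n).2 - (PQ k).2)) =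
     NP p (fun t => (f t - trigpoly (PQ k).1 (PQ k).2 t) - (f t - trigpoly (PQ n).1 (PQ n).2 t)).
    by apply: eq_NP => x; rewrite /trigpoly !hornerD !hornerN; ring.
  have [_ H] := LPB p0 (LPB p0 lf (ltr (PQ k).1 (PQ k).2)).1 (LPB p0 lf (ltr (PQ n).1 (PQ n).2)).1.
  rewrite E2; apply: le_lt_trans (ler_wpM2l K0 H) _.
  rewrite mulrA; apply: (@le_lt_trans _ _ (K * B * (d' + d'))).
    by apply: ler_wpM2l; [exact: mulr_ge0|apply: lerD; apply: ltW; exact: Hn0].
  by rewrite /d' -splitr mul_div_succ_lt.
have [g [lg Hg]] := LP_complete p1 (fun n => lh (PQ n).1) cauchy.
have NPg_small d : 0 < d -> exists n0, forall n, (n0 <= n)%N ->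
    NP p (fun t => g t - (PQ n).1.[t]) <= d.
  by move=> /Hg[n0 H]; exists n0 => n nn; rewrite NPC; exact: H.
exists g; split => //.
- apply/ler_addgt0Pr => eps e0.
  set c := B * (K * B) + B.
  have c1 : 0 < c + 1 by rewrite ltr_wpDl// addr_ge0// !mulr_ge0.
  have d0 : 0 < eps / (c + 1) by rewrite divr_gt0.
  have [n1 H1] := small _ d0; have [n2 H2] := Hg _ d0.
  set n := maxn n1 n2.
  have {}H1 := H1 n (leq_maxl _ _); have {}H2 := H2 n (leq_maxr _ _).
  have [_ g1] := LPB p0 (lh (PQ n).1) (LPB p0 (lh (PQ n).1) lg).1.
  have [_ g2] := LPB p0 lf (LPB p0 lf (ltr (PQ n).1 (PQ n).2)).1.
  have gE : NP p g = NP p (fun t => (PQ n).1.[t] - ((PQ n).1.[t] - g t)).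
    by apply: eq_NP => x; rewrite opprB addrC subrK.
  have tE : NP p (trigpoly (PQ n).1 (PQ n).2) =
      NP p (fun t => f t - (f t - trigpoly (PQ n).1 (PQ n).2 t)).
    by apply: eq_NP => x; rewrite opprB addrC subrK.
  rewrite gE; apply: le_trans g1 _.
  have H3 := HK (PQ n).1 (PQ n).2; rewrite tE in H3.
  have H4 := le_trans H3 (ler_wpM2l K0 g2).
  apply: (@le_trans _ _ (B * (K * (B * (NP p f + eps / (c + 1))) + eps / (c + 1)))).
    apply: (ler_wpM2l B0); apply: lerD; last exact: H2.
    apply: le_trans H4 _.
    by apply: (ler_wpM2l K0); apply: (ler_wpM2l B0); rewrite lerD2l; exact: ltW H1.
  have -> : B * (K * (B * (NP p f + eps / (c + 1))) + eps / (c + 1)) =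
     B * (K * B) * NP p f + c * (eps / (c + 1)) by rewrite /c; ring.
  by rewrite lerD2l; exact: mul_div_succ_le c1 e0.
- move=> n n0; apply/eqP; rewrite -subr_eq0; apply/eqP.
  have [lgf _] := LPB p0 lg lf.
  have fE : cint (fun t => f t * t ^ n) = - cint (fun t => -1 * (f t * t ^ n)).
    by rewrite cintZ; [rewrite mulN1r opprK|exact: (LP_mul_L1 p1 pq lf (LPexprz n))].
  rewrite fE opprK -cintD; last 2 first.
    exact: (LP_mul_L1 p1 pq lg (LPexprz n)).
    by apply: L1Z; exact: (LP_mul_L1 p1 pq lf (LPexprz n)).
  rewrite (eq_cint (g := fun t => (g t - f t) * t ^ n)) => [|x]; last by rewrite mulN1r mulrBl.
  apply: (cint_closure p1 pq lgf (LPexprz n)) => d d0.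
  set d' := d / (2 * B); have d'0 : 0 < d' by rewrite divr_gt0// mulr_gt0// (lt_le_trans ltr01).
  have [n1 H1] := small _ d'0; have [n2 H2] := NPg_small _ d'0.
  set k := maxn n1 n2.
  have {}H1 := H1 k (leq_maxl _ _); have {}H2 := H2 k (leq_maxr _ _).
  exists (fun t => (PQ k).1.[t] - trigpoly (PQ k).1 (PQ k).2 t); split.
  + exact: (LPB p0 (lh _) (ltr _ _)).1.
  + rewrite (@eq_NP _ p _ (fun t => (g t - (PQ k).1.[t]) - (f t - trigpoly (PQ k).1 (PQ k).2 t))); last first.
      by move=> x; ring.
    apply: le_trans (LPB p0 (LPB p0 lg (lh _)).1 (LPB p0 lf (ltr _ _)).1).2 _.
    apply: (@le_trans _ _ (B * (d' + d'))).
      by apply: (ler_wpM2l B0); apply: lerD; [exact: H2|exact: ltW].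
    have Bn0 : B != 0 by rewrite gt_eqF// (lt_le_trans ltr01).
    by rewrite (_ : B * (d' + d') = d)// /d'; field.
  + have i1 : L1 (fun t => (PQ k).1.[t] * t ^ n) by exact: (LP_mul_L1 p1 pq (lh _) (LPexprz n)).
    have i2 : L1 (fun t => trigpoly (PQ k).1 (PQ k).2 t * t ^ n).
      exact: (LP_mul_L1 p1 pq (ltr _ _) (LPexprz n)).
    rewrite (eq_cint (g := fun t => (PQ k).1.[t] * t ^ n + -1 * (trigpoly (PQ k).1 (PQ k).2 t * t ^ n))) => [|x].
      by rewrite cintD//; [rewrite cintZ// cint_trigpoly_exprz// mulN1r subrr|exact: L1Z].
    by rewrite mulN1r mulrBl.
- move=> n n0; apply: (cint_closure p1 pq lg (LPexprz n)) => d d0.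
  have [k Hk] := NPg_small _ d0; exists (fun t => (PQ k).1.[t]); split => //.
    exact: Hk.
  exact: cint_horner_exprz.
- move=> d d0; have [k Hk] := NPg_small _ d0; exists (PQ k).1; exact: Hk.
Qed.

End riesz_projection.

(** * Products of analytic functions *)

Section analytic_products.
Variable R : realType.
Local Notation C := R[i].
Local Notation e := (@circ_pt R).
Local Notation mD := (@measurable_Tdom R).
Implicit Types (f g : C -> C) (P Q : {poly C}) (n : int).
Variables (p q : R).
Hypotheses (p1 : 1 < p) (pq : p^-1 + q^-1 = 1).

Let p0 : 0 < p. Proof. by rewrite (lt_trans ltr01). Qed.
Let q0 : 0 < q. Proof. by rewrite (lt_trans ltr01)// (conj_gt1 p1 pq). Qed.
Let qp : q^-1 + p^-1 = 1. Proof. by rewrite addrC. Qed.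

(* cint (f t^n) is, up to a factor, the Fourier coefficient of index - n. *)
Definition analytic f := forall n, 0 < n -> cint (fun t => f t * t ^ n) = 0.

Lemma LP_exprz r f n : 0 < r -> LP r f -> LP r (fun t => f t * t ^ n).
Proof.
move=> r0 /(LPM_ r0 (Linf_exprz R n)); apply: eq_LP => x; exact: mulrC.
Qed.

Lemma cint_exprzM f m n : cint (fun t => f t * t ^ m * t ^ n) = cint (fun t => f t * t ^ (m + n)).
Proof. by apply: eq_cint => x; rewrite expfzDr ?circ_neq0// mulrA. Qed.

Lemma LP_fourier_eq0 f : LP p f -> (forall n, cint (fun t => f t * t ^ n) = 0) ->
  ae_eqc f (fun=> 0).
Proof. by move=> lf; apply: L1_fourier_eq0; exact: (LP_L1 p1 pq lf). Qed.

Lemma ae_eqc_NP f g : LP p f -> LP p g -> ae_eqc f g -> NP p f = NP p g.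
Proof.
move=> [mf _] [mg _] fg; apply: (Rintegral_ae_eq mD); [exact: measurable_modp..|].
by apply: aeS fg => x /[apply] ->.
Qed.

Lemma analytic_approx f d : LP p f -> analytic f -> 0 < d ->
  exists P, NP p (fun t => f t - P.[t]) <= d.
Proof.
move=> lf af d0; have [K K0 /(_ f lf)[g [lg _ g1 g2 /(_ d d0)[P HP]]]] := riesz_projection p1 pq.
exists P; have lP : LP p (fun t => P.[t]) by apply: Linf_LP => //; exact: Linf_horner.
have [lgf _] := LPB p0 lg lf.
have z : ae_eqc (fun t => g t - f t) (fun=> 0).
  apply: (LP_fourier_eq0 lgf) => n.
  have i1 := LP_L1 p1 pq (LP_exprz n p0 lg).
  have i2 := LP_L1 p1 pq (LP_exprz n p0 lf).
  rewrite (eq_cint (g := fun t => g t * t ^ n + -1 * (f t * t ^ n))) => [|x].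
    rewrite cintD//; last exact: L1Z.
    rewrite cintZ// mulN1r; have [n0|n0] := leP n 0; first by rewrite g1// subrr.
    by rewrite g2// af// subr0.
  by rewrite mulN1r mulrBl.
apply: le_trans HP; rewrite (@ae_eqc_NP (fun t => f t - P.[t]) (fun t => g t - P.[t]))//.
- by have [] := LPB p0 lf lP.
- by have [] := LPB p0 lg lP.
- by apply: aeS z => x /[apply] /eqP; rewrite subr_eq0 => /eqP ->.
Qed.

Lemma analytic_horner_mul P g n : LP q g -> analytic g -> 0 < n ->
  cint (fun t => P.[t] * t ^ n * g t) = 0.
Proof.
move=> lg ag; elim/poly_ind: P n => [|P c IH] n n0.
  rewrite (eq_cint (g := fun t => 0 * g t)) => [|x]; last by rewrite horner0 mul0r.
  by rewrite cintZ ?mul0r//; exact: (LP_L1 (conj_gt1 p1 pq) qp lg).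
have i1 : L1 (fun t => P.[t] * t ^ (n + 1) * g t).
  apply: (LP_mul_L1 p1 pq) => //; apply: Linf_LP => //.
  by apply: LinfM; [exact: Linf_horner|exact: Linf_exprz].
have i2 : L1 (fun t => g t * t ^ n).
  exact: (LP_L1 (conj_gt1 p1 pq) qp (LP_exprz n q0 lg)).
rewrite (eq_cint (g := fun t => P.[t] * t ^ (n + 1) * g t + c * (g t * t ^ n))) => [|x].
  by rewrite cintD//; [rewrite cintZ// ag// mulr0 addr0 IH// ltr_wpDr|exact: L1Z].
rewrite hornerMXaddC (addrC n) expfzDr ?circ_neq0// -[e x ^ 1]/(e x); ring.
Qed.

Lemma analytic_mul0 f g : LP p f -> LP q g ->
  (forall n, 0 <= n -> cint (fun t => f t * t ^ n) = 0) -> analytic g ->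
  cint (fun t => f t * g t) = 0.
Proof.
move=> lf lg f0 ag; apply: (cint_closure p1 pq lf lg) => d d0.
have lf1 := LP_exprz (-1) p0 lf.
have af1 : analytic (fun t => f t * t ^ (-1)).
  by move=> n n0; rewrite cint_exprzM f0// addrC subr_ge0 -gtz0_ge1.
have [K K0 HK] := LPM p0 (Linf_exprz R 1).
have d'0 : 0 < d / (K + 1) by rewrite divr_gt0// ltr_wpDl.
have [P HP] := analytic_approx lf1 af1 d'0.
have lP : LP p (fun t => P.[t]) by apply: Linf_LP => //; exact: Linf_horner.
exists (fun t => P.[t] * t ^ 1); split.
- exact: LP_exprz.
- rewrite (@eq_NP _ p _ (fun t => t ^ 1 * (f t * t ^ (-1) - P.[t]))) => [|x]; last first.
    by rewrite mulrBr mulrCA -expfzDr ?circ_neq0// mulr1 [P.[_] * _]mulrC.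
  have [_ H] := HK _ (LPB p0 lf1 lP).1.
  apply: le_trans H (le_trans (ler_wpM2l K0 HP) _).
  by rewrite mulrCA ger_pMr// ler_pdivrMr ?mul1r ?lerDl// ltr_wpDl.
- exact: analytic_horner_mul.
Qed.

Lemma analytic_mul f g : LP p f -> LP q g -> analytic f -> analytic g ->
  cint (fun=> 1) * cint (fun t => f t * g t) = cint f * cint g.
Proof.
move=> lf lg af ag; set c := cint f / cint (fun=> 1).
have cE : c * cint (fun=> 1) = cint f by rewrite divfK// cint1.
have l1 : LP p (fun=> 1 : C) by apply: Linf_LP => //; exact: Linf_cst.
have lF : LP p (fun t => f t + - c * 1) by apply: (LPD p0 lf (LPZ _ p0 l1)).1.
have F0 n : 0 <= n -> cint (fun t => (f t + - c * 1) * t ^ n) = 0.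
  rewrite (eq_cint (g := fun t => f t * t ^ n + - c * t ^ n)) => [|x]; last by rewrite mulr1 mulrDl.
  have i2 : L1 (fun t : C => t ^ n) by apply: Linf_L1; exact: Linf_exprz.
  rewrite le_eqVlt => /predU1P[<-|n0].
    rewrite cintD//; last 2 first.
      exact: (LP_L1 p1 pq (LP_exprz 0 p0 lf)).
      by apply: L1Z; apply: Linf_L1; exact: Linf_exprz.
    rewrite cintZ; last by apply: Linf_L1; exact: Linf_exprz.
    have -> : cint (fun t => f t * t ^ 0) = cint f by apply: eq_cint => x; rewrite mulr1.
    by rewrite mulNr cE subrr.
  rewrite cintD//; last 2 first.
    exact: (LP_L1 p1 pq (LP_exprz n p0 lf)).
    exact: L1Z.
  by rewrite cintZ// af// cint_exprz ?gt_eqF// mulr0 addr0.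
have := analytic_mul0 lF lg F0 ag.
rewrite (eq_cint (g := fun t => f t * g t + - c * g t)) => [|x]; last by rewrite mulr1 mulrDl.
have ig := LP_L1 (conj_gt1 p1 pq) qp lg.
rewrite cintD//; [|exact: (LP_mul_L1 p1 pq lf lg)|exact: L1Z].
rewrite cintZ// mulNr => /eqP; rewrite subr_eq0 => /eqP ->.
by rewrite -cE; ring.
Qed.

Lemma analytic_leading f : analytic f ->
  (forall n, cint (fun t => f t * t ^ n) = 0) \/
  exists k : int, cint (fun t => f t * t ^ k) != 0 /\ analytic (fun t => f t * t ^ k).
Proof.
move=> af; case: (pselect (exists k : nat, cint (fun t => f t * t ^ (- k%:Z)) != 0)) => [H|H]; last first.
  left=> n; have [/af//|n0] := ltP 0 n.
  apply: contrapT => /eqP nz; apply: H; exists `|n|%N.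
  by rewrite abszE ler0_norm// opprK.
right; case: (ex_minnP H) => k kz kmin; exists (- k%:Z); split => // n n0.
rewrite cint_exprzM; have [/af//|kn] := ltP 0 (- k%:Z + n).
apply: contrapT => /eqP nz.
have E : `|(- k%:Z + n)%R|%N%:Z = - (- k%:Z + n) by rewrite abszE ler0_norm.
have : k%:Z <= `|(- k%:Z + n)%R|%N%:Z by rewrite lez_nat kmin// E opprK.
by rewrite E opprD opprK lerDl oppr_ge0 leNgt n0.
Qed.

Lemma analytic_integral_domain f g : LP p f -> LP q g -> analytic f -> analytic g ->
  (forall n, cint (fun t => f t * g t * t ^ n) = 0) ->
  (forall n, cint (fun t => f t * t ^ n) = 0) \/ (forall n, cint (fun t => g t * t ^ n) = 0).
Proof.
move=> lf lg /analytic_leading[|[k [fk afk]]]; first by left.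
move=> /analytic_leading[|[j [gj agj]]] fg0; first by right.
have := analytic_mul (LP_exprz k p0 lf) (LP_exprz j q0 lg) afk agj.
have -> : cint (fun t => f t * t ^ k * (g t * t ^ j)) = cint (fun t => f t * g t * t ^ (k + j)).
  by apply: eq_cint => x; rewrite expfzDr ?circ_neq0// mulrACA.
rewrite fg0 mulr0 => /esym/eqP; rewrite mulf_eq0.
by rewrite (negbTE fk) (negbTE gj).
Qed.

End analytic_products.

(** * Toeplitz plus Hankel operators *)

Section toeplitz_plus_hankel.
Variable R : realType.
Local Notation C := R[i].
Local Notation mu := (@lebesgue_measure R).
Local Notation D := (@Tdom R).
Local Notation e := (@circ_pt R).
Local Notation intble f := (mu.-integrable D (EFin \o f)).
Local Notation mD := (@measurable_Tdom R).
Implicit Types (f g h v : C -> C) (P Q : {poly C}) (n : int).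
Variables (p q : R).
Hypotheses (p1 : 1 < p) (pq : p^-1 + q^-1 = 1).

Let p0 : 0 < p. Proof. by rewrite (lt_trans ltr01). Qed.
Let q1 : 1 < q. Proof. exact: conj_gt1 p1 pq. Qed.
Let q0 : 0 < q. Proof. by rewrite (lt_trans ltr01). Qed.
Let qp : q^-1 + p^-1 = 1. Proof. by rewrite addrC. Qed.

Lemma intble_cabs f : LP p f -> intble (fun x => cabs (f (e x)) `^ p).
Proof.
move=> [mf ig]; have mc := measurable_cabs_powR p mf.
apply: (dominated_integrable mD mc (intbleZ mD (2 `^ p) ig)) => x _.
by rewrite ger0_norm ?powR_ge0//; exact: cabs_powR_le.
Qed.

Lemma lpint_le_NP f : LP p f -> (lpint p f <= (2 `^ p * NP p f)%:E)%E.
Proof.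
move=> lf; have [mf ig] := lf; have ic := intble_cabs lf.
rewrite /lpint (integral_EFin mD ic) lee_fin -(RintegralZl _ mD ig).
apply: (le_Rintegral mD ic (intbleZ mD (2 `^ p) ig)) => x _.
exact: cabs_powR_le.
Qed.

Lemma NP_eq0_of_lpint f : LP p f -> lpint p f = 0%E -> NP p f = 0.
Proof.
move=> lf; have [mf ig] := lf; have ic := intble_cabs lf.
rewrite /lpint (integral_EFin mD ic) => -[f0].
apply/eqP; rewrite eq_le NP_ge0 andbT -[leRHS](mulr0 2) -f0 -(RintegralZl _ mD ic).
apply: (le_Rintegral mD ig (intbleZ mD 2 ic)) => x _.
exact: modp_le_cabs.
Qed.

Lemma lpint_ae0 f : LP p f -> ae_eqc f (fun=> 0) -> lpint p f = 0%E.
Proof.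
move=> lf f0; have l0 : LP p (fun=> 0 : C) by apply: Linf_LP => //; exact: Linf_cst.
apply/eqP; rewrite eq_le; apply/andP; split; last first.
  by apply: integral_ge0 => x _; rewrite lee_fin powR_ge0.
apply: le_trans (lpint_le_NP lf) _; rewrite lee_fin (ae_eqc_NP lf l0 f0).
rewrite (_ : NP p _ = 0) ?mulr0//.
by rewrite /NP modp0// Rintegral_cst ?mul0r//; exact: mD.
Qed.

Lemma fourier_cint f n : fourier f n = 0 <-> cint (fun t => f t * t ^ (- n)) = 0.
Proof.
rewrite fourierE; split=> [/eqP|->]; last by rewrite mulr0.
rewrite mulf_eq0 => /orP[/eqP/(congr1 (@complex.Re R))/=|/eqP//].
by move=> /eqP; rewrite invr_eq0 gt_eqF// mulrn_wgt0// pi_gt0.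
Qed.

Lemma eq_fourier_cint f g n : fourier f n = fourier g n <->
  cint (fun t => f t * t ^ (- n)) = cint (fun t => g t * t ^ (- n)).
Proof.
rewrite !fourierE; split=> [|->]//; apply: mulfI; apply/eqP => /(congr1 (@complex.Re R))/=.
by move=> /eqP; rewrite invr_eq0 gt_eqF// mulrn_wgt0// pi_gt0.
Qed.

Lemma Hp_analytic f : Hp p f <-> LP p f /\ analytic f.
Proof.
rewrite /Hp Lp_LP//; split=> -[lf af]; split=> // n n0.
  by rewrite -[n]opprK; apply/fourier_cint; apply: af; rewrite oppr_lt0.
by apply/fourier_cint; apply: af; rewrite oppr_gt0.
Qed.

Lemma is_P_analytic f g : is_P p f g <-> [/\ LP p g, analytic g &
  forall n, n <= 0 -> cint (fun t => g t * t ^ n) = cint (fun t => f t * t ^ n)].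
Proof.
split=> [[/Hp_analytic[lg ag] fg]|[lg ag fg]].
  split=> // n n0; rewrite -[n]opprK; apply/eq_fourier_cint; apply: fg.
  by rewrite oppr_ge0.
split=> [|n n0]; first exact/Hp_analytic.
by apply/eq_fourier_cint; apply: fg; rewrite oppr_le0.
Qed.

Lemma cint_reflM f n : cmeasurable f ->
  cint (fun t => f t^-1 * t ^ n) = cint (fun t => f t * t ^ (- n)).
Proof.
move=> mf; rewrite -[RHS]cint_refl; last exact: (cmeasurableM mf (cmeasurable_exprz _ _)).
by apply: eq_cint => x; rewrite exprz_inv opprK.
Qed.

Lemma cint_Jop f n : cmeasurable f ->
  cint (fun t => Jop f t * t ^ n) = cint (fun t => f t * t ^ (1 - n)).
Proof.
move=> mf; rewrite (eq_cint (g := fun t => f t^-1 * t ^ (n - 1))) => [|x].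
  by rewrite cint_reflM// opprB.
rewrite /Jop expfzDr ?circ_neq0// -[e x ^ (-1)]/((e x)^-1); ring.
Qed.

Lemma LP_Jop f : LP p f -> LP p (Jop f).
Proof.
move=> /LP_refl lf; apply: eq_LP (LP_exprz (-1) p0 lf) => x.
by rewrite /Jop mulrC.
Qed.

Lemma is_Q_Jop f g : LP p f -> analytic f -> is_Q p (Jop f) g <->
  LP p g /\ ae_eqc g (Jop f).
Proof.
move=> lf af; have lJ := LP_Jop lf; have [mf _] := lf.
have J0 n : n <= 0 -> cint (fun t => Jop f t * t ^ n) = 0.
  by move=> n0; rewrite cint_Jop// af// subr_gt0 (le_lt_trans n0).
rewrite /is_Q Lp_LP//; split=> [[lg [g0 gJ]]|[lg gJ]].
  split=> //; have [ld _] := LPB p0 lg lJ.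
  have z : ae_eqc (fun t => g t - Jop f t) (fun=> 0).
    apply: (LP_fourier_eq0 p1 pq ld) => n.
    have i1 := LP_L1 p1 pq (LP_exprz n p0 lg).
    have i2 := LP_L1 p1 pq (LP_exprz n p0 lJ).
    rewrite (eq_cint (g := fun t => g t * t ^ n + -1 * (Jop f t * t ^ n))) => [|x]; last first.
      by rewrite mulN1r mulrBl.
    rewrite cintD//; last exact: L1Z.
    rewrite cintZ// mulN1r; have [n0|n0] := leP n 0.
      rewrite J0// subr0 -[n]opprK; apply/fourier_cint; apply: g0.
      by rewrite oppr_ge0.
    apply/eqP; rewrite subr_eq0; apply/eqP; rewrite -[n]opprK; apply/eq_fourier_cint.
    by apply: gJ; rewrite oppr_lt0.
  by apply: aeS z => x /[apply] /eqP; rewrite subr_eq0 => /eqP.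
split=> //; have E n : fourier g n = fourier (Jop f) n.
  apply/eq_fourier_cint; apply: cint_ae_eq.
  - exact: (cmeasurableM lg.1 (cmeasurable_exprz _ _)).
  - exact: (cmeasurableM lJ.1 (cmeasurable_exprz _ _)).
  - by apply: aeS gJ => x /[apply] ->.
by split=> n n0; rewrite E//; apply/fourier_cint; rewrite J0// oppr_le0.
Qed.

End toeplitz_plus_hankel.

Section coburn_simonenko.
Variable R : realType.
Local Notation C := R[i].
Local Notation e := (@circ_pt R).
Local Notation mD := (@measurable_Tdom R).
Implicit Types (f g h v : C -> C) (P Q : {poly C}) (n : int).

Lemma cint_coefD p q f g n : 1 < p -> p^-1 + q^-1 = 1 -> LP p f -> LP p g ->
  cint (fun t => (f t + g t) * t ^ n) = cint (fun t => f t * t ^ n) + cint (fun t => g t * t ^ n).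
Proof.
move=> p1 pq lf lg; have p0 : 0 < p by rewrite (lt_trans ltr01).
rewrite -cintD; [|exact: (LP_L1 p1 pq (LP_exprz _ p0 _))..].
by apply: eq_cint => x; rewrite mulrDl.
Qed.

Lemma cint_coefZ p q c f n : 1 < p -> p^-1 + q^-1 = 1 -> LP p f ->
  cint (fun t => c * f t * t ^ n) = c * cint (fun t => f t * t ^ n).
Proof.
move=> p1 pq lf; have p0 : 0 < p by rewrite (lt_trans ltr01).
rewrite -cintZ; last exact: (LP_L1 p1 pq (LP_exprz _ p0 _)).
by apply: eq_cint => x; rewrite mulrA.
Qed.

Lemma cint_ae0 f : cmeasurable f -> ae_eqc f (fun=> 0) -> cint f = 0.
Proof.
move=> mf f0; rewrite (cint_ae_eq mf (cmeasurable_cst _) f0).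
by rewrite /cint; apply: complex_ext; rewrite /= Rintegral_cst ?mul0r//; exact: mD.
Qed.

Variables (p q : R).
Hypotheses (p1 : 1 < p) (pq : p^-1 + q^-1 = 1).

Let p0 : 0 < p. Proof. by rewrite (lt_trans ltr01). Qed.
Let q1 : 1 < q. Proof. exact: conj_gt1 p1 pq. Qed.
Let q0 : 0 < q. Proof. by rewrite (lt_trans ltr01). Qed.
Let qp : q^-1 + p^-1 = 1. Proof. by rewrite addrC. Qed.

Variables (a b : C -> C) (s : C) (j : int).
Hypotheses (la : Linf a) (ss : s * s = 1).
Hypothesis bE : forall x, b (e x) = a (e x) * e x ^ j.
Hypothesis sj : [\/ j = 0, j = 1 /\ s = 1 | j = -1 /\ s = -1].

(* Since QJf = Jf for f in H^p, the operator is f |-> P (a * fold f). *)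
Definition fold f t := f t + s * (t ^ j * Jop f t).

Lemma LP_fold f : LP p f -> LP p (fold f).
Proof.
move=> lf; apply: (LPD p0 lf _).1; apply: LPZ => //.
by apply: (LPM_ p0 (Linf_exprz _ j)); exact: LP_Jop.
Qed.

Let mul_LP f : LP p f -> LP p (fun t => a t * f t).
Proof. exact: LPM_. Qed.

Let lH P : LP p (fun t => P.[t]).
Proof. by apply: Linf_LP => //; exact: Linf_horner. Qed.

Let aH P : analytic (fun t => P.[t]).
Proof. by move=> n n0; exact: cint_horner_exprz. Qed.

Definition fold_range P Q t := a t * fold (fun t => P.[t]) t + t^-1 * Q.[t^-1].

Lemma LP_fold_range P Q : LP p (fold_range P Q).
Proof.
apply: (LPD p0 _ _).1; first exact: (mul_LP (LP_fold (lH P))).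
apply: Linf_LP => //; apply: LinfM; [exact: (Linf_exprz _ (-1))|exact: Linf_hornerV].
Qed.

Let b_LP f : LP p f -> LP p (fun t => b t * f t).
Proof.
move=> lf; have /mul_LP := LPM_ p0 (Linf_exprz _ j) lf.
by apply: eq_LP => x; rewrite bE mulrA.
Qed.

Let afold f x : a (e x) * fold f (e x) = a (e x) * f (e x) + s * (b (e x) * Jop f (e x)).
Proof. by rewrite bE /fold; ring. Qed.

Lemma coker_trivial_dense : (forall h, Hp p h -> forall d, 0 < d ->
    exists P Q, NP p (fun t => h t - fold_range P Q t) < d) -> coker_trivial p a s b.
Proof.
move=> H h Hh eps e0; have [K K0 HK] := riesz_projection p1 pq.
have [lh ah] := (Hp_analytic p1 _).1 Hh.
set c := 2 `^ p * K; have c1 : 0 < c + 1 by rewrite ltr_wpDl// mulr_ge0// powR_ge0.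
have [|P [Q HPQ]] := H h Hh (eps / (c + 1)); first by rewrite divr_gt0.
set f := fun t => P.[t]; have lf : LP p f := lH P.
have lJ : LP p (Jop f) := LP_Jop p1 lf.
pose u t := fold_range P Q t - h t.
have lu : LP p u := (LPB p0 (LP_fold_range P Q) lh).1.
have [r [lr NPr r1 r2 _]] := HK u lu.
have [g1 [lg1 _ g11 g12 _]] := HK _ (mul_LP lf).
pose g t := r t + h t; pose g2 t := s * (g t - g1 t).
have lg : LP p g := (LPD p0 lr lh).1.
have lgg : LP p (fun t => g t - g1 t) := (LPB p0 lg lg1).1.
have lg2 : LP p g2 := LPZ s p0 lgg.
have fcB f1 f2 n : LP p f1 -> LP p f2 -> cint (fun t => (f1 t - f2 t) * t ^ n) =
    cint (fun t => f1 t * t ^ n) - cint (fun t => f2 t * t ^ n).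
  move=> l1 l2; rewrite (eq_cint (g := fun t => (f1 t + -1 * f2 t) * t ^ n)) => [|x]; last by rewrite mulN1r.
  by rewrite (cint_coefD n p1 pq l1 (LPZ _ p0 l2)) (cint_coefZ _ n p1 pq l2) mulN1r.
have g2E n : cint (fun t => g2 t * t ^ n) = s * (cint (fun t => r t * t ^ n) +
    cint (fun t => h t * t ^ n) - cint (fun t => g1 t * t ^ n)).
  by rewrite (cint_coefZ _ n p1 pq lgg) fcB// (cint_coefD n p1 pq lr lh).
have fr n : n <= 0 -> cint (fun t => fold_range P Q t * t ^ n) =
    cint (fun t => a t * f t * t ^ n) + s * cint (fun t => b t * Jop f t * t ^ n).
  move=> n0; have lQ : LP p (fun t => t^-1 * Q.[t^-1]).
    by apply: Linf_LP => //; apply: LinfM; [exact: (Linf_exprz _ (-1))|exact: Linf_hornerV].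
  rewrite (cint_coefD n p1 pq (mul_LP (LP_fold lf)) lQ).
  have -> : cint (fun t => t^-1 * Q.[t^-1] * t ^ n) = 0.
    rewrite -(@cint_hornerV_exprz R Q (n - 1)); last by rewrite ltrBlDr ltr_pwDr.
    apply: eq_cint => x; rewrite expfzDr ?circ_neq0// -[e x ^ (-1)]/((e x)^-1); ring.
  rewrite addr0 (eq_cint (g := fun t => (a t * f t + s * (b t * Jop f t)) * t ^ n)) => [|x].
    by rewrite (cint_coefD n p1 pq (mul_LP lf) (LPZ s p0 (b_LP lJ))) (cint_coefZ s n p1 pq (b_LP lJ)).
  by rewrite afold.
exists f, g; split; [by apply/(Hp_analytic p1); split => //; exact: aH|split].
  exists g1, g2; split; [|split].
  - by apply/(is_P_analytic p1); split.
  - exists (Jop f); split.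
      by apply/(is_Q_Jop p1 pq _ lf (@aH P)); split=> //; exact: aeW.
    apply/(is_P_analytic p1); split => // n n0; rewrite g2E.
      by rewrite r2// g12// ah// addr0 subr0 mulr0.
    rewrite r1// g11// /u fcB//; last exact: LP_fold_range.
    by rewrite subrK fr// addrAC subrr add0r mulrA ss mul1r.
  - by move=> t; rewrite /g2 mulrA ss mul1r addrC subrK.
have E : (fun t => (g t - h t)%R) = r by apply/funext => t; rewrite /g addrK.
rewrite E; apply: le_lt_trans (lpint_le_NP p1 lr) _; rewrite lte_fin.
have : NP p u < eps / (c + 1) by rewrite NPC.
move=> Nu; apply: (@le_lt_trans _ _ (c * NP p u)).
  by rewrite -mulrA ler_wpM2l// powR_ge0.
apply: (@le_lt_trans _ _ (c * (eps / (c + 1)))).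
  by apply: ler_wpM2l; [apply: mulr_ge0 => //; exact: powR_ge0|exact: ltW].
by rewrite mulrCA gtr_pMr// ltr_pdivrMr// mul1r ltrDl.
Qed.

Lemma coker_annihilator : ~ coker_trivial p a s b -> exists v, [/\ LP q v,
  forall P Q, cint (fun t => fold_range P Q t * v t) = 0 &
  exists2 h, LP p h & cint (fun t => h t * v t) != 0].
Proof.
move=> nc; apply: contrapT => nv; apply: nc; apply: coker_trivial_dense => h Hh d d0.
apply: contrapT => H; apply: nv; have [lh _] := (Hp_analytic p1 _).1 Hh.
pose M m := exists P Q, m = fold_range P Q.
have LM m : M m -> LP p m by move=> [P [Q ->]]; exact: LP_fold_range.
have M0 : M (fun=> 0).
  by exists 0, 0; apply/funext => t; rewrite /fold_range /fold /Jop !horner0; ring.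
have Ml c m1 m2 : M m1 -> M m2 -> M (fun t => m1 t + c * m2 t).
  move=> [P1 [Q1 ->]] [P2 [Q2 ->]]; exists (P1 + c *: P2), (Q1 + c *: Q2).
  by apply/funext => t; rewrite /fold_range /fold /Jop !hornerD !hornerZ; ring.
have [|v [lv v0 hv]] := LP_annihilator p1 pq LM M0 Ml lh d0.
  by move=> m [P [Q ->]]; rewrite leNgt; apply/negP => h1; apply: H; exists P, Q.
by exists v; split => //; [move=> P Q; apply: v0; exists P, Q|exists h].
Qed.

Let av_LP v : LP q v -> LP q (fun t => a t * v t).
Proof. exact: LPM_. Qed.

Definition sym_mul v t := a t * v t + s * (t ^ (1 - j) * (a t^-1 * v t^-1)).

Lemma annihilator_analytic v : LP q v ->
  (forall P Q, cint (fun t => fold_range P Q t * v t) = 0) -> analytic (fun t => v t^-1).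
Proof.
move=> lv v0 [[|k]|//] // _; rewrite cint_reflM; last exact: lv.1.
rewrite -(v0 0 'X^k); apply: eq_cint => x.
rewrite /fold_range /fold /Jop !horner0 hornerXn !mulr0 addr0 mulr0 add0r.
by rewrite mulrC -exprS exprVn.
Qed.

Lemma annihilator_sym_mul v : LP q v ->
  (forall P Q, cint (fun t => fold_range P Q t * v t) = 0) -> ae_eqc (sym_mul v) (fun=> 0).
Proof.
move=> lv v0; have lav := av_LP lv.
have lavr : LP q (fun t => a t^-1 * v t^-1) := LP_refl lav.
have lw2 : LP q (fun t => t ^ (1 - j) * (a t^-1 * v t^-1)).
  by apply: LPM_ => //; exact: Linf_exprz.
have lw : LP q (sym_mul v) := (LPD q0 lav (LPZ s q0 lw2)).1.
pose A n := cint (fun t => a t * v t * t ^ n).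
(* The coefficients W of sym_mul v satisfy W n = s W (j - 1 - n), and annihilation
   gives those with n >= 0; the only other one not reached is n = j = -1, where s = -1. *)
have WE n : cint (fun t => sym_mul v t * t ^ n) = A n + s * A (j - 1 - n).
  rewrite (cint_coefD n q1 qp lav (LPZ s q0 lw2)) (cint_coefZ s n q1 qp lw2); congr (_ + s * _).
  rewrite (eq_cint (g := fun t => (a t^-1 * v t^-1) * t ^ (1 - j + n))) => [|x].
    rewrite (@cint_reflM _ (fun t => a t * v t) (1 - j + n)); last exact: lav.1.
    by congr (cint (fun t => _ * t ^ _)); rewrite !opprD opprK addrC [- 1 + j]addrC addrC.
  by rewrite [in RHS]expfzDr ?circ_neq0//; ring.
apply: (LP_fourier_eq0 q1 qp lw) => n.
have W0 k : 0 <= k -> A k + s * A (j - 1 - k) = 0.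
  case: k => [k|//] _; rewrite -[RHS](v0 'X^k 0).
  have i2 := LP_L1 q1 qp (LP_exprz (j - 1 - k%:Z) q0 lav).
  rewrite /A -cintZ// -cintD; [|exact: (LP_L1 q1 qp (LP_exprz _ q0 lav))|exact: L1Z].
  apply: eq_cint => x.
  rewrite /fold_range /fold /Jop !hornerXn horner0 mulr0 addr0.
  rewrite !expfzDr ?circ_neq0// -[e x ^ (-1)]/((e x)^-1).
  by rewrite -[e x ^ (- k%:Z)]exprz_inv -!exprnP; ring.
have Ws : A n + s * A (j - 1 - n) = s * (A (j - 1 - n) + s * A (j - 1 - (j - 1 - n))).
  by rewrite mulrDr mulrA ss mul1r subKr addrC.
rewrite WE; have [n0|n0] := leP 0 n; first exact: W0.
have [n1|n1] := leP 0 (j - 1 - n); first by rewrite Ws W0// mulr0.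
case: sj => [j0|[j1 _]|[j1 s1]].
- by move: n1; rewrite j0 sub0r subr_lt0 ltNge -ltzD1 addNr n0.
- by move: n1; rewrite j1 subrr sub0r oppr_lt0 ltNge (ltW n0).
have nE : n = -1.
  by move: n0 n1; rewrite j1; case: n {Ws WE} => [//|[//|k]] _; rewrite NegzE.
by rewrite nE j1 s1 opprK addrNK mulN1r subrr.
Qed.

Lemma ker_antianalytic : ~ ker_trivial p a s b -> exists f,
  [/\ LP p f, analytic f, lpint p f <> 0%E &
      forall n, n <= 0 -> cint (fun t => a t * fold f t * t ^ n) = 0].
Proof.
move=> nk; apply: contrapT => H; apply: nk => f g Hf [g1 [g2 [fg1 [[r [fr rg2]] gE]]]] g0.
have [lf af] := (Hp_analytic p1 _).1 Hf.
apply: contrapT => f0; apply: H; exists f; split=> [|||n n0]; [exact: lf|exact: af|exact: f0|].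
move=> {f0}.
have lJ := LP_Jop p1 lf.
have [lr rJ] := (is_Q_Jop p1 pq r lf af).1 fr.
have [lg1 ag1 g1E] := (is_P_analytic p1 _ _).1 fg1.
have [lg2 ag2 g2E] := (is_P_analytic p1 _ _).1 rg2.
have lg : LP p g.
  by apply: eq_LP (LPD p0 lg1 (LPZ s p0 lg2)).1 => x; rewrite gE.
have gz : cint (fun t => g t * t ^ n) = 0.
  have NPg0 := NP_eq0_of_lpint p1 lg g0; move: NPg0 => {g0} NPg0.
  apply: (cint_closure p1 pq lg (Linf_LP q0 (Linf_exprz _ n))) => d d0.
  exists (fun=> 0); split.
  - exact: (Linf_LP p0 (Linf_cst 0)).
  - rewrite (@eq_NP _ p _ g) => [|x]; last by rewrite subr0.
    by rewrite NPg0; exact: ltW.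
  - rewrite (eq_cint (g := fun=> 0)) => [|x]; last by rewrite mul0r.
    by apply: cint_ae0; [exact: cmeasurable_cst|exact: aeW].
rewrite (eq_cint (g := fun t => (a t * f t + s * (b t * Jop f t)) * t ^ n)) => [|x]; last first.
  by rewrite afold.
rewrite (cint_coefD n p1 pq (mul_LP lf) (LPZ s p0 (b_LP lJ))) (cint_coefZ s n p1 pq (b_LP lJ)).
rewrite -g1E// -[RHS]gz (eq_cint (f := fun t => g t * t ^ n)
  (g := fun t => (g1 t + s * g2 t) * t ^ n)) => [|x]; last by rewrite gE.
rewrite (cint_coefD n p1 pq lg1 (LPZ s p0 lg2)) (cint_coefZ s n p1 pq lg2); congr (_ + s * _).
rewrite g2E//; apply: cint_ae_eq.
- exact: (LP_exprz n p0 (b_LP lJ)).1.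
- exact: (LP_exprz n p0 (b_LP lr)).1.
- by apply: aeS rJ => x /[apply] ->.
Qed.

Hypothesis ainv : exists b', ae_eqc (fun t => a t * b' t) (fun=> 1).

Lemma fold_ae0 f : LP p f -> analytic f -> ae_eqc (fold f) (fun=> 0) -> ae_eqc f (fun=> 0).
Proof.
move=> lf af f0; have lJ := LP_Jop p1 lf.
have lcJ : LP p (fun t => t ^ j * Jop f t) by apply: (LPM_ p0 (Linf_exprz _ j)).
apply: (LP_fourier_eq0 p1 pq lf) => n; have [/af//|n0] := ltP 0 n.
have : cint (fun t => fold f t * t ^ n) = 0.
  apply: cint_ae0; first exact: (LP_exprz n p0 (LP_fold lf)).1.
  by apply: aeS f0 => x /[apply] ->; rewrite mul0r.
rewrite (cint_coefD n p1 pq lf (LPZ s p0 lcJ)) (cint_coefZ s n p1 pq lcJ).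
have -> : cint (fun t => t ^ j * Jop f t * t ^ n) = cint (fun t => f t * t ^ (1 - (j + n))).
  rewrite -(cint_Jop _ lf.1); apply: eq_cint => x.
  by rewrite expfzDr ?circ_neq0//; ring.
have [jn|jn] := ltP 0 (1 - (j + n)); first by rewrite (af _ jn) mulr0 addr0.
case: sj => [j0|[j1 s1]|[j1 s1]].
- by move: jn; rewrite j0 add0r leNgt subr_gt0 (le_lt_trans n0).
- have -> : n = 0 by apply/eqP; rewrite eq_le n0; move: jn; rewrite j1 opprD addrA subrr sub0r oppr_le0.
  rewrite j1 s1 addr0 subrr mul1r => /eqP; rewrite -mulr2n mulrn_eq0 => /eqP//.
- by move: jn; rewrite j1 opprD opprK addrA leNgt subr_gt0 (le_lt_trans n0).
Qed.

Lemma ker_or_coker_trivial : ker_trivial p a s b \/ coker_trivial p a s b.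
Proof.
apply: contrapT => /not_orP[/ker_antianalytic[f [lf af f0 fm]]].
move=> /coker_annihilator[v [lv v0 [h lh]]].
have av := annihilator_analytic lv v0.
have wz := annihilator_sym_mul lv v0.
have lfo := LP_fold lf; have lm := mul_LP lfo.
have lmr : LP p (fun t => a t^-1 * fold f t^-1) := LP_refl lm.
have lvr : LP q (fun t => v t^-1) := LP_refl lv.
have mr n : 0 <= n -> cint (fun t => a t^-1 * fold f t^-1 * t ^ n) = 0.
  move=> n0; rewrite (@cint_reflM _ (fun t => a t * fold f t)); last exact: lm.1.
  by rewrite fm// oppr_le0.
pose H n := cint (fun t => a t^-1 * fold f t^-1 * v t^-1 * t ^ n).
have lhv := LP_mul_L1 p1 pq lm lv.
have HE n : cint (fun t => a t * fold f t * v t * t ^ n) = H (- n).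
  rewrite /H (@cint_reflM _ (fun t => a t * fold f t * v t)) ?opprK//.
  exact: (L1_cmeasurable lhv).
have H0 n : 0 <= n -> H n = 0.
  move=> n0; rewrite /H (eq_cint (g := fun t => a t^-1 * fold f t^-1 * t ^ n * v t^-1)) => [|x].
    apply: (analytic_mul0 p1 pq (LP_exprz n p0 lmr) lvr) => // m m0.
    by rewrite cint_exprzM mr// addr_ge0.
  by rewrite mulrAC.
have HN n : H n + H (- n) = 0.
  have lX : LP q (fun t => v t * t ^ n) := LP_exprz n q0 lv.
  have lXr : LP q (fun t => v t^-1 * t ^ n) := LP_exprz n q0 lvr.
  rewrite addrC -HE /H -cintD; last 2 first.
  - exact: L1M lhv (Linf_exprz _ n).
  - exact: L1M (LP_mul_L1 p1 pq lmr lvr) (Linf_exprz _ n).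
  apply: cint_ae0.
    have m1 := cmeasurableM (L1_cmeasurable lhv) (cmeasurable_exprz R n).
    have m2 := cmeasurableM (L1_cmeasurable (LP_mul_L1 p1 pq lmr lvr)) (cmeasurable_exprz R n).
    exact: cmeasurableD.
  apply: aeS wz => x /[apply] wx.
  have foldV : fold f (e x)^-1 = s * e x ^ (1 - j) * fold f (e x).
    rewrite /fold /Jop invrK exprz_inv !expfzDr ?circ_neq0// -[e x ^ 1]/(e x).
    have jj : e x ^ (- j) * e x ^ j = 1 by rewrite -expfzDr ?circ_neq0// addNr.
    have := circ_neq0 x.
    rewrite !mulrDr; move: (e x ^ (- j)) (e x ^ j) jj => y z yz x0.
    have -> : s * (e x * y) * (s * (z * ((e x)^-1 * f (e x)^-1))) =
       (s * s) * (y * z) * (e x * (e x)^-1) * f (e x)^-1 by ring.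
    rewrite ss yz mulfV// !mul1r addrC; congr (_ + _); ring.
  rewrite foldV -[RHS](mul0r (fold f (e x) * e x ^ n)) -wx /sym_mul; ring.
have Hz n : H n = 0.
  have [n0|n0] := leP 0 n; first exact: H0.
  by have := HN n; rewrite [H (- n)]H0 ?addr0// oppr_ge0 ltW.
have am : analytic (fun t => a t^-1 * fold f t^-1) by move=> n n0; rewrite mr// ltW.
case: (analytic_integral_domain p1 pq lmr lvr am av Hz) => [z|z].
  have mz : ae_eqc (fun t => a t * fold f t) (fun=> 0).
    apply: (LP_fourier_eq0 p1 pq lm) => n; rewrite -[n]opprK.
    by rewrite -(@cint_reflM _ (fun t => a t * fold f t)) ?z//; exact: lm.1.
  have [b' ab'] := ainv; exfalso; apply: f0; apply: (lpint_ae0 p1 lf).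
  apply: (fold_ae0 lf af); apply: aeS2 mz ab' => x /[swap] ax /[swap] Dx => /(_ Dx) mx.
  by rewrite -[LHS]mul1r -(ax Dx) mulrAC mx mul0r.
have vz : ae_eqc v (fun=> 0).
  apply: (LP_fourier_eq0 q1 qp lv) => n; rewrite -[n]opprK.
  by rewrite -(cint_reflM _ lv.1) z.
move=> /eqP; apply; apply: cint_ae0; first exact: (L1_cmeasurable (LP_mul_L1 p1 pq lh lv)).
by apply: aeS vz => x /[apply] ->; rewrite mulr0.
Qed.

End coburn_simonenko.

Theorem theorem2p9 (R : realType) (p : R) (a : R[i] -> R[i])
  (hp1 : 1 < p) (ha : GLinf a) (s : R[i]) (b : R[i] -> R[i])
  (hA : [\/ s = 1 /\ b = (fun t => a t * t),
           s = -1 /\ b = (fun t => a t * t^-1),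
           s = 1 /\ b = a
         | s = -1 /\ b = a]) :
  ker_trivial p a s b \/ coker_trivial p a s b.
Proof.
have p0 : 0 < p by rewrite (lt_trans ltr01).
have pq : p^-1 + (p / (p - 1))^-1 = 1.
  have : p - 1 != 0 by rewrite subr_eq0 gt_eqF.
  have : p != 0 by rewrite gt_eqF.
  by move=> ? ?; field; apply/andP.
have [la [a' [_ aa']]] := ha.
have inv : exists b', ae_eqc (fun t => a t * b' t) (fun=> 1) by exists a'.
have [j [ss sj bE]] : exists j : int, [/\ s * s = 1,
    [\/ j = 0, j = 1 /\ s = 1 | j = -1 /\ s = -1] &
    forall x, b (circ_pt x) = a (circ_pt x) * circ_pt x ^ j].
  case: hA => -[-> ->].
  - by exists 1; rewrite mul1r; split=> //; apply: Or32.
  - by exists (-1); rewrite mulrNN mul1r; split=> //; apply: Or33.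
  - by exists 0; rewrite mul1r; split=> [//||x]; [apply: Or31|rewrite mulr1].
  - by exists 0; rewrite mulrNN mul1r; split=> [//||x]; [apply: Or31|rewrite mulr1].
exact: (ker_or_coker_trivial hp1 pq la ss bE sj inv).
Qed.
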